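(* Let $J\in\mathbb{N}$, $N=2J+1$, and consider the true system $\rho(t)$, the adaptive model $\hat\rho(t)$ and the adaptive parameter $\hat\theta(t)$ described in the context, with $f(t)=(Kt+1)^{-p}$, where $K>0$ and $p\in\mathbb{R}$. Suppose that the pair of initial states is $(\rho(0),\hat\rho(0))=(\rho_n,\rho_m)$ for some $n,m\in\{0,\dots,2J\}$ with $m\neq J$, that $u(t)=0$ for all $t\ge 0$, and that $\hat\theta(0)$ is deterministic. Then the following hold. 1. For the mean of $\hat\theta(t)$: if $p\in(-\infty,1]$, then $$\lim_{t\to\infty}\mathbb{E}_w[\hat\theta(t)]=\theta\,\frac{J-n}{J-m};$$ if $p>1$, then $\lim_{t\to\infty}\mathbb{E}_w[\hat\theta(t)]$ exists and depends on $\hat\theta(0)$ (i.e. with all other data fixed, the limit is a nonconstant function of $\hat\theta(0)$). 2. For the variance $V(\hat\theta(t)):=\mathbb{E}_w\big[(\hat\theta(t)-\mathbb{E}_w[\hat\theta(t)])^2\big]$: if $p>1$, then $$\limsup_{t\to\infty}V(\hat\theta(t))\le \frac18,$$ and $$\lim_{t\to\infty}V(\hat\theta(t))=\begin{cases}0,& p\in(0,1],\\ \tfrac18,& p=0,\\ \infty,& p<0.\end{cases}$$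
   Context: Notation: $[X,Y]_-:=XY-YX$; $\mathcal{S}(\mathbb{C}^N):=\{\rho\in\mathbb{C}^{N\times N}: \rho=\rho^*\ge 0,\ \mathrm{Tr}[\rho]=1\}$. Matrices: $J_z:=\mathrm{diag}(J,J-1,\dots,-J+1,-J)\in\mathbb{C}^{N\times N}$, and $J_y\in\mathbb{C}^{N\times N}$ is the Hermitian tridiagonal matrix with zero diagonal, $(J_y)_{m,m+1}=-\mathrm{i}c_m$, $(J_y)_{m+1,m}=\mathrm{i}c_m$, $c_m=\frac12\sqrt{(2J+1-m)m}$, $m=1,\dots,N-1$. For $\omega,u\in\mathbb{R}$, $H_\omega(u):=\omega J_z+uJ_y$. For $n\in\{0,\dots,2J\}$, $\rho_n\in\mathcal{S}(\mathbb{C}^N)$ is the state with $J_z\rho_n=\rho_nJ_z=(J-n)\rho_n$, i.e. the diagonal matrix whose only nonzero entry is a $1$ in the $(n+1)$-th diagonal position. True system: with constants $\omega>0$, $M>0$, $\eta\in(0,1]$, control input $u(t)$ and measurement output $y(t)$, $$d\rho(t)=\mathrm{i}[H_\omega(u(t)),\rho(t)]_-dt-\tfrac{M}{2}[J_z,[J_z,\rho(t)]_-]_-dt+\sqrt{\eta M}\,\big(J_z\rho(t)+\rho(t)J_z-2\mathrm{Tr}[J_z\rho(t)]\rho(t)\big)\big(dy(t)-2\sqrt{\eta M}\,\mathrm{Tr}[J_z\rho(t)]dt\big),$$ $\rho(0)\in\mathcal{S}(\mathbb{C}^N)$. Put $\theta:=\sqrt{\eta M}$, $x(t):=\mathrm{Tr}[J_z\rho(t)]$.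 The output satisfies $dy(t)=dw(t)+2\theta x(t)dt$, where $w$ is a standard Wiener process. Adaptive model: with given constants $\hat\omega>0$, $\hat\eta\in(0,1]$, and with $\hat\theta(t)=\sqrt{\hat\eta\hat M(t)}$ (i.e. $\hat M(t)=\hat\theta(t)^2/\hat\eta$), $$d\hat\rho(t)=\mathrm{i}[H_{\hat\omega}(u(t)),\hat\rho(t)]_-dt-\tfrac{\hat M(t)}{2}[J_z,[J_z,\hat\rho(t)]_-]_-dt+\hat\theta(t)\big(J_z\hat\rho(t)+\hat\rho(t)J_z-2\mathrm{Tr}[J_z\hat\rho(t)]\hat\rho(t)\big)\big(dy(t)-2\hat\theta(t)\mathrm{Tr}[J_z\hat\rho(t)]dt\big),$$ $\hat\rho(0)\in\mathcal{S}(\mathbb{C}^N)$. Put $\hat x(t):=\mathrm{Tr}[J_z\hat\rho(t)]$. Parameter tuning law: $\hat\theta(t)$ is the solution of $$d\hat\theta(t)=f(t)\Big\{-\hat x(t)^2\hat\theta(t)dt+\tfrac12\hat x(t)dy(t)\Big\},\qquad f(t)=(Kt+1)^{-p},\ t\ge0,$$ with given deterministic initial value $\hat\theta(0)$. $\mathbb{E}_w[\,\cdot\,]$ denotes expectation with respect to $w$, conditional on $(\rho(0),\hat\rho(0))$. All stochastic differential equations are in the Itô sense. *)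

(* Defs.v *)
(* MathComp / MathComp-Analysis *)
From HB Require Import structures.
From mathcomp Require Import all_boot all_order all_algebra.
From mathcomp Require Import complex.
From mathcomp Require Import all_classical all_reals all_analysis.

Set Implicit Arguments.
Unset Strict Implicit.
Unset Printing Implicit Defensive.

Import Order.TTheory GRing.Theory Num.Theory.
Import numFieldNormedType.Exports.

Local Open Scope classical_set_scope.
Local Open Scope ring_scope.

Section angular_momentum.
Context {R : realType} (J : nat).
Local Notation C := R[i].
Local Notation N := (2 * J).+1.

(* Indices start at 0: row i here is row i + 1 of the usual 1-based matrices,
   and the basis vector i is the eigenvector of Jz for the value J - i. *)
Definition Jz : 'M[C]_N := diag_mx (\row_(i < N) (J%:R - i%:R)).

Definition Jy_coef (k : nat) : R :=
  2^-1 * Num.sqrt (((2 * J).+1%:R - k%:R) * k%:R).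

Definition Jy : 'M[C]_N :=
  \matrix_(i < N, j < N)
    if j == i.+1 :> nat then - 'i%C * (Jy_coef i.+1)%:C%C
    else if i == j.+1 :> nat then 'i%C * (Jy_coef j.+1)%:C%C
    else 0.

Definition hamiltonian (omega u : R) : 'M[C]_N :=
  omega%:C%C *: Jz + u%:C%C *: Jy.

Definition commutator (A B : 'M[C]_N) : 'M[C]_N := A *m B - B *m A.

Definition adjoint m n (A : 'M[C]_(m, n)) : 'M[C]_(n, m) :=
  map_mx Num.conj A^T.

(* In the partial order of R[i], 0 <= z means that z is real and nonnegative. *)
Definition density_matrix (A : 'M[C]_N) : Prop :=
  [/\ A = adjoint A,
      forall v : 'cV[C]_N, 0 <= (adjoint v *m A *m v) ord0 ord0
    & \tr A = 1].

Definition pure_state (n : 'I_N) : 'M[C]_N := delta_mx n n.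

(* The trace Tr[Jz A]; it is real whenever A is Hermitian, and the real part
   turns it into an element of R. *)
Definition mean_Jz (A : 'M[C]_N) : R := complex.Re (\tr (Jz *m A)).

(* i [H_omega(u), A] - (kappa / 2) [Jz, [Jz, A]] *)
Definition lindblad (omega kappa u : R) (A : 'M[C]_N) : 'M[C]_N :=
  'i%C *: commutator (hamiltonian omega u) A
  - (kappa / 2)%:C%C *: commutator Jz (commutator Jz A).

(* Jz A + A Jz - 2 Tr[Jz A] A *)
Definition backaction (A : 'M[C]_N) : 'M[C]_N :=
  Jz *m A + A *m Jz - (2 * mean_Jz A)%:C%C *: A.

End angular_momentum.

(* Processes are functions R -> T -> R of time and outcome; only their values
   at nonnegative times matter. *)
Section ito_calculus.
Context {R : realType} {d : measure_display} {T : measurableType d}.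
Implicit Types (P : probability T R) (F : R -> set (set T)).
Implicit Types X W a b H : R -> T -> R.

Definition filtration F : Prop :=
  [/\ forall t, 0 <= t -> sigma_algebra setT (F t),
      forall t, 0 <= t -> F t `<=` measurable
    & forall s t, 0 <= s -> s <= t -> F s `<=` F t].

Definition rv_measurable (G : set (set T)) (X : T -> R) : Prop :=
  forall B : set R, measurable B -> G (X @^-1` B).

Definition adapted F X : Prop :=
  forall t, 0 <= t -> rv_measurable (F t) (X t).

Definition jointly_measurable X : Prop :=
  measurable_fun ([set s : R | 0 <= s] `*` [set: T])
    (fun z : R * T => X z.1 z.2).

Definition continuous_paths P X : Prop :=
  {ae P, forall w, {within [set s : R | 0 <= s], continuous (X ^~ w)}}.

Definition wiener P F W : Prop :=
  [/\ adapted F W,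
      {ae P, forall w, W 0 w = 0},
      continuous_paths P W,
      forall s t (B : set R), 0 <= s -> s < t -> measurable B ->
        let Wst w := W t w - W s w in
        P (Wst @^-1` B) = normal_prob 0 (Num.sqrt (t - s)) B
    & forall s t (A : set T) (B : set R), 0 <= s -> s < t ->
        F s A -> measurable B ->
        let Wst w := W t w - W s w in
        P (A `&` Wst @^-1` B) = (P A * P (Wst @^-1` B))%E].

Record simple_process F : Type := SimpleProcess {
  sp_size : nat;
  sp_time : nat -> R;
  sp_val : nat -> T -> R;
  sp_time0 : 0 <= sp_time 0;
  sp_time_nd : forall i, sp_time i <= sp_time i.+1;
  sp_bounded : forall i, exists c : R, forall w, `|sp_val i w| <= c;
  sp_adapted : forall i, rv_measurable (F (sp_time i)) (sp_val i) }.

Definition simple_eval F (S : simple_process F) (s : R) (w : T) : R :=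
  \sum_(i < sp_size S)
    sp_val S i w * \1_(`]sp_time S i, sp_time S i.+1]%classic) s.

Definition simple_integral F W (S : simple_process F) (t : R) (w : T) : R :=
  \sum_(i < sp_size S)
    sp_val S i w * (W (Num.min t (sp_time S i.+1)) w
                    - W (Num.min t (sp_time S i)) w).

(* Convergence to 0 in probability of nonnegative random variables. *)
Definition tends_to0_in_prob P (Z : nat -> T -> \bar R) : Prop :=
  forall e : R, 0 < e ->
    P [set w | (e%:E < Z k w)%E] @[k --> \oo] --> 0%E.

(* I is (a version of) the Ito integral of H with respect to W over [0, t]:
   the limit in probability of the integrals of simple processes S k such that
   \int_0^t (S k - H)^2 ds tends to 0 in probability. *)
Definition is_ito_integral P F W H (t : R) (I : T -> R) : Prop :=
  exists S : nat -> simple_process F,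
    tends_to0_in_prob P (fun k w =>
      (\int[lebesgue_measure]_(s in `[0%R, t]%classic)
         ((simple_eval (S k) s w - H s w) ^+ 2)%:E)%E)
    /\ tends_to0_in_prob P (fun k w =>
         `|simple_integral W (S k) t w - I w|%:E).

(* X is an Ito process with stochastic differential dX = a dt + b dW. *)
Record ito_process P F W X a b : Prop := ItoProcess {
  ito_adapted : adapted F X;
  ito_continuous : continuous_paths P X;
  ito_drift_adapted : adapted F a;
  ito_drift_measurable : jointly_measurable a;
  ito_drift_integrable : {ae P, forall w, forall t, 0 <= t ->
    lebesgue_measure.-integrable `[0, t]%classic (fun s => (a s w)%:E)};
  ito_diffusion_adapted : adapted F b;
  ito_diffusion_measurable : jointly_measurable b;
  ito_diffusion_integrable : {ae P, forall w, forall t, 0 <= t ->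
    (\int[lebesgue_measure]_(s in `[0%R, t]%classic) ((b s w) ^+ 2)%:E
       < +oo)%E};
  ito_equation : forall t, 0 <= t ->
    is_ito_integral P F W b t (fun w =>
      X t w - X 0 w - \int[lebesgue_measure]_(s in `[0, t]%classic) a s w) }.

(* Entrywise, on real and imaginary parts. *)
Definition matrix_ito_process P F W n (X A B : R -> T -> 'M[R[i]]_n) : Prop :=
  forall i j : 'I_n,
    ito_process P F W (fun t w => complex.Re (X t w i j))
      (fun t w => complex.Re (A t w i j)) (fun t w => complex.Re (B t w i j))
    /\ ito_process P F W (fun t w => complex.Im (X t w i j))
      (fun t w => complex.Im (A t w i j)) (fun t w => complex.Im (B t w i j)).

(* The stochastic differential D.1 dt + D.2 dW. *)
Definition differential : Type := ((R -> T -> R) * (R -> T -> R))%type.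

End ito_calculus.

Section adaptive_filter.
Context {R : realType} {d : measure_display} {T : measurableType d}.
Context (P : probability T R) (F : R -> set (set T)) (W : R -> T -> R).
Context (J : nat).
Local Notation state := 'M[R[i]]_((2 * J).+1).

(* dy = 2 theta x dt + dW with x = Tr[Jz rho] *)
Definition output_differential (theta : R) (rho : R -> T -> state) :
    @differential R d T :=
  (fun t w => 2 * theta * mean_Jz (rho t w), fun _ _ => 1).

(* d rho = lindblad(rho) dt
           + theta(t) backaction(rho) (dy - 2 theta(t) Tr[Jz rho] dt),
   where a term g dy with dy = D.1 dt + D.2 dW stands for
   g D.1 dt + g D.2 dW. *)
Definition filter_equation (omega : R) (kappa theta u : R -> T -> R)
    (dy : @differential R d T) (rho : R -> T -> state) : Prop :=
  matrix_ito_process P F W rho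
    (fun t w => lindblad omega (kappa t w) (u t w) (rho t w)
       + (theta t w * (dy.1 t w - 2 * theta t w * mean_Jz (rho t w)))%:C%C
         *: backaction (rho t w))
    (fun t w => (theta t w * dy.2 t w)%:C%C *: backaction (rho t w)).

Definition gain (K p t : R) : R := (K * t + 1) `^ (- p).

(* d thetah = f(t) (- xh^2 thetah dt + (1/2) xh dy) with xh = Tr[Jz rhoh] *)
Definition tuning_law (K p : R) (dy : @differential R d T)
    (rhoh : R -> T -> state) (thetah : R -> T -> R) : Prop :=
  ito_process P F W thetah
    (fun t w => gain K p t *
       (- mean_Jz (rhoh t w) ^+ 2 * thetah t w
        + 2^-1 * mean_Jz (rhoh t w) * dy.1 t w))
    (fun t w => gain K p t * (2^-1 * mean_Jz (rhoh t w) * dy.2 t w)).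

(* Here Mh(t) = thetah(t)^2 / etah. *)
Record adaptive_system (omega M eta omegah etah K p : R) (u y : R -> T -> R)
    (rho rhoh : R -> T -> state) (thetah : R -> T -> R) (theta0 : R) : Prop :=
  AdaptiveSystem {
  rho_init : forall w, density_matrix (rho 0 w);
  rhoh_init : forall w, density_matrix (rhoh 0 w);
  thetah_init : forall w, thetah 0 w = theta0;
  output_eq : let dy := output_differential (Num.sqrt (eta * M)) rho in
    ito_process P F W y dy.1 dy.2;
  true_system : let theta := Num.sqrt (eta * M) in
    filter_equation omega (fun _ _ => M) (fun _ _ => theta) u
      (output_differential theta rho) rho;
  adaptive_model : let theta := Num.sqrt (eta * M) in
    filter_equation omegah (fun t w => thetah t w ^+ 2 / etah) thetah u
      (output_differential theta rho) rhoh;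
  adaptation : let theta := Num.sqrt (eta * M) in
    tuning_law K p (output_differential theta rho) rhoh thetah }.

End adaptive_filter.

(* Main.v *)
(* Along an eigenstate of Jz, the diagonal entries X of a filter state satisfy
   dX = a dt + b dw with X = c at time 0 and |a|, |b| <= C |X - c|, where C is
   bounded on compact time intervals along each path; such a process stays at c.
   Hence Tr[Jz rho] = J - n and Tr[Jz rhoh] = J - m at all times, almost surely.
   With B = J - m and L = theta (J - n) / B the tuning law becomes the linear
   equation d thetah = - B^2 f (thetah - L) dt + (B / 2) f dw. Multiplying
   thetah - L by E = exp (B^2 \int f) leaves the Wiener integral of the
   deterministic function E B f / 2, so that
     E[thetah(t)] = L + (thetah(0) - L) / E(t),
     V(thetah(t)) = E(t)^-2 \int_0^t (E B f / 2)^2.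
   As (E^2)' = 2 B^2 f E^2, the variance is 1/8 of the average of f with respect
   to the measure d(E^2) on [0, t], of mass E(t)^2 - 1, normalised by E(t)^2.
   Everything then follows from the behaviour of f and \int f at infinity, where
   \int f diverges exactly when p <= 1. *)
Require Import Defs.
From mathcomp Require Import all_boot all_order all_algebra.
From mathcomp Require Import complex ring lra.
From mathcomp Require Import all_classical all_reals all_analysis measurable_realfun.
Import Order.TTheory GRing.Theory Num.Theory.
Import numFieldNormedType.Exports.
Local Open Scope classical_set_scope.
Local Open Scope ring_scope.
Set Implicit Arguments.
Unset Strict Implicit.
Unset Printing Implicit Defensive.

(** * Square-integrable random variables *)

(** The Ito integral is given only through one sequence of simple processes converging in
    probability, with no control of moments. Everything therefore goes through sums over finite
    grids. Lenglart's inequality shows that every approximation of the integrand leads to the same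
    integral, so left-endpoint Euler sums may be used; moments are computed exactly for these sums,
    and a Fatou lemma for convergence in probability carries the bounds to the limit. The growth
    constant C is random, because the coefficients of the adaptive filter contain [thetah].
    Uniqueness is thus localised on events where a fixed integer bounds both the path and the
    constant; every path lies in such an event. In the linear equation the martingale part N is
    known only through limits in probability, while the integrating factor E is smooth. The product
    rule is therefore a pathwise statement about sums of E dN, and summation by parts compares these
    sums in L2 with Wiener sums of the deterministic function E B f / 2. *)

Lemma measurable_set_lt {R : realType} {d} {T : measurableType d} (X Y : T -> R) :
  measurable_fun setT X -> measurable_fun setT Y ->
  measurable [set w | X w < Y w].
Proof.
move=> mX mY; have := measurable_funB mY mX measurableT (measurable_itv `]0, +oo[).
rewrite setTI; congr measurable; apply/seteqP; split => w;
  by rewrite /= in_itv/= andbT subr_gt0.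
Qed.

Section real_integrable.
Context {R : realType} {d : measure_display} {T : measurableType d}.
Variable P : probability T R.
Implicit Types X Y : T -> R.

Definition L1 X := P.-integrable setT (EFin \o X).
Definition L2 X := measurable_fun setT X /\ L1 (fun w => X w ^+ 2).

Lemma L1D X Y : L1 X -> L1 Y -> L1 (fun w => X w + Y w).
Proof. by move=> iX iY; exact: (integrableD measurableT iX iY). Qed.

Lemma L1B X Y : L1 X -> L1 Y -> L1 (fun w => X w - Y w).
Proof. by move=> iX iY; exact: (integrableB measurableT iX iY). Qed.

Lemma L1Zl X k : L1 X -> L1 (fun w => k * X w).
Proof. by move=> iX; exact: (integrableZl measurableT k iX). Qed.

Lemma L1_le X Y : measurable_fun setT X -> L1 Y ->
  (forall w, `|X w| <= Y w) -> L1 X.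
Proof.
move=> mX iY XY; apply: (le_integrable _ _ _ iY) => //.
  exact/measurable_EFinP.
by move=> w _; rewrite /= lee_fin (le_trans (XY w))// ler_norm.
Qed.

Lemma L1_cst k : L1 (cst k).
Proof. exact: finite_measure_integrable_cst. Qed.

Lemma L1_bounded X k : measurable_fun setT X -> (forall w, `|X w| <= k) -> L1 X.
Proof. by move=> mX; apply: L1_le => //; exact: L1_cst. Qed.

Lemma L1_sum (I : Type) (s : seq I) (p : pred I) (X : I -> T -> R) :
  (forall i, p i -> L1 (X i)) -> L1 (fun w => \sum_(i <- s | p i) X i w).
Proof.
move=> iX; elim: s => [|i s IH].
  under [X in L1 X]eq_fun do rewrite big_nil.
  exact: L1_cst.
under [X in L1 X]eq_fun do rewrite big_cons.
case: (boolP (p i)) => pi //; apply: L1D => //; exact: iX.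
Qed.

Lemma L2_L1 X : L2 X -> L1 X.
Proof.
move=> [mX iX]; apply: (@L1_le _ (fun w => X w ^+ 2 + 1)) => //.
  by apply: L1D => //; exact: L1_cst.
move=> w; rewrite -real_normK ?num_real//.
by have := sqr_ge0 (`|X w| - 1); set u := `|X w|; nra.
Qed.

Lemma L2M X Y : L2 X -> L2 Y -> L1 (fun w => X w * Y w).
Proof.
move=> [mX iX] [mY iY]; apply: (@L1_le _ (fun w => X w ^+ 2 + Y w ^+ 2)).
- exact: measurable_funM.
- exact: L1D.
- move=> w; rewrite normrM -(real_normK (num_real (X w))).
  rewrite -(real_normK (num_real (Y w))).
  move: (normr_ge0 (X w)) (normr_ge0 (Y w)); set a := `|X w|; set b := `|Y w|.
  by have := sqr_ge0 (a - b); nra.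
Qed.

Lemma L2D X Y : L2 X -> L2 Y -> L2 (fun w => X w + Y w).
Proof.
move=> hX hY; have iXY := L2M hX hY; case: hX hY => mX iX [mY iY].
split; first exact: measurable_funD.
under [X in L1 X]eq_fun do rewrite sqrrD -mulr_natl.
by apply: L1D => //; apply: L1D => //; exact: L1Zl.
Qed.

Lemma L2Zl X k : L2 X -> L2 (fun w => k * X w).
Proof.
move=> [mX iX]; split; first exact: measurable_funM.
under [X in L1 X]eq_fun do rewrite exprMn.
exact: L1Zl.
Qed.

Lemma L2B X Y : L2 X -> L2 Y -> L2 (fun w => X w - Y w).
Proof.
move=> hX hY; have := L2D hX (L2Zl (-1) hY).
by under [X in L2 X -> _]eq_fun do rewrite mulN1r.
Qed.

Lemma L2_bounded X k : measurable_fun setT X -> (forall w, `|X w| <= k) -> L2 X.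
Proof.
move=> mX Xk; split=> //; apply: (@L1_bounded _ (k ^+ 2)).
  exact: measurable_funX.
move=> w; rewrite normrX lerXn2r ?nnegrE//.
exact: le_trans (Xk w).
Qed.

Lemma L2_cst k : L2 (cst k).
Proof. by apply: (@L2_bounded _ `|k|). Qed.

Lemma L2_sum (I : Type) (s : seq I) (p : pred I) (X : I -> T -> R) :
  (forall i, p i -> L2 (X i)) -> L2 (fun w => \sum_(i <- s | p i) X i w).
Proof.
move=> iX; elim: s => [|i s IH].
  under [X in L2 X]eq_fun do rewrite big_nil.
  exact: L2_cst.
under [X in L2 X]eq_fun do rewrite big_cons.
case: (boolP (p i)) => pi //; apply: L2D => //; exact: iX.
Qed.

Definition Ex X := \int[P]_w X w.

Lemma ExD X Y : L1 X -> L1 Y -> Ex (fun w => X w + Y w) = Ex X + Ex Y.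
Proof. by move=> iX iY; exact: RintegralD. Qed.

Lemma ExB X Y : L1 X -> L1 Y -> Ex (fun w => X w - Y w) = Ex X - Ex Y.
Proof. by move=> iX iY; exact: RintegralB. Qed.

Lemma ExZl X k : L1 X -> Ex (fun w => k * X w) = k * Ex X.
Proof. by move=> iX; exact: RintegralZl. Qed.

Lemma Ex_cst k : Ex (cst k) = k.
Proof.
have PT : P setT = 1%E by exact: probability_setT.
by rewrite /Ex Rintegral_cst// [X in fine X]PT mulr1.
Qed.

Lemma Ex_ge0 X : (forall w, 0 <= X w) -> 0 <= Ex X.
Proof. by move=> X0; exact: Rintegral_ge0. Qed.

Lemma le_Ex X Y : L1 X -> L1 Y -> (forall w, X w <= Y w) -> Ex X <= Ex Y.
Proof. by move=> iX iY XY; exact: le_Rintegral. Qed.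

Lemma Ex_sum (I : Type) (s : seq I) (p : pred I) (X : I -> T -> R) :
  (forall i, p i -> L1 (X i)) ->
  Ex (fun w => \sum_(i <- s | p i) X i w) = \sum_(i <- s | p i) Ex (X i).
Proof.
move=> iX; elim: s => [|i s IH].
  rewrite big_nil -[RHS](Ex_cst 0); congr Ex.
  by apply/funext => w; rewrite big_nil.
rewrite big_cons; under [X in Ex X]eq_fun do rewrite big_cons.
case: (boolP (p i)) => pi //; rewrite ExD ?IH//; [exact: iX|exact: L1_sum].
Qed.

Lemma Ex_indic A : measurable A -> Ex \1_A = fine (P A).
Proof. by move=> mA; rewrite /Ex /Rintegral integral_indic// setIT. Qed.

Lemma L1_fin X : L1 X -> (\int[P]_w (X w)%:E = (Ex X)%:E)%E.
Proof. by move=> iX; rewrite /Ex /Rintegral fineK//; exact: integrable_fin_num. Qed.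

Lemma L1_ge0 X : measurable_fun setT X -> (forall w, 0 <= X w) ->
  (\int[P]_w (X w)%:E < +oo)%E -> L1 X.
Proof.
move=> mX X0 h; apply/integrableP; split; first exact/measurable_EFinP.
by under eq_integral do rewrite /= ger0_norm//.
Qed.

End real_integrable.

(** * Products of independent random variables *)

Section independence.
Context {R : realType} {d : measure_display} {T : measurableType d}.
Variables (P : probability T R) (X Y : T -> R).
Hypotheses (mX : measurable_fun setT X) (mY : measurable_fun setT Y).
Hypothesis XY_indep : forall A B : set R, measurable A -> measurable B ->
  P (X @^-1` A `&` Y @^-1` B) = (P (X @^-1` A) * P (Y @^-1` B))%E.

Let mX' : {mfun T >-> R} := mfun_Sub (mem_set mX).
Let mY' : {mfun T >-> R} := mfun_Sub (mem_set mY).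
Let XY (w : T) : R * R := (X w, Y w).
Let mXY : measurable_fun setT XY.
Proof. exact: measurable_fun_pair. Qed.
Let mXY' : {mfun T >-> (R * R)%type} := mfun_Sub (mem_set mXY).
Let muX := distribution P mX'.
Let muY := distribution P mY'.
Let muXY := distribution P mXY'.

Let muXYE (A : set (R * R)) : measurable A -> (muX \x muY)%E A = muXY A.
Proof.
apply: product_measure_unique => B C mB mC.
rewrite /muXY /distribution /pushforward /= -XY_indep//.
Qed.

(** By [muXYE] the joint law of (X, Y) is the product of the marginal laws, since the two agree on
    rectangles. Tonelli gives integrability of the product, after which Fubini factorises its
    integral. *)
Lemma indep_Ex : L1 P X -> L1 P Y ->
  L1 P (X \* Y) /\ Ex P (X \* Y) = Ex P X * Ex P Y.
Proof.
move=> iX iY.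
pose mulE (z : R * R) : \bar R := (z.1 * z.2)%:E.
have mp : measurable_fun setT mulE.
  by apply/measurable_EFinP; apply: measurable_funM.
have iXY : P.-integrable setT (EFin \o (X \* Y)).
  apply/integrableP; split.
    by apply/measurable_EFinP; exact: measurable_funM.
  rewrite (_ : (\int[P]_x _)%E = \int[muXY]_z `|mulE z|)%E; last first.
    by rewrite ge0_integral_distribution//; exact: measurableT_comp.
  rewrite -(@eq_measure_integral _ _ _ _ _ (muX \x muY)%E); last first.
    by move=> A mA _; rewrite /= muXYE.
  rewrite fubini_tonelli1; last 2 first.
  - exact: measurableT_comp.
  - by [].
  rewrite /fubini_F /=.
  under eq_integral.
    move=> x _; under eq_integral do rewrite normrM EFinM.
    rewrite ge0_integralZl//; last first.
      by do 2 apply: measurableT_comp => //.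
    over.
  rewrite /= ge0_integralZr//; last 2 first.
  - by do 2 apply: measurableT_comp => //.
  - by apply: integral_ge0.
  rewrite !ge0_integral_distribution//=; try by do 2 apply: measurableT_comp => //.
  apply: lte_mul_pinfty.
  - exact: integral_ge0.
  - rewrite ge0_fin_numE; last exact: integral_ge0.
    by case/integrableP: iX.
  - by case/integrableP: iY.
split => //.
rewrite /Ex /Rintegral.
rewrite (_ : (\int[P]_x (X x * Y x)%:E)%E = \int[muXY]_z mulE z)%E; last first.
  by rewrite integral_distribution.
rewrite -(@eq_measure_integral _ _ _ _ _ (muX \x muY)%E); last first.
  by move=> A mA _; rewrite /= muXYE.
rewrite -integral12_prod_meas1; last first.
  have : muXY.-integrable setT mulE.
    exact: (@integrable_pushforward _ _ _ _ _ XY _ P).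
  move=> /integrableP[_ h]; apply/integrableP; split => //.
  rewrite (@eq_measure_integral _ _ _ _ muXY)//.
  by move=> A mA _; rewrite /= muXYE.
rewrite /fubini_F /=.
have iY' : muY.-integrable setT EFin.
  exact: (@integrable_pushforward _ _ _ _ _ Y _ P).
have hY : (\int[muY]_y y%:E = (\int[P]_w Y w)%:E)%E.
  by rewrite integral_distribution// /Rintegral fineK//; exact: integrable_fin_num.
rewrite /mulE /=.
under eq_integral.
  move=> x _; under eq_integral do rewrite EFinM.
  rewrite integralZl// hY.
  over.
rewrite /= integralZr//; last exact: (@integrable_pushforward _ _ _ _ _ X _ P).
rewrite integral_distribution// fineM//.
exact: (integrable_fin_num _ iX).
Qed.

End independence.

(** The derivative is two-sided at the end points too, so [F] is continuous there and the one-sided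
    limits in the fundamental theorem are immediate. The degenerate interval is included. *)
Lemma FTC2_closed {R : realType} (f F : R -> R) (a b : R) : a <= b ->
  {within `[a, b], continuous f} ->
  (forall x, a <= x <= b -> is_derive x 1 F (f x)) ->
  (\int[lebesgue_measure]_(x in `[a, b]) (f x)%:E = (F b - F a)%:E)%E.
Proof.
rewrite le_eqVlt => /predU1P[<- _ _|ab cf dF].
  by rewrite set_itv1 integral_set1 subrr.
have cF x : a <= x <= b -> F y @[y --> x] --> F x.
  move=> /dF xd; apply: differentiable_continuous.
  exact/derivable1_diffP/(@ex_derive _ _ _ _ _ _ _ xd).
rewrite EFinB; apply: continuous_FTC2 => //.
- split.
  + move=> x; rewrite in_itv/= => /andP[/ltW ax /ltW xb].
    by have xd := dF x; apply: ex_derive; apply: xd; rewrite ax.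
  + by apply: cvg_at_right_filter; apply: cF; rewrite lexx ltW.
  + by apply: cvg_at_left_filter; apply: cF; rewrite lexx ltW.
- move=> x; rewrite in_itv/= => /andP[/ltW ax /ltW xb].
  have xd : is_derive x 1 F (f x) by apply: dF; rewrite ax.
  by rewrite derive1E derive_val.
Qed.

(** * Moments of the centred normal law *)

Section normal_moments.
Context {R : realType}.
Local Notation mu := (@lebesgue_measure R).

Lemma ge0_integralT_opp (G : R -> R) : (forall x, 0 <= G x) -> continuous G ->
  (\int[mu]_x (G x)%:E = \int[mu]_x (G (- x))%:E)%E.
Proof.
move=> G0 cG.
have split0 (H : R -> R) : (forall x, 0 <= H x) -> continuous H ->
    (\int[mu]_x (H x)%:E = \int[mu]_(x in `[0%R, +oo[) (H x)%:E +
      \int[mu]_(x in `[0%R, +oo[) (H (- x))%:E)%E.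
  move=> H0 cH; have mH := continuous_measurable_fun cH.
  rewrite -(setUv [set x : R | 0 <= x]) ge0_integral_setU//=; last 5 first.
  - by rewrite -set_itvcy.
  - by apply: measurableC; rewrite -set_itvcy.
  - by apply/measurable_EFinP; rewrite setUv.
  - by move=> x _; rewrite lee_fin.
  - exact/disj_setPCl.
  congr (_ + _)%E; rewrite -set_itvcy// setCitvr.
  rewrite integral_itv_bndo_bndc; last exact/measurable_EFinP/measurable_funTS.
  rewrite -{1}oppr0 ge0_integration_by_substitutionNy//.
  exact: continuous_subspaceT.
rewrite (split0 G)// (split0 (fun x => G (- x))) //.
  by rewrite addeC; congr (_ + _)%E; apply: eq_integral => x _; rewrite opprK.
by move=> x; apply: continuous_comp; [exact: opp_continuous|exact: cG].
Qed.

Variable s : R.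
Hypothesis s_gt0 : 0 < s.
Let s_neq0 : s != 0. Proof. by rewrite gt_eqF. Qed.

(** The Radon-Nikodym derivative of [normal_prob] agrees almost everywhere with [normal_pdf],
    because both have the same integral over every measurable set. *)
Lemma ge0_integral_normal_prob (f : R -> \bar R) :
  (forall x, 0 <= f x)%E -> measurable_fun setT f ->
  (\int[normal_prob 0 s]_x f x = \int[mu]_x (f x * (normal_pdf 0 s x)%:E))%E.
Proof.
move=> f0 mf; have dom := normal_prob_dominates 0 s.
rewrite -(Radon_Nikodym_SigmaFinite.change_of_variables dom)//.
have iRN := Radon_Nikodym_SigmaFinite.f_integrable dom.
apply: ae_eq_integral => //.
- by apply: emeasurable_funM => //; exact: measurable_int iRN.
- apply: emeasurable_funM => //; apply/measurable_EFinP.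
  exact: measurable_normal_pdf.
- apply: ae_eqe_mul2l; apply: integral_ae_eq => //.
  + by apply/measurable_EFinP; exact: measurable_normal_pdf.
  + move=> A _ mA.
    by rewrite -(Radon_Nikodym_SigmaFinite.f_integral dom).
Qed.

Let pdf := normal_pdf 0 s.

Let pdfE x : pdf x = normal_peak s * expR (- x ^+ 2 / (s ^+ 2 *+ 2)).
Proof. by rewrite /pdf normal_pdfE// /normal_fun subr0. Qed.

Let pdf_derive (x : R) : is_derive x 1 pdf (- x / s ^+ 2 * pdf x).
Proof.
rewrite pdfE (_ : pdf = fun x => normal_peak s * expR (- x ^+ 2 / (s ^+ 2 *+ 2)));
  last by apply/funext => y; rewrite pdfE.
apply: is_derive_eq.
rewrite /GRing.scale /=.
by field; rewrite s_neq0.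
Qed.

Let cpdf : continuous pdf. Proof. exact: continuous_normal_pdf. Qed.

(** The inequality exp(y) >= 1 + y at y = x^2 / (2 s^2) bounds x pdf(x) by a constant over x. This
    is the boundary term of the integration by parts in [itv_integral]. *)
Let xpdf_cvg0 : n%:R * pdf n%:R @[n --> \oo] --> (0 : R).
Proof.
have h : (normal_peak s * (s ^+ 2 *+ 2)) * n%:R^-1 @[n --> \oo] --> (0 : R).
  rewrite -(mulr0 (normal_peak s * (s ^+ 2 *+ 2))).
  apply: cvgMr; apply/gtr0_cvgV0; last exact: cvgr_idn.
  by exists 1%N => // n /= n0; rewrite ltr0n.
apply: (squeeze_cvgr _ (cvg_cst 0) h).
exists 1%N => // n /= n0.
have n0' : 0 < n%:R :> R by rewrite ltr0n.
rewrite mulr_ge0 ?normal_pdf_ge0//= pdfE mulNr expRN mulrCA -mulrA.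
rewrite ler_pM2l ?normal_peak_gt0//.
rewrite ler_pdivrMr ?expR_gt0// mulrAC ler_pdivlMr// -expr2.
have := expR_ge1Dx (n%:R ^+ 2 / (s ^+ 2 *+ 2)).
set e := expR _ => he.
have s2 : 0 < s ^+ 2 *+ 2 by rewrite mulrn_wgt0// exprn_gt0.
have -> : n%:R ^+ 2 = (s ^+ 2 *+ 2) * (n%:R ^+ 2 / (s ^+ 2 *+ 2)).
  by rewrite mulrC divfK// gt_eqF.
by rewrite ler_pM2l// (le_trans _ he)// lerDr.
Qed.

Let half_pdf : (\int[mu]_(x in `[0%R, +oo[) (pdf x)%:E = (2^-1)%:E)%E.
Proof.
have := integral_normal_pdf 0 s; rewrite (ge0_symfun_integralT)//; last 2 first.
- by move=> x; exact: normal_pdf_ge0.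
- by move=> x; rewrite /= -!/(pdf _) !pdfE sqrrN.
rewrite set_itvcy.
case: (\int[mu]_(x in _) _)%E => [r [] h| |] //=; last 2 first.
- by rewrite mulr_infty gtr0_sg// mul1e.
- by rewrite mulr_infty gtr0_sg// mul1e.
by congr EFin; lra.
Qed.

Let sqr_pdf_cont : continuous (fun x : R => x ^+ 2 * pdf x : R).
Proof. by move=> x; apply: cvgM; [exact: exprn_continuous|exact: cpdf]. Qed.

Let sqr_pdf_ge0 x : 0 <= x ^+ 2 * pdf x.
Proof. by rewrite mulr_ge0 ?sqr_ge0 ?normal_pdf_ge0. Qed.

Let itv_integral n : ((\int[mu]_(x in `[0%R, n%:R]) (x ^+ 2 * pdf x)%:E =
   (s ^+ 2)%:E * \int[mu]_(x in `[0%R, n%:R]) (pdf x)%:E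
   - (s ^+ 2 * (n%:R * pdf n%:R))%:E))%E.
Proof.
case: n => [|n]; first by rewrite set_itv1 !integral_set1 mul0r mulr0 mule0 sube0.
have cc (f : R -> R) : continuous f ->
    mu.-integrable `[0, n.+1%:R] (EFin \o f).
  move=> cf; apply: continuous_compact_integrable; first exact: segment_compact.
  exact: continuous_subspaceT.
(* Since pdf' = - x pdf / s^2, the derivative of - s^2 x pdf is x^2 pdf - s^2 pdf: integration by
   parts written as a single primitive. *)
pose F x := - s ^+ 2 * (x * pdf x).
have dF (x : R) : is_derive x 1 F (x ^+ 2 * pdf x - s ^+ 2 * pdf x).
  have dp := pdf_derive x; rewrite /F; apply: is_derive_eq; rewrite /GRing.scale /=.
  by field.
have cg : continuous (fun x : R => x ^+ 2 * pdf x - s ^+ 2 * pdf x : R).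
  by move=> x; apply: cvgB; [exact: sqr_pdf_cont|apply: cvgMr; exact: cpdf].
have := @FTC2_closed R (fun x => x ^+ 2 * pdf x - s ^+ 2 * pdf x) F 0 n.+1%:R
  (ler0n _ _) (continuous_subspaceT cg) (fun x _ => dF x).
have c1 := cc _ sqr_pdf_cont; have c2 := cc _ cpdf.
rewrite integralB_EFin//; last first.
  by apply: (cc (fun x => s ^+ 2 * pdf x)) => x; apply: cvgMr; exact: cpdf.
under [X in (_ - X)%E]eq_integral do rewrite EFinM.
rewrite integralZl//.
rewrite -(fineK (integrable_fin_num _ c1))// -(fineK (integrable_fin_num _ c2))//.
move: (fine _) (fine _) => u v.
by rewrite -!EFinM -!EFinB => -[h]; congr EFin; move: h; rewrite /F; lra.
Qed.

Let half_sqr_pdf :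
  (\int[mu]_(x in `[0%R, +oo[) (x ^+ 2 * pdf x)%:E = (s ^+ 2 / 2)%:E)%E.
Proof.
have h1 := @ge0_cvgn_integral _ mu _ sqr_pdf_ge0
  (continuous_measurable_fun sqr_pdf_cont).
have h := @ge0_cvgn_integral _ mu _ (normal_pdf_ge0 0 s) (measurable_normal_pdf 0 s).
apply: (cvg_unique _ h1) => /=; first exact: ereal_hausdorff.
rewrite (_ : (s ^+ 2 / 2)%:E = ((s ^+ 2)%:E * (2^-1)%:E - (s ^+ 2 * 0)%:E)%E); last first.
  by rewrite mulr0 sube0.
rewrite (_ : (fun n : nat => _) = (fun n : nat => (s ^+ 2)%:E * \int[mu]_(x in `[0%R, n%:R]) (pdf x)%:E
   - (s ^+ 2 * (n%:R * pdf n%:R))%:E)%E); last first.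
  by apply/funext => n; exact: itv_integral.
apply: cvgeB => //.
- apply: cvgeZl => //; by rewrite -half_pdf.
- by apply: cvg_EFin; [exact: nearW|apply: cvgMr; exact: xpdf_cvg0].
Qed.

Let integral_sqr_pdf : (\int[mu]_x (x ^+ 2 * pdf x)%:E = (s ^+ 2)%:E)%E.
Proof.
rewrite (ge0_symfun_integralT)//.
  by rewrite -set_itvcy half_sqr_pdf -EFinM; congr EFin; lra.
by move=> x; rewrite /= !pdfE sqrrN.
Qed.

Context {d : measure_display} {T : measurableType d}.
Variables (P : probability T R) (X : T -> R).
Hypothesis mX : measurable_fun setT X.
Hypothesis lawX : forall B : set R, measurable B ->
  P (X @^-1` B) = normal_prob 0 s B.

Let mX' : @measurable_fun _ _ T (measurableTypeR R) setT X.
Proof. exact: mX. Qed.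

Let X' : {mfun T >-> measurableTypeR R} :=
  @mfun_Sub _ _ T (measurableTypeR R) X (mem_set mX').

Let ge0_law (f : R -> R) : (forall x, 0 <= f x) -> measurable_fun setT f ->
  (\int[P]_w (f (X w))%:E = \int[mu]_x (f x * pdf x)%:E)%E.
Proof.
move=> f0 mf.
have mEf : measurable_fun setT (EFin \o f) by exact/measurable_EFinP.
rewrite -[LHS](@ge0_integral_distribution _ _ _ _ _ P X' (EFin \o f))//.
transitivity (\int[normal_prob 0 s]_y (f y)%:E)%E.
  by apply: eq_measure_integral => A mA _; exact: lawX.
by rewrite ge0_integral_normal_prob.
Qed.

Lemma normal_sqr : L2 P X /\ Ex P (fun w => X w ^+ 2) = s ^+ 2.
Proof.
have h := ge0_law (fun x => sqr_ge0 x) (exprn_measurable 2).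
have {}h : (\int[P]_w (X w ^+ 2)%:E = (s ^+ 2)%:E)%E.
  by rewrite h integral_sqr_pdf.
split; last by rewrite /Ex /Rintegral h.
split => //; apply/integrableP; split; first exact/measurable_EFinP/measurable_funX.
under eq_integral do rewrite /= ger0_norm ?sqr_ge0//.
by rewrite h ltry.
Qed.

(** Reflection exchanges |x| - x and |x| + x and preserves the density. Both functions are
    nonnegative, so the law of X applies to them and gives them the same mean. *)
Lemma normal_mean : Ex P X = 0.
Proof.
have [i2 _] := normal_sqr; have iX := L2_L1 i2.
have iN : L1 P (fun w => `|X w|) by exact: (integrable_norm iX).
have ge1 (x : R) : 0 <= `|x| - x by rewrite subr_ge0 ler_norm.
have ge2 (x : R) : 0 <= `|x| + x by rewrite -[x in _ + x]opprK subr_ge0 -normrN ler_norm.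
have h1 := ge0_law ge1 (measurable_funB (@normr_measurable _ setT) (@measurable_id _ _ setT)).
have h2 := ge0_law ge2 (measurable_funD (@normr_measurable _ setT) (@measurable_id _ _ setT)).
have c1 : continuous (fun x : R => (`|x| - x) * pdf x).
  by move=> x; apply: cvgM; [apply: cvgB; [exact: norm_continuous|exact: cvg_id]|exact: cpdf].
have := ge0_integralT_opp (fun x => mulr_ge0 (ge1 x) (normal_pdf_ge0 0 s x)) c1.
under [X in _ = X -> _]eq_integral do rewrite normrN opprK -/(pdf _) pdfE sqrrN -pdfE.
rewrite -h1 -h2 => /(congr1 fine).
rewrite -!/(Rintegral _ _ _) -!/(Ex _ _) ExB// ExD//.
by lra.
Qed.

End normal_moments.

(** * Sums of Wiener increments on a grid *)

Section rv_measurable.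
Context {R : realType} {d : measure_display} {T : measurableType d}.
Variable G : set (set T).
Hypothesis sG : sigma_algebra setT G.
Implicit Types X Y : T -> R.

(** Measurability with respect to a sub-sigma-algebra is measurability on the space that carries the
    generated structure; the closure properties below are transported along this equivalence. *)
Lemma rv_measurableP X : rv_measurable G X <->
  measurable_fun setT (X : g_sigma_algebraType G -> R).
Proof.
have h A : (measurable : set (set (g_sigma_algebraType G))) A <-> G A.
  by rewrite /measurable /= sigma_algebra_id.
split=> [mX _ B mB|mX B mB].
  by rewrite setTI; apply/h; exact: mX.
by apply/h; rewrite -[X @^-1` B]setTI; exact: mX.
Qed.

Lemma rv_cst k : rv_measurable G (cst k : T -> R).
Proof. exact/rv_measurableP. Qed.

Lemma rvD X Y : rv_measurable G X -> rv_measurable G Y ->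
  rv_measurable G (fun w => X w + Y w).
Proof.
by move=> /rv_measurableP mX /rv_measurableP mY; exact/rv_measurableP/measurable_funD.
Qed.

Lemma rvB X Y : rv_measurable G X -> rv_measurable G Y ->
  rv_measurable G (fun w => X w - Y w).
Proof.
by move=> /rv_measurableP mX /rv_measurableP mY; exact/rv_measurableP/measurable_funB.
Qed.

Lemma rvM X Y : rv_measurable G X -> rv_measurable G Y ->
  rv_measurable G (fun w => X w * Y w).
Proof.
by move=> /rv_measurableP mX /rv_measurableP mY; exact/rv_measurableP/measurable_funM.
Qed.

Lemma rv_comp (f : R -> R) X : measurable_fun setT f -> rv_measurable G X ->
  rv_measurable G (f \o X).
Proof. by move=> mf /rv_measurableP mX; exact/rv_measurableP/measurableT_comp. Qed.

Lemma rvX X n : rv_measurable G X -> rv_measurable G (fun w => X w ^+ n).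
Proof. exact: rv_comp (exprn_measurable n). Qed.

Lemma rv_norm X : rv_measurable G X -> rv_measurable G (fun w => `|X w|).
Proof. exact: rv_comp (@normr_measurable _ setT). Qed.

Lemma rv_sum (I : Type) (s : seq I) (p : pred I) (X : I -> T -> R) :
  (forall i, p i -> rv_measurable G (X i)) ->
  rv_measurable G (fun w => \sum_(i <- s | p i) X i w).
Proof.
move=> mX; elim: s => [|i s IH].
  by under [X in rv_measurable _ X]eq_fun do rewrite big_nil; exact: rv_cst.
under [X in rv_measurable _ X]eq_fun do rewrite big_cons.
by case: (boolP (p i)) => pi //; apply: rvD => //; exact: mX.
Qed.

Lemma rv_le X Y : rv_measurable G X -> rv_measurable G Y ->
  G [set w | X w <= Y w].
Proof.
move=> mX mY; have := rvB mY mX (measurable_itv `[0, +oo[).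
by congr G; apply/seteqP; split => w; rewrite /= in_itv/= andbT subr_ge0.
Qed.

Lemma rv_indic A : G A -> rv_measurable G (\1_A : T -> R).
Proof.
move=> GA; apply/rv_measurableP; apply: measurable_indic.
by rewrite /measurable /= sigma_algebra_id.
Qed.

Lemma sigma_algebra_setI A B : G A -> G B -> G (A `&` B).
Proof.
move=> GA GB.
have h C : (measurable : set (set (g_sigma_algebraType G))) C <-> G C.
  by rewrite /measurable /= sigma_algebra_id.
by apply/h; apply: measurableI; exact/h.
Qed.

Lemma sigma_algebra_bigcapT (A : nat -> set T) :
  (forall i, G (A i)) -> G (\bigcap_i A i).
Proof.
move=> GA.
have h C : (measurable : set (set (g_sigma_algebraType G))) C <-> G C.
  by rewrite /measurable /= sigma_algebra_id.
by apply/h; apply: bigcapT_measurable => k; apply/h; exact: GA.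
Qed.

End rv_measurable.

Section wiener_increments.
Context {R : realType} {d : measure_display} {T : measurableType d}.
Variables (P : probability T R) (F : R -> set (set T)) (W : R -> T -> R).
Hypotheses (hF : filtration F) (hW : wiener P F W).
Implicit Types X Y Z : T -> R.

Lemma filtration_sigma t : 0 <= t -> sigma_algebra setT (F t).
Proof. by case: hF => h _ _; exact: h. Qed.

Lemma filtration_measurable t X : 0 <= t -> rv_measurable (F t) X ->
  measurable_fun setT X.
Proof.
case: hF => _ h _ t0 mX _ B mB; rewrite setTI; apply: (h t) => //.
exact: mX.
Qed.

Lemma filtration_mono s t X : 0 <= s -> s <= t -> rv_measurable (F s) X ->
  rv_measurable (F t) X.
Proof. by case: hF => _ _ h s0 st mX B mB; apply: (h s) => //; exact: mX. Qed.

Lemma wiener_adapted t : 0 <= t -> rv_measurable (F t) (W t).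
Proof. by case: hW => h _ _ _ _; exact: h. Qed.

Definition incr s t w := W t w - W s w.

Lemma incr_rv s t : 0 <= s -> s <= t -> rv_measurable (F t) (incr s t).
Proof.
move=> s0 st; have t0 := le_trans s0 st.
apply: rvB; [exact: filtration_sigma|exact: wiener_adapted|].
exact: (filtration_mono s0 st (wiener_adapted s0)).
Qed.

Lemma incr_measurable s t : 0 <= s -> s <= t -> measurable_fun setT (incr s t).
Proof.
by move=> s0 st; exact: filtration_measurable (le_trans s0 st) (incr_rv s0 st).
Qed.

Lemma incr_refl s : incr s s = cst 0.
Proof. by apply/funext => w; rewrite /incr subrr. Qed.

Lemma incr_moments s t : 0 <= s -> s <= t ->
  [/\ L2 P (incr s t), Ex P (incr s t) = 0 &
    Ex P (fun w => incr s t w ^+ 2) = t - s].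
Proof.
move=> s0; rewrite le_eqVlt => /predU1P[<-|st].
  rewrite incr_refl subrr; split; [exact: L2_cst|exact: Ex_cst|].
  rewrite -[RHS](Ex_cst P); congr Ex; apply/funext => w.
  by rewrite /= expr0n.
have mD := incr_measurable s0 (ltW st).
have ts0 : 0 < t - s by rewrite subr_gt0.
have law (B : set R) : measurable B ->
    P (incr s t @^-1` B) = normal_prob 0 (Num.sqrt (t - s)) B.
  by case: hW => _ _ _ h _ mB; exact: h.
have sq0 : 0 < Num.sqrt (t - s) by rewrite sqrtr_gt0.
have [h1 h2] := normal_sqr sq0 mD law.
by rewrite h2 sqr_sqrtr ?(ltW ts0)//; split => //; exact: (normal_mean sq0 mD law).
Qed.

(** The event that f of the increment lies in B says that the increment lies in the preimage of B,
    so the independence clause of [wiener] applies. That clause concerns s < t; for s = t the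
    increment is 0 and f contributes the constant f 0. *)
Lemma incr_indep_comp s t Z (f : R -> R) : 0 <= s -> s <= t ->
  rv_measurable (F s) Z -> L1 P Z -> measurable_fun setT f ->
  L1 P (f \o incr s t) ->
  L1 P (fun w => Z w * f (incr s t w)) /\
  Ex P (fun w => Z w * f (incr s t w)) = Ex P Z * Ex P (f \o incr s t).
Proof.
move=> s0; rewrite le_eqVlt => /predU1P[<- _ iZ _ _|st mZ iZ mf iD].
  rewrite incr_refl (_ : (fun w => _) = (fun w => f 0 * Z w)); last first.
    by apply/funext => w; rewrite mulrC.
  split; first exact: L1Zl.
  by rewrite ExZl// [f \o _](_ : _ = cst (f 0))// Ex_cst mulrC.
have mD := incr_measurable s0 (ltW st).
apply: indep_Ex => //.
- exact: filtration_measurable mZ.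
- exact: measurableT_comp.
- move=> A B mA mB.
  have mfB : measurable (f @^-1` B) by rewrite -[X in measurable X]setTI; exact: mf.
  have -> : (f \o incr s t) @^-1` B = incr s t @^-1` (f @^-1` B) by [].
  by case: hW => _ _ _ _ h; apply: h => //; exact: mZ.
Qed.

Lemma incr_indep s t Z : 0 <= s -> s <= t -> rv_measurable (F s) Z -> L1 P Z ->
  L1 P (fun w => Z w * incr s t w) /\ Ex P (fun w => Z w * incr s t w) = 0.
Proof.
move=> s0 st mZ iZ; have [L2D D0 _] := incr_moments s0 st.
have [h1 h2] := @incr_indep_comp s t Z idfun s0 st mZ iZ (@measurable_id _ _ _) (L2_L1 L2D).
by split => //; rewrite [LHS]h2 [X in _ * X]D0 mulr0.
Qed.

Lemma incr_indep2 s t Z : 0 <= s -> s <= t -> rv_measurable (F s) Z -> L1 P Z ->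
  L1 P (fun w => Z w * incr s t w ^+ 2) /\
  Ex P (fun w => Z w * incr s t w ^+ 2) = Ex P Z * (t - s).
Proof.
move=> s0 st mZ iZ; have [[_ iD2] _ D2] := incr_moments s0 st.
have [h1 h2] := @incr_indep_comp s t Z (fun x => x ^+ 2) s0 st mZ iZ (exprn_measurable 2) iD2.
by split => //; rewrite [LHS]h2 [X in _ * X]D2.
Qed.

Section grid.
Variables (p : nat -> R) (v : nat -> T -> R).
Hypothesis p0 : 0 <= p 0%N.
Hypothesis p_nd : forall i, p i <= p i.+1.
Hypothesis v_rv : forall l, rv_measurable (F (p l)) (v l).
Hypothesis v_L2 : forall l, exists c : R, forall w, `|v l w| <= c.

Lemma grid_ge0 l : 0 <= p l.
Proof. by elim: l => // l IH; exact: le_trans (p_nd l). Qed.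

(** The discrete stochastic integral of [v]: the coefficient [v l] is known at the left end point
    [p l], and grid points may coincide. *)
Definition grid_sum n w := \sum_(l < n) v l w * incr (p l) (p l.+1) w.

Lemma grid_sumS n w :
  grid_sum n.+1 w = grid_sum n w + v n w * incr (p n) (p n.+1) w.
Proof. by rewrite /grid_sum big_ord_recr. Qed.

Lemma grid_sum_rv n : rv_measurable (F (p n)) (grid_sum n).
Proof.
elim: n => [|n IH].
  rewrite (_ : grid_sum 0 = cst 0); last by apply/funext => w; rewrite /grid_sum big_ord0.
  by apply: rv_cst; exact: filtration_sigma.
rewrite (_ : grid_sum n.+1 = fun w => grid_sum n w + v n w * incr (p n) (p n.+1) w); last first.
  by apply/funext => w; rewrite grid_sumS.
have s := filtration_sigma (grid_ge0 n.+1).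
apply: rvD => //; first exact: filtration_mono (grid_ge0 n) (p_nd n) IH.
apply: rvM => //; first exact: filtration_mono (grid_ge0 n) (p_nd n) (v_rv n).
exact: incr_rv (grid_ge0 n) (p_nd n).
Qed.

Let v_meas l : measurable_fun setT (v l).
Proof. exact: filtration_measurable (grid_ge0 l) (v_rv l). Qed.

Let term_L2 n : L2 P (fun w => v n w * incr (p n) (p n.+1) w).
Proof.
have [c vc] := v_L2 n; split.
  apply: measurable_funM => //; exact: incr_measurable (grid_ge0 n) (p_nd n).
under [X in L1 _ X]eq_fun do rewrite exprMn.
apply: (incr_indep2 (grid_ge0 n) (p_nd n) _ _).1.
  by apply: rvX => //; exact: filtration_sigma (grid_ge0 n).
by have [_] := L2_bounded P (v_meas n) vc.
Qed.

Lemma grid_sum_L2 n : L2 P (grid_sum n).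
Proof. exact: L2_sum. Qed.

Lemma grid_sum_mean n : Ex P (grid_sum n) = 0.
Proof.
rewrite /grid_sum Ex_sum => [|l _]; last exact: L2_L1 (term_L2 l).
rewrite big1// => l _; apply: (incr_indep (grid_ge0 l) (p_nd l) _ _).2 => //.
by have [c vc] := v_L2 l; exact: L2_L1 (L2_bounded P (v_meas l) vc).
Qed.

(** When the square of the partial sum plus the new term is expanded, the factor of the increment in
    the cross term is measurable at time [p n], so the independent centred increment kills it. The
    last square contributes the mean of its squared coefficient times the length of the cell. *)
Lemma grid_isometry n : Ex P (fun w => grid_sum n w ^+ 2) =
  \sum_(l < n) Ex P (fun w => v l w ^+ 2) * (p l.+1 - p l).
Proof.
elim: n => [|n IH].
  rewrite big_ord0 -[RHS](Ex_cst P 0); congr Ex; apply/funext => w.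
  by rewrite /grid_sum big_ord0 expr0n.
rewrite big_ord_recr/= -IH.
have [c vc] := v_L2 n; have bv := L2_bounded P (v_meas n) vc.
have s := filtration_sigma (grid_ge0 n).
have ML2 := grid_sum_L2 n.
have [h1 h2] := incr_indep (grid_ge0 n) (p_nd n)
  (rvM s (grid_sum_rv n) (v_rv n)) (L2M ML2 bv).
have [h3 h4] := incr_indep2 (grid_ge0 n) (p_nd n) (@rvX _ _ _ _ s _ 2 (v_rv n)) bv.2.
transitivity (Ex P (fun w => grid_sum n w ^+ 2 +
  (2 * (grid_sum n w * v n w * incr (p n) (p n.+1) w) +
   v n w ^+ 2 * incr (p n) (p n.+1) w ^+ 2))).
  by congr Ex; apply/funext => w; rewrite grid_sumS; ring.
rewrite ExD; [|exact: ML2.2|by apply: L1D => //; exact: L1Zl].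
by rewrite ExD//; [rewrite ExZl// h2 h4 mulr0 add0r|exact: L1Zl].
Qed.

End grid.
End wiener_increments.

Section grid_telescope.
Context {R : realType}.
Variables (p : nat -> R) (n : nat).
Hypothesis p_nd : forall i, p i <= p i.+1.

Let p_mono : {homo p : i j / (i <= j)%N >-> i <= j}.
Proof. exact/nondecreasing_seqP. Qed.

Lemma grid_next_le l j : p l < p j -> p l.+1 <= p j.
Proof.
move=> lj; apply: p_mono; rewrite ltnNge; apply/negP => /p_mono.
by rewrite leNgt lj.
Qed.

(** The indicator compares grid values rather than indices because grid points may coincide. *)
Lemma grid_telescope (h : R -> R) (i j : nat) : (i <= n)%N -> (j <= n)%N ->
  p i <= p j ->
  \sum_(l < n) (p i <= p l < p j)%R%:R * (h (p l.+1) - h (p l)) = h (p j) - h (p i).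
Proof.
move=> ni nj pij.
(* Clamping the argument to [p i, p j] turns each summand into a plain increment of [cl], zero
   outside the interval, so the sum telescopes over the whole grid. *)
pose cl x := h (Num.max (p i) (Num.min (p j) x)).
transitivity (\sum_(0 <= l < n) (cl (p l.+1) - cl (p l))).
  rewrite big_mkord; apply: eq_bigr => l _; rewrite /cl.
  have [lj|jl] := ltP (p l) (p j); last first.
    have jl' : p j <= p l.+1 by exact: le_trans (p_nd l).
    by rewrite andbF mul0r !min_l// subrr.
  have lj' := grid_next_le lj.
  rewrite (min_r lj') andbT.
  have [il|li] := leP (p i) (p l).
    by rewrite !max_r ?mul1r// (le_trans il).
  by rewrite mul0r !max_l ?subrr// grid_next_le.
rewrite telescope_sumr// /cl.
rewrite (min_l (p_mono nj)) (max_r pij) min_r ?max_l//; exact: p_mono.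
Qed.

End grid_telescope.

(** * Lenglart's inequality for sums on a grid *)

Section lenglart.
Context {R : realType} {d : measure_display} {T : measurableType d}.
Variables (P : probability T R) (F : R -> set (set T)) (W : R -> T -> R).
Hypotheses (hF : filtration F) (hW : wiener P F W).

Lemma markov_sqr (X : T -> R) (c e : R) : 0 < e -> L2 P X ->
  Ex P (fun w => X w ^+ 2) <= c ->
  (P [set w | (e < `|X w|)%R] <= (c / e ^+ 2)%:E)%E.
Proof.
move=> e0 [mX iX] Xc.
have mA : measurable [set w | e < `|X w|].
  apply: measurable_set_lt => //.
  exact: measurableT_comp.
have i1 : L1 P (fun w => e ^+ 2 * \1_[set w | e < `|X w|] w).
  apply: L1Zl; apply: (@L1_bounded _ _ _ _ _ 1); first exact: measurable_indic.
  by move=> w; rewrite indicE; case: (_ \in _); rewrite ?normr1 ?normr0.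
have := le_Ex i1 iX; rewrite ExZl; last first.
  apply: (@L1_bounded _ _ _ _ _ 1); first exact: measurable_indic.
  by move=> w; rewrite indicE; case: (_ \in _); rewrite ?normr1 ?normr0.
rewrite Ex_indic// => h.
rewrite -[leLHS]fineK ?fin_num_measure// lee_fin ler_pdivlMr ?exprn_gt0// mulrC.
apply: le_trans Xc; apply: h => w; rewrite indicE.
have [|_] := boolP (w \in _); last by rewrite mulr0 sqr_ge0.
rewrite inE /= mulr1 => ew; rewrite -(real_normK (num_real (X w))).
by apply: lerXn2r; rewrite ?nnegrE // ltW.
Qed.

(* Lenglart's inequality: stop the sum when its bracket exceeds dl, and apply
   the isometry and Chebyshev's inequality to the stopped sum. *)
Lemma grid_lenglart (p : nat -> R) (v : nat -> T -> R) (n : nat) (A : set T)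
    (dl e : R) : 0 <= p 0%N -> (forall i, p i <= p i.+1) ->
  (forall l, rv_measurable (F (p l)) (v l)) ->
  (forall l, exists c : R, forall w, `|v l w| <= c) ->
  measurable A -> 0 <= dl -> 0 < e ->
  (P (A `&` [set w | (e < `|grid_sum W p v n w|)%R]) <=
   P (A `&` [set w | (dl < \sum_(l < n) v l w ^+ 2 * (p l.+1 - p l))%R]) +
   (dl / e ^+ 2)%:E)%E.
Proof.
move=> p0 p_nd v_rv v_bd mA dl0 e0.
pose S k w := \sum_(l < k) v l w ^+ 2 * (p l.+1 - p l).
have S_nd w k : S k w <= S k.+1 w.
  by rewrite /S big_ord_recr/= lerDl mulr_ge0 ?sqr_ge0// subr_ge0.
have S_mono w : {homo S ^~ w : i j / (i <= j)%N >-> i <= j}.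
  exact/nondecreasing_seqP.
(* The bracket [S l.+1] involves only v 0, ..., v l and is decided at time [p l]. Testing it, rather
   than [S l], keeps the stopped coefficients adapted and prevents any overshoot of dl. *)
pose B l := [set w | S l.+1 w <= dl].
pose u l w := v l w * \1_(B l) w.
have sF l : sigma_algebra setT (F (p l)).
  exact: (filtration_sigma hF (grid_ge0 p0 p_nd l)).
have p_mono : {homo p : i j / (i <= j)%N >-> i <= j} by exact/nondecreasing_seqP.
have u_rv l : rv_measurable (F (p l)) (u l).
  apply: rvM => //; apply: rv_indic => //; apply: rv_le => //; last exact: rv_cst.
  apply: rv_sum => // k _; apply: rvM => //; last exact: rv_cst.
  apply: rvX => //; apply: (filtration_mono hF (grid_ge0 p0 p_nd k) _ (v_rv k)).
  by apply: p_mono; rewrite -ltnS.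
have u_bd l : exists c : R, forall w, `|u l w| <= c.
  have [c vc] := v_bd l; exists c => w; rewrite /u normrM indicE.
  by case: (_ \in _); rewrite ?normr1 ?mulr1// normr0 mulr0 (le_trans _ (vc w)).
have uS w k : \sum_(l < k) u l w ^+ 2 * (p l.+1 - p l) <= dl.
  elim: k => [|k IH]; first by rewrite big_ord0.
  have [SB|SB] := boolP (S k.+1 w <= dl).
    apply: le_trans SB; apply: ler_sum => l _; rewrite ler_wpM2r ?subr_ge0//.
    by rewrite /u indicE; case: (_ \in _); rewrite ?mulr1// mulr0 expr0n sqr_ge0.
  rewrite big_ord_recr/= [X in _ + X](_ : _ = 0) ?addr0//.
  by rewrite /u indicE memNset ?mulr0 ?expr0n ?mul0r//= /B/=; exact/negP.
have uv w : S n w <= dl -> grid_sum W p u n w = grid_sum W p v n w.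
  move=> Sn; apply: eq_bigr => l _; congr (_ * _); rewrite /u indicE mem_set ?mulr1//.
  by rewrite /B/=; apply: le_trans Sn; apply: S_mono.
have L2u := grid_sum_L2 hF hW p0 p_nd u_rv u_bd n.
have L2v := grid_sum_L2 hF hW p0 p_nd v_rv v_bd n.
have mv l : measurable_fun setT (v l) := filtration_measurable hF (grid_ge0 p0 p_nd l) (v_rv l).
have L2ul l : L2 P (u l).
  have [c uc] := u_bd l; apply: L2_bounded uc.
  exact: (filtration_measurable hF (grid_ge0 p0 p_nd l) (u_rv l)).
have Eu : Ex P (fun w => grid_sum W p u n w ^+ 2) <= dl.
  rewrite (grid_isometry hF hW p0 p_nd u_rv u_bd).
  have -> : \sum_(l < n) Ex P (fun w => u l w ^+ 2) * (p l.+1 - p l) =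
      Ex P (fun w => \sum_(l < n) (p l.+1 - p l) * u l w ^+ 2).
    rewrite Ex_sum => [|l _]; last exact: L1Zl (L2ul l).2.
    by apply: eq_bigr => l _; rewrite (ExZl (p l.+1 - p l) (L2ul l).2) mulrC.
  rewrite -[leRHS](Ex_cst P); apply: le_Ex; last 2 first.
  - exact: L1_cst.
  - by move=> w; rewrite (le_trans _ (uS w n))// le_eqVlt; apply/orP; left;
      apply/eqP; apply: eq_bigr => l _; rewrite mulrC.
  by apply: L1_sum => l _; exact: L1Zl (L2ul l).2.
have mS : measurable [set w | dl < S n w].
  apply: measurable_set_lt => //.
  apply: measurable_sum => l; apply: measurable_funM => //.
  exact: measurable_funX.
have mM (v' : nat -> T -> R) : L2 P (grid_sum W p v' n) ->
    measurable [set w | e < `|grid_sum W p v' n w|].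
  move=> [mg _]; apply: measurable_set_lt => //.
  exact: measurableT_comp.
apply: le_trans (leeD (lexx _) (markov_sqr e0 L2u Eu)).
apply: le_trans (measureU2 _ _ _); last 2 first.
- exact: measurableI.
- exact: mM.
apply: le_measure; rewrite ?inE.
- by apply: measurableI => //; exact: mM.
- by apply: measurableU; [exact: measurableI|exact: mM].
- move=> w [Aw /= ew]; have [SB|SB] := leP (S n w) dl; last by left.
  by right; rewrite /= uv.
Qed.

End lenglart.

Lemma common_grid {R : realType} (t : R) (xs : seq R) : 0 <= t ->
  (forall x, x \in xs -> 0 <= x <= t) ->
  exists p : nat -> R, exists n : nat, [/\ p 0%N = 0, p n = t,
    forall i, p i <= p i.+1 &
    forall x, x \in xs -> exists2 l, (l <= n)%N & p l = x].
Proof.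
move=> t0 xst; pose ys := sort <=%R (0 :: t :: xs).
have yst y : y \in ys -> 0 <= y <= t.
  rewrite mem_sort !inE => /orP[/eqP ->|/orP[/eqP ->|/xst//]];
  by rewrite lexx ?t0.
have sys : sorted <=%R ys by apply: sort_sorted; exact: le_total.
have szys : size ys = (size xs).+2 by rewrite size_sort.
(* The default value t extends the sorted list by a constant, so the sequence is nondecreasing for
   all indices and takes the value t at index [size ys]. *)
exists (nth t ys), (size ys); split.
- have : nth t ys 0 \in ys by rewrite mem_nth// szys.
  move=> /yst/andP[h _]; apply/eqP; rewrite eq_le h andbT.
  have : 0 \in ys by rewrite mem_sort inE eqxx.
  move=> /(nthP t)[i isz <-].
  by apply: sorted_leq_nth => //; [exact: le_trans|rewrite inE szys].
- by rewrite nth_default.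
- move=> i; have [isz|isz] := ltnP i.+1 (size ys).
    by apply: sorted_leq_nth => //; [exact: le_trans|rewrite inE ltnW].
  rewrite [leRHS]nth_default//.
  have [isz'|isz'] := ltnP i (size ys); last by rewrite nth_default.
  by have /yst/andP[] := mem_nth t isz'.
- move=> x xxs; have : x \in ys by rewrite mem_sort !inE xxs !orbT.
  by move=> /(nthP t)[i isz <-]; exists i => //; exact: ltnW.
Qed.

(** Used with g the squared difference of two simple processes: it bounds the discrete bracket by
    the time integral. The intervals are open on the left, as those on which simple processes are
    constant. *)
Lemma grid_integral_ge {R : realType} (p : nat -> R) (g : R -> \bar R)
    (c : nat -> R) (n : nat) : (forall i, p i <= p i.+1) ->
  (forall x, 0 <= g x)%E -> measurable_fun `[p 0%N, p n] g ->
  (forall l s, (l < n)%N -> p l < s <= p l.+1 -> ((c l)%:E <= g s)%E) ->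
  (forall l, 0 <= c l) ->
  ((\sum_(l < n) c l * (p l.+1 - p l))%:E <=
    \int[lebesgue_measure]_(s in `[p 0%N, p n]) g s)%E.
Proof.
move=> p_nd g0 mg cg c0.
have p_mono : {homo p : i j / (i <= j)%N >-> i <= j} by exact/nondecreasing_seqP.
suff h k : (k <= n)%N -> ((\sum_(l < k) c l * (p l.+1 - p l))%:E <=
    \int[lebesgue_measure]_(s in `[p 0%N, p k]) g s)%E by exact: h.
elim: k => [|k IH] kn; first by rewrite big_ord0; exact: integral_ge0.
rewrite big_ord_recr/= EFinD.
have U : `[p 0%N, p k.+1]%classic = `[p 0%N, p k] `|` `]p k, p k.+1].
  rewrite -itv_bndbnd_setU// bnd_simp; exact: p_mono.
rewrite U ge0_integral_setU//=; last 2 first.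
- by apply: measurable_funS mg => //; rewrite -U; apply: subset_itvl; rewrite bnd_simp p_mono.
- apply/disj_setPS => s [/=]; rewrite !in_itv/= => /andP[_ sk] /andP[ks _].
  by move: (lt_le_trans ks sk); rewrite ltxx.
apply: leeD; first by apply: IH; exact: ltnW.
apply: (@le_trans _ _ (\int[lebesgue_measure]_(s in `]p k, p k.+1]) (c k)%:E)%E).
  rewrite integral_cst//= lebesgue_measure_itv/= lte_fin.
  case: ltP => [|h]; first by rewrite EFinM.
  rewrite mule0 lee_fin [X in _ * X](_ : _ = 0) ?mulr0//.
  by apply/eqP; rewrite subr_eq0 eq_le h p_nd.
apply: ge0_le_integral => //.
- by move=> s _; rewrite lee_fin.
- apply: measurable_funS mg => //; apply: subset_itv; rewrite bnd_simp; exact: p_mono.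
- by move=> s /=; rewrite in_itv/= => h; exact: cg.
Qed.

(** * Simple processes and their integrals *)

Section simple_processes.
Context {R : realType} {d : measure_display} {T : measurableType d}.
Variables (P : probability T R) (F : R -> set (set T)) (W : R -> T -> R).
Hypotheses (hF : filtration F) (hW : wiener P F W).
Implicit Types S : simple_process F.

Lemma sp_time_ge0 S i : 0 <= sp_time S i.
Proof. by elim: i => [|i IH]; [exact: sp_time0|exact: le_trans (sp_time_nd S i)]. Qed.

(* On a grid that contains the jump times, this right-continuous version is
   the value of the simple process on the interval starting at s. *)
Definition right_val S t s w : R :=
  \sum_(i < sp_size S) sp_val S i w *
    (Num.min t (sp_time S i) <= s < Num.min t (sp_time S i.+1))%R%:R.

Lemma right_val_rv S t s : 0 <= s -> rv_measurable (F s) (right_val S t s).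
Proof.
move=> s0; have sF := filtration_sigma hF s0.
apply: rv_sum => // i _.
case: (boolP (_ && _)) => [/andP[h1 h2]|_]; last first.
  by under [X in rv_measurable _ X]eq_fun do rewrite mulr0; exact: rv_cst.
under [X in rv_measurable _ X]eq_fun do rewrite mulr1.
apply: (filtration_mono hF (sp_time_ge0 S i) _ (sp_adapted S i)).
(* As s < t, the cap at t is inactive in the lower bound, so a nonzero term has its jump time
   [sp_time S i] at or before s. *)
move: h1 h2; rewrite ge_min lt_min => /orP[ts /andP[st]|//].
by move: (le_lt_trans ts st); rewrite ltxx.
Qed.

Lemma right_val_bounded S t s : exists c : R, forall w, `|right_val S t s w| <= c.
Proof.
have [c hc] := choice (sp_bounded S).
exists (\sum_(i < sp_size S) c i) => w.
apply: le_trans (ler_norm_sum _ _ _) _; apply: ler_sum => i _.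
rewrite normrM; case: (_ && _); rewrite ?normr1 ?mulr1 ?normr0 ?mulr0//.
exact: le_trans (hc i w).
Qed.

Section on_grid.
Variables (S : simple_process F) (t : R) (p : nat -> R) (n : nat).
Hypotheses (p_nd : forall i, p i <= p i.+1) (pn : p n = t).
Hypothesis p_jumps : forall i, (i <= sp_size S)%N ->
  exists2 l, (l <= n)%N & p l = Num.min t (sp_time S i).

Let p_mono : {homo p : i j / (i <= j)%N >-> i <= j}.
Proof. exact/nondecreasing_seqP. Qed.

Lemma simple_integral_grid w :
  simple_integral W S t w = grid_sum W p (fun l => right_val S t (p l)) n w.
Proof.
rewrite /grid_sum /right_val; under eq_bigr do rewrite mulr_suml.
rewrite exchange_big/=; apply: eq_bigr => i _.
have [l ln pl] := p_jumps (ltnW (ltn_ord i)).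
have [k kn pk] := p_jumps (ltn_ord i).
under eq_bigr do rewrite -mulrA.
rewrite -mulr_sumr; congr (_ * _).
rewrite -pl -pk -(@grid_telescope _ _ n p_nd (fun x => W x w))//.
by rewrite pl pk le_min !ge_min lexx/= sp_time_nd orbT.
Qed.

Lemma simple_eval_grid l s w : (l < n)%N -> p l < s <= p l.+1 ->
  simple_eval S s w = right_val S t (p l) w.
Proof.
move=> ln /andP[ls sl]; apply: eq_bigr => i _; congr (_ * _).
have st : s <= t by rewrite (le_trans sl)// -pn; exact: p_mono.
have [j jn pj] := p_jumps (ltnW (ltn_ord i)).
have [k kn pk] := p_jumps (ltn_ord i).
rewrite indicE; congr (nat_of_bool _)%:R; rewrite mem_setE in_itv/=.
apply/andP/andP => -[h1 h2]; split.
- rewrite -pj; apply: p_mono; rewrite leqNgt; apply/negP => /p_mono.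
  apply/negP; rewrite -ltNge pj; apply: lt_le_trans sl.
  by rewrite gt_min h1 orbT.
- by rewrite lt_min (lt_le_trans ls st) (lt_le_trans ls h2).
- move: h1; rewrite ge_min => /orP[tl|h]; last exact: le_lt_trans ls.
  by move: (lt_le_trans ls st); rewrite ltNge tl.
- move: h2; rewrite -pk => /(grid_next_le p_nd)/(le_trans sl); rewrite pk le_min.
  by case/andP.
Qed.

End on_grid.

Lemma measurable_simple_eval S w D : measurable_fun D (simple_eval S ^~ w).
Proof.
by apply: measurable_sum => i; apply: measurable_funM.
Qed.

(** A grid that contains the jump times of both processes, capped at t, turns the difference of the
    integrals into a single grid sum. [D] is the bracket of that sum: a real measurable variable
    below the time integral, to which Lenglart's inequality applies. *)
Lemma simple_lenglart S1 S2 (t e dl : R) (A : set T) : 0 <= t ->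
  measurable A -> 0 <= dl -> 0 < e ->
  exists D : T -> R, [/\ measurable_fun setT D,
    forall w, ((D w)%:E <= \int[lebesgue_measure]_(s in `[0%R, t])
       ((simple_eval S1 s w - simple_eval S2 s w) ^+ 2)%:E)%E &
    (P (A `&` [set w | (e < `|simple_integral W S1 t w - simple_integral W S2 t w|)%R])
      <= P (A `&` [set w | (dl < D w)%R]) + (dl / e ^+ 2)%:E)%E].
Proof.
move=> t0 mA dl0 e0.
pose pts (S : simple_process F) := [seq Num.min t (sp_time S i) | i <- iota 0 (sp_size S).+1].
have pts_t x : x \in pts S1 ++ pts S2 -> 0 <= x <= t.
  rewrite mem_cat => /orP[] /mapP[i _ ->];
  by rewrite le_min t0 sp_time_ge0 ge_min lexx.
have [p [n [p0 pn p_nd p_in]]] := common_grid t0 pts_t.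
have jump1 i : (i <= sp_size S1)%N ->
    exists2 l, (l <= n)%N & p l = Num.min t (sp_time S1 i).
  move=> iS; apply: p_in; rewrite mem_cat; apply/orP; left.
  by apply/mapP; exists i => //; rewrite mem_iota add0n ltnS.
have jump2 i : (i <= sp_size S2)%N ->
    exists2 l, (l <= n)%N & p l = Num.min t (sp_time S2 i).
  move=> iS; apply: p_in; rewrite mem_cat; apply/orP; right.
  by apply/mapP; exists i => //; rewrite mem_iota add0n ltnS.
have p_ge0 l : 0 <= p l by apply: grid_ge0 => //; rewrite p0.
pose v l w := right_val S1 t (p l) w - right_val S2 t (p l) w.
have v_rv l : rv_measurable (F (p l)) (v l).
  have sF := filtration_sigma hF (p_ge0 l).
  by apply: rvB => //; exact: right_val_rv.
have v_bd l : exists c : R, forall w, `|v l w| <= c.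
  have [c1 h1] := right_val_bounded S1 t (p l).
  have [c2 h2] := right_val_bounded S2 t (p l).
  by exists (c1 + c2) => w; rewrite (le_trans (ler_normB _ _))// lerD.
pose D w := \sum_(l < n) v l w ^+ 2 * (p l.+1 - p l).
exists D; split.
- apply: measurable_sum => l; apply: measurable_funM => //.
  by apply: measurable_funX; exact: (filtration_measurable hF (p_ge0 l) (v_rv l)).
- move=> w; rewrite -p0 -pn.
  apply: (@grid_integral_ge _ p _ (fun l => v l w ^+ 2)) => //.
  + by move=> x; rewrite lee_fin sqr_ge0.
  + apply/measurable_EFinP; apply: measurable_funX; apply: measurable_funB;
    exact: measurable_simple_eval.
  + move=> l s ln ls; rewrite lee_fin /v.
    by rewrite (simple_eval_grid p_nd pn jump1 w ln ls) (simple_eval_grid p_nd pn jump2 w ln ls).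
  + by move=> l; rewrite sqr_ge0.
- have eqI w : simple_integral W S1 t w - simple_integral W S2 t w = grid_sum W p v n w.
    rewrite (simple_integral_grid p_nd jump1) (simple_integral_grid p_nd jump2).
    by rewrite /grid_sum -sumrB; apply: eq_bigr => l _; rewrite mulrBl.
  under eq_set do rewrite eqI.
  by apply: (grid_lenglart hF hW) => //; rewrite p0.
Qed.

End simple_processes.

(** * Ito integrals of processes with continuous paths *)

Section convergence_to0.
Context {R : realType}.

Lemma cvge0P (u : nat -> \bar R) : (forall k, 0 <= u k)%E ->
  u k @[k --> \oo] --> 0%E <->
  forall e : R, 0 < e -> \forall k \near \oo, (u k <= e%:E)%E.
Proof.
move=> u0; split=> [/fine_cvgP[ufin /cvgr0Pnorm_le uc] e e0|uc].
  near=> k; have ufk : u k \is a fin_num by near: k.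
  rewrite -(fineK ufk) lee_fin (le_trans (ler_norm _))//.
  by near: k; exact: uc.
apply/fine_cvgP; split.
  near=> k; rewrite ge0_fin_numE//; apply: (@le_lt_trans _ _ 1%:E); last exact: ltry.
  by near: k; exact: uc.
apply/cvgr0Pnorm_le => e e0; near=> k.
have uk : (u k <= e%:E)%E by near: k; exact: uc.
rewrite /= ger0_norm ?fine_ge0// -lee_fin fineK//.
by rewrite ge0_fin_numE// (le_lt_trans uk)// ltry.
Unshelve. all: by end_near. Qed.

End convergence_to0.

Section time_integrals.
Context {R : realType} {d : measure_display} {T : measurableType d}.
Variables (P : probability T R) (F : R -> set (set T)) (W : R -> T -> R).
Hypotheses (hF : filtration F) (hW : wiener P F W).

Let halfspace : set (R * T) := [set s : R | 0 <= s] `*` [set: T].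

Let halfspace_measurable : measurable halfspace.
Proof.
apply: measurableX => //; rewrite -set_itvcy; exact: measurable_itv.
Qed.

Lemma measurable_time_integral_ge0 (g : R * T -> \bar R) t :
  (forall z, 0 <= g z)%E -> measurable_fun halfspace g ->
  measurable_fun setT (fun w => \int[lebesgue_measure]_(s in `[0%R, t]) g (s, w))%E.
Proof.
move=> g0 mg.
pose D : set (R * T) := `[0%R, t]%classic `*` [set: T].
have mD : measurable D by apply: measurableX.
have mgD : measurable_fun setT (g \_ D).
  apply/(measurable_restrictT _ mD); apply: measurable_funS mg => //.
  by move=> [s w] [/=]; rewrite in_itv/= => /andP[].
rewrite (_ : (fun w => _) = (fun w => \int[lebesgue_measure]_s (g \_ D) (s, w))%E).
  apply: (@measurable_fun_fubini_tonelli_G _ _ (measurableTypeR R) T R lebesgue_measure) => //.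
  by move=> z; rewrite patchE; case: ifP.
apply/funext => w; rewrite integral_mkcond; apply: eq_integral => s _.
by rewrite !patchE; congr (if _ then _ else _); rewrite !mem_setE /D in_setX/= in_setT andbT mem_setE.
Qed.

Lemma measurable_time_Rintegral (a : R -> T -> R) t : jointly_measurable a ->
  measurable_fun setT (fun w => \int[lebesgue_measure]_(s in `[0%R, t]) a s w).
Proof.
move=> ma; apply: measurableT_comp => //.
have mEa : measurable_fun halfspace (fun z : R * T => (a z.1 z.2)%:E).
  exact/measurable_EFinP.
under eq_fun do rewrite integralE.
apply: emeasurable_funB.
- have h := measurable_time_integral_ge0 t (funepos_ge0 _) (measurable_funepos mEa).
  apply: (eq_measurable_fun _ _ h) => w _; apply: eq_integral => s _.
  by rewrite unlock.
- have h := measurable_time_integral_ge0 t (funeneg_ge0 _) (measurable_funeneg mEa).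
  apply: (eq_measurable_fun _ _ h) => w _; apply: eq_integral => s _.
  by rewrite unlock.
Qed.

Lemma jointly_measurable_simple (S : simple_process F) : jointly_measurable (simple_eval S).
Proof.
apply: measurable_sum => i; apply: measurable_funTS; apply: measurable_funM.
  apply: measurableT_comp => //.
  by apply: (filtration_measurable hF (sp_time_ge0 S i)); exact: sp_adapted.
have mi : measurable_fun setT
    (\1_(`]sp_time S i, sp_time S i.+1]%classic) : R -> R) by exact: measurable_indic.
exact: (measurableT_comp mi measurable_fst).
Qed.

Lemma measurable_simple_err (S : simple_process F) (H : R -> T -> R) t :
  jointly_measurable H ->
  measurable_fun setT (fun w => \int[lebesgue_measure]_(s in `[0%R, t])
    ((simple_eval S s w - H s w) ^+ 2)%:E)%E.
Proof.
move=> mH.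
apply: (@measurable_time_integral_ge0 (fun z => ((simple_eval S z.1 z.2 - H z.1 z.2) ^+ 2)%:E)) => //.
  by move=> z; rewrite lee_fin sqr_ge0.
apply/measurable_EFinP; apply: measurable_funX; apply: measurable_funB => //.
exact: jointly_measurable_simple.
Qed.

Lemma measurable_path (H : R -> T -> R) t w : jointly_measurable H ->
  measurable_fun (`[0, t] : set R) (H ^~ w).
Proof.
move=> mH; have mp : measurable_fun (`[0, t] : set R) (fun s : R => (s, w)).
  by apply: measurable_funTS; exact: measurable_fun_pair.
apply: (@measurable_comp _ _ _ _ _ _ halfspace (fun z : R * T => H z.1 z.2) _ (fun s : R => (s, w))) => //.
by move=> z [s +] <-; rewrite /= in_itv/= => /andP[s0 _]; split.
Qed.

Lemma simple_err_triangle (S1 S2 : simple_process F) (H : R -> T -> R) t w :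
  jointly_measurable H ->
  (\int[lebesgue_measure]_(s in `[0%R, t])
     ((simple_eval S1 s w - simple_eval S2 s w) ^+ 2)%:E <=
   2%:E * \int[lebesgue_measure]_(s in `[0%R, t])
     ((simple_eval S1 s w - H s w) ^+ 2)%:E +
   2%:E * \int[lebesgue_measure]_(s in `[0%R, t])
     ((simple_eval S2 s w - H s w) ^+ 2)%:E)%E.
Proof.
move=> mH; have mHw := @measurable_path H t w mH.
have m1 (S : simple_process F) : measurable_fun (`[0, t] : set R) (fun s => (simple_eval S s w - H s w) ^+ 2).
  by apply: measurable_funX; apply: measurable_funB => //; exact: measurable_simple_eval.
have m2 (S : simple_process F) : measurable_fun (`[0, t] : set R) (fun s => ((simple_eval S s w - H s w) ^+ 2)%:E).
  exact/measurable_EFinP.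
have m3 (S : simple_process F) : measurable_fun `[0, t]
    (fun s => 2%:E * ((simple_eval S s w - H s w) ^+ 2)%:E)%E.
  exact: emeasurable_funM.
have n2 (S : simple_process F) s : (0 <= ((simple_eval S s w - H s w) ^+ 2)%:E)%E.
  by rewrite lee_fin sqr_ge0.
have n3 (S : simple_process F) s : (0 <= 2%:E * ((simple_eval S s w - H s w) ^+ 2)%:E)%E.
  exact: mule_ge0.
have e1 (S : simple_process F) : (2%:E * \int[lebesgue_measure]_(s in `[0%R, t])
     ((simple_eval S s w - H s w) ^+ 2)%:E = \int[lebesgue_measure]_(s in `[0%R, t])
     (2%:E * ((simple_eval S s w - H s w) ^+ 2)%:E))%E.
  by rewrite ge0_integralZl//; exact: m2.
rewrite !e1 -ge0_integralD//; try exact: m3.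
apply: ge0_le_integral => //.
- by move=> s _; rewrite lee_fin sqr_ge0.
- apply/measurable_EFinP; apply: measurable_funX; apply: measurable_funB;
  exact: measurable_simple_eval.
- by apply: emeasurable_funD; exact: m3.
- move=> s _; rewrite lee_fin.
  set x := simple_eval S1 s w; set y := simple_eval S2 s w; set z := H s w.
  by have := sqr_ge0 ((x - z) + (y - z)); nra.
Qed.

Lemma measurable_simple_integral (S : simple_process F) t : 0 <= t ->
  measurable_fun setT (simple_integral W S t).
Proof.
move=> t0; apply: measurable_sum => i; apply: measurable_funM.
  by apply: (filtration_measurable hF (sp_time_ge0 S i)); exact: sp_adapted.
have mW s : 0 <= s -> measurable_fun setT (W s).
  by move=> s0; exact: (filtration_measurable hF s0 (wiener_adapted hW s0)).
by apply: measurable_funB; apply: mW; rewrite le_min t0 sp_time_ge0.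
Qed.

(** The integral does not depend on the approximating sequence: S and the sequence S' supplied by
    the definition both approach H, so Lenglart's inequality makes their integrals close in
    probability. Restricting the claim to a measurable event A allows localisation. *)
Lemma ito_integral_approx (H : R -> T -> R) t I (S : nat -> simple_process F) A :
  0 <= t -> jointly_measurable H -> is_ito_integral P F W H t I ->
  measurable_fun setT I -> measurable A ->
  (forall dl : R, 0 < dl -> P (A `&` [set w | dl%:E <
     \int[lebesgue_measure]_(s in `[0%R, t])
       ((simple_eval (S k) s w - H s w) ^+ 2)%:E])%E @[k --> \oo] --> 0%E) ->
  forall e : R, 0 < e ->
    P (A `&` [set w | e < `|simple_integral W (S k) t w - I w|])
      @[k --> \oo] --> 0%E.
Proof.
move=> t0 mH [S' [S'H S'I]] mI mA SH e e0.
have mE dl (S0 : simple_process F) : measurable [set w | dl%:E <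
     \int[lebesgue_measure]_(s in `[0%R, t])
       ((simple_eval S0 s w - H s w) ^+ 2)%:E]%E.
  rewrite -[X in measurable X]setTI; apply: emeasurable_fun_o_infty => //.
  exact: measurable_simple_err.
have mD (S0 : simple_process F) u : measurable [set w | u < `|simple_integral W S0 t w - I w|].
  apply: measurable_set_lt => //; apply: measurableT_comp => //.
  by apply: measurable_funB => //; exact: measurable_simple_integral.
apply/cvge0P => [k|eta eta0]; first exact: measure_ge0.
have e2 : 0 < e / 2 by rewrite divr_gt0.
(* The failure probability eta is shared in four equal parts. This choice makes the remainder dl /
   (e / 2)^2 in Lenglart's inequality equal to eta / 4. Squared time errors of at most dl / 4 for S
   and S' give D <= dl through the factor 2 in [simple_err_triangle]. *)
pose dl := (e / 2) ^+ 2 * (eta / 4).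
have dl0 : 0 < dl by rewrite mulr_gt0 ?exprn_gt0// divr_gt0.
have eta4 : 0 < eta / 4 by rewrite divr_gt0.
have dl4 : 0 < dl / 4 by rewrite divr_gt0.
have /cvge0P := S'H _ dl4; move/(_ (fun k => measure_ge0 _ _))/(_ _ eta4) => h1.
have /cvge0P := S'I _ e2; move/(_ (fun k => measure_ge0 _ _))/(_ _ eta4) => h2.
have /cvge0P := SH _ dl4; move/(_ (fun k => measure_ge0 _ _))/(_ _ eta4) => h3.
near=> k.
have g1 : (P [set w | ((dl / 4)%:E < \int[lebesgue_measure]_(s in `[0%R, t])
       ((simple_eval (S' k) s w - H s w) ^+ 2)%:E)%E] <= (eta / 4)%:E)%E by near: k.
have g2 : (P [set w | (e / 2 < `|simple_integral W (S' k) t w - I w|)%R] <= (eta / 4)%:E)%E.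
  by near: k.
have g3 : (P (A `&` [set w | ((dl / 4)%:E < \int[lebesgue_measure]_(s in `[0%R, t])
       ((simple_eval (S k) s w - H s w) ^+ 2)%:E)%E]) <= (eta / 4)%:E)%E by near: k.
have [D [mDD DS DP]] := simple_lenglart hF hW (S k) (S' k) t0 mA (ltW dl0) e2.
have mDl : measurable [set w | dl < D w] by exact: measurable_set_lt.
have mSS' : measurable [set w | e / 2 < `|simple_integral W (S k) t w - simple_integral W (S' k) t w|].
  apply: measurable_set_lt => //; apply: measurableT_comp => //.
  by apply: measurable_funB; exact: measurable_simple_integral.
have DA : (P (A `&` [set w | (dl < D w)%R]) <= (eta / 4)%:E + (eta / 4)%:E)%E.
  apply: le_trans (leeD g3 g1); apply: le_trans (measureU2 _ _ _); last 2 first.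
  - exact: measurableI.
  - exact: mE.
  apply: le_measure; rewrite ?inE.
  - exact: measurableI.
  - by apply: measurableU => //; exact: measurableI.
  - move=> w [Aw /= dlD].
    have := le_trans (DS w) (simple_err_triangle (S k) (S' k) t w mH).
    set a := (\int[_]_(s in _) _)%E; set b := (\int[_]_(s in _) _)%E => Dab.
    have [ha|ha] := leP a (dl / 4)%:E; last by left.
    have [hb|hb] := leP b (dl / 4)%:E; last by right.
    have : ((D w)%:E <= 2%:E * (dl / 4)%:E + 2%:E * (dl / 4)%:E)%E.
      by apply: le_trans Dab _; apply: leeD; apply: lee_wpmul2l.
    by rewrite -!EFinM -EFinD lee_fin => ?; exfalso; lra.
have SS' : (P (A `&` [set w | (e / 2 < `|simple_integral W (S k) t w - simple_integral W (S' k) t w|)%R])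
    <= (eta / 4)%:E + (eta / 4)%:E + (eta / 4)%:E)%E.
  apply: le_trans DP _; apply: leeD => //.
  by rewrite lee_fin /dl mulrC mulKf// gt_eqF// exprn_gt0.
have -> : eta%:E = ((eta / 4)%:E + (eta / 4)%:E + (eta / 4)%:E + (eta / 4)%:E)%E.
  by rewrite -!EFinD; congr EFin; lra.
apply: le_trans (leeD SS' g2); apply: le_trans (measureU2 _ _ _); last 2 first.
- exact: measurableI.
- exact: mD.
apply: le_measure; rewrite ?inE.
- exact: measurableI.
- by apply: measurableU => //; exact: measurableI.
- move=> w [Aw /= ew].
  have [h|h] := leP `|simple_integral W (S k) t w - simple_integral W (S' k) t w| (e / 2); last by left.
  right => /=; rewrite ltNge; apply/negP => h'.
  move: ew; rewrite ltNge => /negP; apply.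
  rewrite (_ : _ - I w = (simple_integral W (S k) t w - simple_integral W (S' k) t w) +
    (simple_integral W (S' k) t w - I w)); last by ring.
  by rewrite (le_trans (ler_normD _ _))// [e]splitr lerD.
Unshelve. all: by end_near. Qed.

End time_integrals.

(** The unions of A j over j >= k decrease to the set of outcomes lying in infinitely many A j,
    which is null; continuity from above concludes. *)
Lemma cvg_prob_of_ae {R : realType} {d} {T : measurableType d}
    (P : probability T R) (A : nat -> set T) :
  (forall k, measurable (A k)) ->
  {ae P, forall w, \forall k \near \oo, ~ A k w} ->
  P (A k) @[k --> \oo] --> 0%E.
Proof.
move=> mA hA.
pose B k := \bigcup_(j in [set j | (k <= j)%N]) A j.
have mB k : measurable (B k) by exact: bigcup_measurable.
have B0 : P (\bigcap_k B k) = 0%E.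
  apply/negligibleP; first exact: bigcapT_measurable.
  apply: negligibleS hA => w Bw /= [N _ hN].
  by have [j /= Nj Aj] := Bw N I; exact: hN j Nj Aj.
have cB : P (B k) @[k --> \oo] --> 0%E.
  rewrite -B0; apply: nonincreasing_cvg_mu => //.
  - by apply: le_lt_trans (probability_le1 _ _) _ => //; exact: ltry.
  - exact: bigcapT_measurable.
  - move=> i j ij; apply/subsetPset => w [l /= jl Al]; exists l => //=.
    exact: leq_trans jl.
apply: (squeeze_cvge _ (cvg_cst 0%E) cB); near=> k.
rewrite measure_ge0/=; apply: le_measure; rewrite ?inE//.
by move=> w Aw; exists k => /=.
Unshelve. all: by end_near. Qed.

(** * Uniform continuity and Riemann sums *)

Section uniform_continuity.
Context {R : realType}.
Implicit Types h : R -> R.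

Lemma heine h (a b : R) : {within `[a, b], continuous h} -> forall e, 0 < e ->
  exists2 r, 0 < r & forall x y, a <= x <= b -> a <= y <= b ->
    `|x - y| < r -> `|h x - h y| <= e.
Proof.
move=> ch e e0.
have e2 : 0 < e / 2 by rewrite divr_gt0.
have /compact_near_coveringP cab := @segment_compact R a b.
(* Compactness in near-covering form: the filter parameter is the radius r, and near each point the
   claim holds with half the radius of continuity at that point. *)
have := cab R 0^'+ (fun r x => a <= x <= b -> forall y, a <= y <= b -> `|x - y| < r -> `|h x - h y| <= e) _ _.
case=> [x xab|r0 r00 H].
  have /cvgrPdist_lt/(_ _ e2) := (iffLR (subspace_continuousP _ _) ch) x xab.
  rewrite near_withinE => -[r /= r0 hr].
  have r2 : 0 < r / 2 by rewrite divr_gt0.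
  exists (ball x (r / 2), [set s | 0 < s < r / 2]) => /=.
    split; first exact: nbhsx_ballx.
    by near=> s => /=; apply/andP; split; near: s; [exact: nbhs_right_gt|exact: nbhs_right_lt].
  move=> [z s] /= [xz /andP[s0 sr]] zab y yab zy.
  have xz' : `|x - z| < r / 2 by [].
  have h1 : `|h x - h z| < e / 2.
    by apply: hr => //=; rewrite ?in_itv// (lt_trans xz')// gtr_pMr// invf_lt1// ltr1n.
  have h2 : `|h x - h y| < e / 2.
    apply: hr => /=; rewrite ?in_itv//.
    rewrite (_ : x - y = (x - z) + (z - y)); last by ring.
    by rewrite (le_lt_trans (ler_normD _ _))// [r]splitr ltrD// (lt_trans zy).
  rewrite (_ : h z - h y = (h x - h y) - (h x - h z)); last by ring.
  by rewrite (le_trans (ler_normB _ _))// [e]splitr lerD// ltW.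
exists (r0 / 2); first by rewrite divr_gt0.
move=> x y xab yab xy; apply: (H (r0 / 2)) => //=.
- by rewrite sub0r normrN gtr0_norm ?divr_gt0// gtr_pMr// invf_lt1// ltr1n.
- by rewrite divr_gt0.
Unshelve. all: by end_near. Qed.

End uniform_continuity.

Section time_integral_local.
Context {R : realType}.
Local Notation mu := (@lebesgue_measure R).

Lemma Rintegral_local (a : R -> R) (t u v c e : R) : 0 <= u -> u <= v -> v <= t ->
  mu.-integrable `[0, t] (EFin \o a) ->
  (forall s, u < s <= v -> `|a s - c| <= e) ->
  `|\int[mu]_(s in `[0, v]) a s - \int[mu]_(s in `[0, u]) a s - c * (v - u)|
    <= e * (v - u).
Proof.
move=> u0 uv vt ia ae.
have iv : mu.-integrable `[0, v] (EFin \o a).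
  by apply: integrableS ia => //; apply: subset_itvl; rewrite bnd_simp.
rewrite (@Rintegral_itvB R a (BLeft 0) (BRight v) u)//.
have iuv : mu.-integrable `]u, v] (EFin \o a).
  by apply: integrableS iv => //; apply: subset_itvr; rewrite bnd_simp.
have muv : fine (mu `]u, v]) = v - u.
  rewrite lebesgue_measure_itv/= lte_fin; case: ltP => // vu.
  by apply/eqP; rewrite eq_sym subr_eq0 eq_le uv vu.
have icst k : mu.-integrable `]u, v] (EFin \o cst k).
  apply: (@integrableS _ _ _ mu `[u, v]) => //.
    by apply: subset_itvr; rewrite bnd_simp.
  apply: continuous_compact_integrable; first exact: segment_compact.
  by apply: continuous_subspaceT => x; exact: cst_continuous.
rewrite -{1}muv -Rintegral_cst// -RintegralB//; last exact: icst.
apply: le_trans (le_normr_Rintegral _ _) _ => //.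
  exact: (integrableB _ iuv (icst c)).
rewrite -muv -Rintegral_cst//; apply: le_Rintegral => //.
- exact: (integrable_norm (integrableB _ iuv (icst c))).
- exact: icst.
Qed.

Lemma Riemann_sum (a : R -> R) (t dt e : R) (m : nat) : 0 <= dt -> m%:R * dt = t ->
  mu.-integrable `[0, t] (EFin \o a) ->
  (forall i s, (i < m)%N -> i%:R * dt < s <= i.+1%:R * dt -> `|a s - a (i%:R * dt)| <= e) ->
  `|\int[mu]_(s in `[0, t]) a s - \sum_(i < m) a (i%:R * dt) * dt| <= e * t.
Proof.
move=> dt0 mdt ia ae.
pose I x := \int[mu]_(s in `[0, x]) a s.
have -> : \int[mu]_(s in `[0, t]) a s = \sum_(i < m) (I (i.+1%:R * dt) - I (i%:R * dt)).
  rewrite -(big_mkord xpredT (fun i => I (i.+1%:R * dt) - I (i%:R * dt))).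
  rewrite (telescope_sumr (fun i => I (i%:R * dt)))//.
  by rewrite mdt mul0r /I set_itv1 Rintegral_set1 subr0.
rewrite -sumrB (le_trans (ler_norm_sum _ _ _))//.
have -> : e * t = \sum_(i < m) e * dt.
  by rewrite sumr_const card_ord -mulrnAr -mdt mulr_natl.
apply: ler_sum => i _.
have dtE : i.+1%:R * dt - i%:R * dt = dt by rewrite -mulrBl -natrB// subSnn mul1r.
have := @Rintegral_local a t (i%:R * dt) (i.+1%:R * dt) (a (i%:R * dt)) e.
rewrite dtE; apply => //.
- by rewrite mulr_ge0.
- by rewrite ler_wpM2r// ler_nat.
- by rewrite -mdt ler_wpM2r// ler_nat.
- by move=> s; apply: ae.
Qed.

End time_integral_local.

(** * Ito integrals as limits of Euler sums *)

Section euler.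
Context {R : realType} {d : measure_display} {T : measurableType d}.
Variables (P : probability T R) (F : R -> set (set T)) (W : R -> T -> R).
Hypotheses (hF : filtration F) (hW : wiener P F W).

Section euler_process.
Variables (b : nat -> T -> R) (dt : R) (m : nat).
Hypothesis dt_ge0 : 0 <= dt.
Hypothesis b_bd : forall i, exists c : R, forall w, `|b i w| <= c.
Hypothesis b_rv : forall i, rv_measurable (F (i%:R * dt)) (b i).

Let time0 : 0 <= 0%:R * dt. Proof. by rewrite mul0r. Qed.
Let time_nd i : i%:R * dt <= i.+1%:R * dt.
Proof. by rewrite ler_wpM2r// ler_nat. Qed.

Definition euler_process : simple_process F :=
  @SimpleProcess _ _ _ F m (fun i => i%:R * dt) b time0 time_nd b_bd b_rv.

Lemma simple_integral_euler w : simple_integral W euler_process (m%:R * dt) w =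
  \sum_(i < m) b i w * incr W (i%:R * dt) (i.+1%:R * dt) w.
Proof.
apply: eq_bigr => i _; rewrite /incr !min_r//= ler_wpM2r// ler_nat//.
exact: ltnW.
Qed.

Lemma simple_eval_euler i s w : (i < m)%N -> i%:R * dt < s <= i.+1%:R * dt ->
  simple_eval euler_process s w = b i w.
Proof.
move=> im /andP[si is1]; rewrite /simple_eval /=.
rewrite (bigD1 (Ordinal im))//= [X in _ + X]big1 => [|j ji].
  by rewrite addr0 indicE mem_set ?mulr1//= in_itv/= si.
rewrite indicE memNset ?mulr0//= in_itv/= => /andP[js sj].
move: ji; apply/negP; rewrite negbK -val_eqE/= eqn_leq.
have dt0 : 0 < dt.
  rewrite lt_neqAle dt_ge0 andbT; apply/eqP => dt0.
  by move: (lt_le_trans si is1); rewrite -dt0 !mulr0 ltxx.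
move: (lt_le_trans js is1) (lt_le_trans si sj).
by rewrite !ltr_pM2r// !ltr_nat !ltnS => -> ->.
Qed.

End euler_process.

Lemma grid_locate (dt s : R) (m : nat) : 0 < s <= m%:R * dt ->
  exists2 i, (i < m)%N & i%:R * dt < s <= i.+1%:R * dt.
Proof.
move=> /andP[s0]; elim: m => [|m IH sm].
  by rewrite mul0r leNgt s0.
have [/IH[i im is_]|ms] := leP s (m%:R * dt).
  by exists i => //; exact: ltnW.
by exists m; rewrite ?ms.
Qed.

Lemma euler_err (b : nat -> T -> R) (dt : R) (m : nat) (dt0 : 0 <= dt) b_bd
    (b_rv : forall i, rv_measurable (F (i%:R * dt)) (b i)) (h : R -> R) t w eta :
  m%:R * dt = t -> measurable_fun (`[0, t] : set R) h -> 0 <= eta ->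
  (forall i s, (i < m)%N -> i%:R * dt < s <= i.+1%:R * dt -> `|b i w - h s| <= eta) ->
  (\int[lebesgue_measure]_(s in `[0%R, t])
    ((simple_eval (euler_process m dt0 b_bd b_rv) s w - h s) ^+ 2)%:E
    <= (eta ^+ 2 * t)%:E)%E.
Proof.
move=> mdt mh eta0 bh; have t0 : 0 <= t by rewrite -mdt mulr_ge0.
have mf : measurable_fun (`[0, t] : set R)
    (fun s => ((simple_eval (euler_process m dt0 b_bd b_rv) s w - h s) ^+ 2)%:E).
  apply/measurable_EFinP; apply: measurable_funX; apply: measurable_funB => //.
  exact: measurable_simple_eval.
have mf' : measurable_fun (`]0, t] : set R)
    (fun s => ((simple_eval (euler_process m dt0 b_bd b_rv) s w - h s) ^+ 2)%:E).
  by apply: measurable_funS mf => //; apply: subset_itvr; rewrite bnd_simp.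
(* The simple process vanishes at time 0, so the estimate is available only on ]0, t]; the point 0
   carries no mass. *)
rewrite -integral_itv_obnd_cbnd//.
apply: (@le_trans _ _ (\int[lebesgue_measure]_(s in `]0%R, t]) (eta ^+ 2)%:E)%E).
  apply: ge0_le_integral => //.
  - by move=> s _; rewrite lee_fin sqr_ge0.
  - move=> s /=; rewrite in_itv/= -mdt => /grid_locate[i im isi].
    rewrite (simple_eval_euler _ _ _ _ im isi) lee_fin -(real_normK (num_real (b i w - h s))).
    by apply: lerXn2r; rewrite ?nnegrE//; exact: (bh i).
rewrite integral_cst//= lebesgue_measure_itv/= lte_fin.
case: ltP => [_|_]; first by rewrite oppr0 adde0 -EFinM.
by rewrite mule0 lee_fin mulr_ge0 ?sqr_ge0.
Qed.

(** Uniform continuity of the path makes the squared time error of the Euler process tend to 0 for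
    almost every outcome in A, hence in probability on A. The coefficients are bounded and adapted
    everywhere but match H at the grid times only on A, which leaves room for multiplying them by
    adapted indicators. *)
Lemma euler_ito (H : R -> T -> R) t I A (m : nat -> nat) (dt : nat -> R)
    (b : nat -> nat -> T -> R) : 0 < t ->
  (forall k, 0 <= dt k) -> (forall k, (m k)%:R * dt k = t) ->
  dt k @[k --> \oo] --> 0 ->
  (forall k i, exists c : R, forall w, `|b k i w| <= c) ->
  (forall k i, rv_measurable (F (i%:R * dt k)) (b k i)) ->
  jointly_measurable H -> is_ito_integral P F W H t I ->
  measurable_fun setT I -> measurable A ->
  {ae P, forall w, A w -> {within `[0, t], continuous (H ^~ w)} /\
    forall k i, (i < m k)%N -> b k i w = H (i%:R * dt k) w} ->
  forall e : R, 0 < e -> P (A `&` [set w | e <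
    `|\sum_(i < m k) b k i w * incr W (i%:R * dt k) (i.+1%:R * dt k) w - I w|])
      @[k --> \oo] --> 0%E.
Proof.
move=> t0 dt0 mdt dtc b_bd b_rv mH hI mI mA hA e e0.
pose S k := euler_process (m k) (dt0 k) (b_bd k) (b_rv k).
have -> : (fun k => P (A `&` [set w | e <
    `|\sum_(i < m k) b k i w * incr W (i%:R * dt k) (i.+1%:R * dt k) w - I w|])) =
   (fun k => P (A `&` [set w | e < `|simple_integral W (S k) t w - I w|])).
  apply/funext => k; congr (P (_ `&` _)); apply/seteqP; split => w /=;
  by rewrite -(mdt k) simple_integral_euler.
apply: (ito_integral_approx hF hW (ltW t0) mH hI mI mA) => // dl dl0.
apply: cvg_prob_of_ae => [k|].
  apply: measurableI => //; rewrite -[X in measurable X]setTI.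
  by apply: emeasurable_fun_o_infty => //; exact: measurable_simple_err.
apply: filterS hA => w hA.
have [Aw|nA] := pselect (A w); last by apply: nearW => k -[].
have [cH bH] := hA Aw.
(* An oscillation of at most sqrt(dl / t) on each cell gives, by [euler_err], a squared error of at
   most dl over [0, t]. *)
have eta0 : 0 < Num.sqrt (dl / t) by rewrite sqrtr_gt0 divr_gt0.
have [r r0 hr] := heine cH eta0.
have hn := (cvgr0Pnorm_lt _).1 dtc _ r0; near=> k; move=> [_ /=].
have dtk : `|dt k| < r.
  near: k; exact: hn.
apply/negP; rewrite -leNgt.
have -> : dl = Num.sqrt (dl / t) ^+ 2 * t.
  by rewrite sqr_sqrtr ?divfK ?gt_eqF// divr_ge0// ltW.
apply: euler_err => //.
- exact: measurable_path.
- move=> i s im /andP[si sj]; rewrite bH//.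
  have sj1 : s <= t by rewrite (le_trans sj)// -(mdt k) ler_wpM2r// ler_nat.
  have i0 : 0 <= i%:R * dt k by rewrite mulr_ge0.
  apply: hr.
  + by rewrite i0 (le_trans (ltW si)).
  + by rewrite sj1 (le_trans i0)// ltW.
  + rewrite distrC gtr0_norm ?subr_gt0//.
    have : s - i%:R * dt k <= dt k by rewrite lerBlDl; move: sj; rewrite -addn1 natrD; lra.
    by move=> /le_lt_trans; apply; rewrite (le_lt_trans (ler_norm _)).
Unshelve. all: by end_near. Qed.

End euler.

(** Cauchy-Schwarz with nonnegative weights, by induction on the number of terms. *)
Lemma weighted_sqr_sum {R : realType} (n : nat) (u x : nat -> R) :
  (forall i, 0 <= u i) ->
  (\sum_(i < n) u i * x i) ^+ 2 <= (\sum_(i < n) u i) * \sum_(i < n) u i * x i ^+ 2.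
Proof.
move=> u0; elim: n => [|n IH]; first by rewrite !big_ord0 expr0n mul0r.
rewrite !big_ord_recr/=.
have A0 : 0 <= \sum_(i < n) u i by apply: sumr_ge0.
have B0 : 0 <= \sum_(i < n) u i * x i ^+ 2.
  by apply: sumr_ge0 => i _; rewrite mulr_ge0 ?sqr_ge0.
move: (\sum_(i < n) u i * x i) (\sum_(i < n) u i) (\sum_(i < n) u i * x i ^+ 2) IH A0 B0 => S A B IH A0 B0.
(* The induction step adds [u n] times this expression. Multiplied by A it dominates (A x n - S)^2
   by the induction hypothesis, and A = 0 forces S = 0. *)
have h : 0 <= A * x n ^+ 2 + B - 2 * x n * S.
  move: A0; rewrite le_eqVlt => /predU1P[A0|A0].
    have S0 : S = 0.
      by apply/eqP; rewrite -sqrf_eq0 eq_le sqr_ge0 andbT (le_trans IH)// -A0 mul0r.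
    by rewrite -A0 S0 mul0r mulr0 subr0 add0r.
  rewrite -(pmulr_rge0 _ A0); apply: le_trans (sqr_ge0 (A * x n - S)) _.
  by nra.
have := mulr_ge0 (u0 n) h; nra.
Qed.

(** * Fatou's lemma under convergence in probability *)

Section fatou_in_probability.
Context {R : realType} {d : measure_display} {T : measurableType d}.
Variable P : probability T R.

(** Y^2 is truncated at level N. Where Z k is close to Y, Young's inequality bounds Y^2 by nearly Z
    k^2; elsewhere the truncated variable is at most N, on a set of small probability. Monotone
    convergence then removes the truncation. *)
Lemma fatou_prob (Y : T -> R) (Z : nat -> T -> R) (A : set T) (B : R) :
  measurable_fun setT Y -> (forall k, L2 P (Z k)) -> measurable A ->
  (forall k, Ex P (fun w => Z k w ^+ 2) <= B) ->
  (forall e : R, 0 < e -> P (A `&` [set w | e < `|Z k w - Y w|]) @[k --> \oo] --> 0%E) ->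
  L1 P (fun w => \1_A w * Y w ^+ 2) /\ Ex P (fun w => \1_A w * Y w ^+ 2) <= B.
Proof.
move=> mY Z2 mA ZB ZY.
have mI : measurable_fun setT (\1_A : T -> R) by exact: measurable_indic.
have I01 w : 0 <= (\1_A w : R) <= 1 by rewrite indicE; case: (_ \in _); rewrite ?lexx ?ler01.
pose f (N : nat) w : R := \1_A w * Num.min (Y w ^+ 2) N%:R.
have f_ge0 N w : 0 <= f N w.
  by rewrite mulr_ge0 ?(andP (I01 w)).1// le_min sqr_ge0 ler0n.
have mf N : measurable_fun setT (f N).
  apply: measurable_funM => //; apply: measurable_minr => //.
  exact: measurable_funX.
have fL1 N : L1 P (f N).
  apply: (@L1_bounded _ _ _ _ _ N%:R) => // w; rewrite ger0_norm//.
  by rewrite /f -[leRHS]mul1r ler_pM ?(andP (I01 w)).1 ?(andP (I01 w)).2// ?le_min ?sqr_ge0 ?ler0n// ge_min lexx orbT.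
have B0 : 0 <= B by apply: le_trans (ZB 0%N); apply: Ex_ge0 => w; exact: sqr_ge0.
have fB N : Ex P (f N) <= B.
  apply/ler_addgt0Pr => e e0.
  (* The bound obtained is (1 + e') B + e' + e'^2, plus at most e' from the exceptional set; as e'
     <= 1, this is at most B + e' (B + 3). *)
  pose e' := Num.min 1 (e / (B + 3)).
  have B3 : 0 < B + 3 by rewrite ltr_pwDr.
  have e'0 : 0 < e' by rewrite lt_min ltr01 divr_gt0.
  have e'1 : e' <= 1 by rewrite ge_min lexx.
  have e'e : e' * (B + 3) <= e by rewrite -ler_pdivlMr// ge_min lexx orbT.
  have N1 : 0 < N%:R + 1 :> R by rewrite ltr_wpDl.
  have eN : 0 < e' / (N%:R + 1) by rewrite divr_gt0.
  have := ZY _ e'0; move/cvge0P => /(_ (fun k => measure_ge0 _ _))/(_ _ eN)[k _ /(_ k (leqnn k))].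
  set D := A `&` _ => PD.
  have mD : measurable D.
    apply: measurableI => //; apply: measurable_set_lt => //.
    apply: measurableT_comp => //; apply: measurable_funB => //; exact: (Z2 k).1.
  have LD : L1 P (fun w => N%:R * \1_D w).
    by apply: L1Zl; apply: (@L1_bounded _ _ _ _ _ 1) => // w; rewrite indicE; case: (_ \in _); rewrite ?normr1 ?normr0.
  have LZ : L1 P (fun w => (1 + e') * Z k w ^+ 2) by apply: L1Zl; exact: (Z2 k).2.
  have L1' : L1 P (fun w => (1 + e') * Z k w ^+ 2 + (e' + e' ^+ 2)) by apply: L1D => //; exact: L1_cst.
  have g0 w : 0 <= (1 + e') * Z k w ^+ 2 + (e' + e' ^+ 2).
    by have := mulr_ge0 (ltW e'0) (sqr_ge0 (Z k w)); have := sqr_ge0 (Z k w); have := sqr_ge0 e'; nra.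
  have : Ex P (f N) <= Ex P (fun w => ((1 + e') * Z k w ^+ 2 + (e' + e' ^+ 2)) + N%:R * \1_D w).
    apply: le_Ex => //; first exact: L1D.
    move=> w; rewrite /f indicE; have [Aw|nA] := boolP (w \in A); last first.
      by rewrite mul0r addr_ge0// mulr_ge0// indicE.
    rewrite mul1r indicE; have [Dw|nD] := boolP (w \in D).
      rewrite mulr1; apply: (@le_trans _ _ N%:R); first by rewrite ge_min lexx orbT.
      by rewrite lerDr.
    rewrite mulr0 addr0; apply: (@le_trans _ _ (Y w ^+ 2)); first by rewrite ge_min lexx.
    have : `|Z k w - Y w| <= e'.
      rewrite leNgt; apply: contra nD => h; rewrite inE; split => //.
      by rewrite inE in Aw.
    rewrite ler_norml => /andP[h1 h2].
    have := sqr_ge0 (Z k w * e' + (Z k w - Y w)).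
    set z := Z k w in h1 h2 *; set y := Y w in h1 h2 *.
    have h3 : (z - y) ^+ 2 <= e' ^+ 2 by nra.
    have h4 : 0 <= e' * (e' * z ^+ 2 + 2 * z * (z - y) + e').
      by have := sqr_ge0 (e' * z + (z - y)); nra.
    rewrite pmulr_rge0// in h4.
    by nra.
  move=> /le_trans; apply.
  rewrite ExD// ExD//; last exact: L1_cst.
  rewrite (ExZl (1 + e') (Z2 k).2) Ex_cst ExZl; last first.
    by apply: (@L1_bounded _ _ _ _ _ 1) => // w; rewrite indicE; case: (_ \in _); rewrite ?normr1 ?normr0.
  rewrite Ex_indic//.
  have PD' : fine (P D) <= e' / (N%:R + 1).
    by rewrite -lee_fin fineK// fin_num_measure.
  have : N%:R * fine (P D) <= e'.
    apply: (@le_trans _ _ (N%:R * (e' / (N%:R + 1)))); first by rewrite ler_wpM2l.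
    by rewrite mulrCA ler_piMr ?(ltW e'0)// ler_pdivrMr// mul1r lerDl.
  by have := ZB k; set z := Ex P _; set q := N%:R * _ => h1 h2; nra.
have mfY : measurable_fun setT (fun w => \1_A w * Y w ^+ 2).
  by apply: measurable_funM => //; exact: measurable_funX.
have lim_f w : (f N w)%:E @[N --> \oo] --> (\1_A w * Y w ^+ 2)%:E.
  apply: cvg_EFin; first exact: nearW.
  apply: cvg_near_cst; near=> N; rewrite /= /f min_l//.
  by near: N; exact: nbhs_infty_ger.
have h : (\int[P]_w (\1_A w * Y w ^+ 2)%:E <= B%:E)%E.
  under eq_integral do rewrite -(cvg_lim _ (lim_f _))//.
  rewrite monotone_convergence//; last 3 first.
  - by move=> N; exact/measurable_EFinP.
  - by move=> N w _; rewrite lee_fin.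
  - move=> w _ a b ab; rewrite lee_fin /f ler_wpM2l ?(andP (I01 w)).1//.
    by rewrite le_min ge_min lexx ge_min ler_nat ab orbT.
  apply: lime_le.
    apply: ereal_nondecreasing_is_cvgn => a b ab; apply: ge0_le_integral => //.
    - by move=> w _; rewrite lee_fin.
    - exact/measurable_EFinP.
    - exact/measurable_EFinP.
    - move=> w _; rewrite lee_fin /f ler_wpM2l ?(andP (I01 w)).1//.
      by rewrite le_min ge_min lexx ge_min ler_nat ab orbT.
  by apply: nearW => N; rewrite L1_fin// lee_fin.
have LY : L1 P (fun w => \1_A w * Y w ^+ 2).
  apply: L1_ge0 => //; last exact: le_lt_trans h (ltry _).
  by move=> w; rewrite mulr_ge0 ?sqr_ge0 ?(andP (I01 w)).1.
by split=> //; rewrite -lee_fin -L1_fin.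
Unshelve. all: by end_near. Qed.

End fatou_in_probability.

(** * Uniqueness for Ito processes with a linear growth bound *)

(** By exp(y) >= 1 + y, each summand times lam is at most the increment of x -> exp(lam x) over its
    cell, and the increments telescope. *)
Lemma expR_Riemann_sum {R : realType} (lam h : R) (n : nat) : 0 < lam ->
  \sum_(i < n) h * expR (lam * (i%:R * h)) <= expR (lam * (n%:R * h)) / lam.
Proof.
move=> lam0; rewrite ler_pdivlMr// mulr_suml.
apply: (@le_trans _ _ (\sum_(0 <= i < n) (expR (lam * (i.+1%:R * h)) - expR (lam * (i%:R * h))))).
  rewrite big_mkord; apply: ler_sum => i _.
  have -> : lam * (i.+1%:R * h) = lam * (i%:R * h) + lam * h.
    by rewrite -addn1 natrD; ring.
  rewrite expRD; have := expR_ge1Dx (lam * h); have := expR_gt0 (lam * (i%:R * h)).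
  set x := expR (lam * (_ * h)); set y := expR (lam * h) => x0 hy.
  by have := ler_wpM2l (ltW x0) hy; nra.
rewrite (telescope_sumr (fun i => expR (lam * (i%:R * h))))// mul0r mulr0 expR0.
by rewrite lerBlDr lerDl.
Qed.

Lemma Riemann_near {R : realType} (a : R -> R) (t : R) (m : nat -> nat) (dt : nat -> R) :
  (forall k, 0 <= dt k) -> (forall k, (m k)%:R * dt k = t) ->
  dt k @[k --> \oo] --> 0 -> 0 < t ->
  {within `[0, t], continuous a} -> forall e, 0 < e ->
  \forall k \near \oo,
    `|\int[lebesgue_measure]_(s in `[0, t]) a s -
      \sum_(i < m k) a (i%:R * dt k) * dt k| <= e.
Proof.
move=> dt0 mdt dtc t0 ca e e0.
have et : 0 < e / t by rewrite divr_gt0.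
have [r r0 hr] := heine ca et.
have hn := (cvgr0Pnorm_lt _).1 dtc _ r0.
near=> k; have dtk : `|dt k| < r by near: k; exact: hn.
have -> : e = e / t * t by rewrite divfK// gt_eqF.
apply: Riemann_sum => //.
  by apply: continuous_compact_integrable => //; exact: segment_compact.
move=> i s im /andP[si sj].
have sj1 : s <= t by rewrite (le_trans sj)// -(mdt k) ler_wpM2r// ler_nat.
have i0 : 0 <= i%:R * dt k by rewrite mulr_ge0.
apply: hr.
- by rewrite sj1 (le_trans i0)// ltW.
- by rewrite i0 (le_trans (ltW si)).
- rewrite gtr0_norm ?subr_gt0//.
  have : s - i%:R * dt k <= dt k by rewrite lerBlDl; move: sj; rewrite -addn1 natrD; lra.
  by move=> /le_lt_trans; apply; rewrite (le_lt_trans (ler_norm _)).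
Unshelve. all: by end_near. Qed.

Lemma cvg_prob_subU {R : realType} {d} {T : measurableType d}
    (P : probability T R) (A B C : nat -> set T) :
  (forall k, measurable (A k)) -> (forall k, measurable (B k)) ->
  (forall k, measurable (C k)) -> (forall k, A k `<=` B k `|` C k) ->
  P (B k) @[k --> \oo] --> 0%E -> P (C k) @[k --> \oo] --> 0%E ->
  P (A k) @[k --> \oo] --> 0%E.
Proof.
move=> mA mB mC ABC B0 C0.
have BC : (P (B k) + P (C k))%E @[k --> \oo] --> 0%E.
  by rewrite -[X in _ --> X]adde0; exact: cvgeD.
apply: (squeeze_cvge _ (cvg_cst 0%E) BC); near=> k.
rewrite measure_ge0/=; apply: le_trans (measureU2 _ (mB k) (mC k)).
by apply: le_measure; rewrite ?inE//; exact: measurableU.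
Unshelve. all: by end_near. Qed.

Section ito_process_facts.
Context {R : realType} {d : measure_display} {T : measurableType d}.
Variables (P : probability T R) (F : R -> set (set T)) (W : R -> T -> R).
Hypotheses (hF : filtration F) (hW : wiener P F W).
Variables (X a b : R -> T -> R).
Hypothesis hX : ito_process P F W X a b.

Lemma ito_measurable t : 0 <= t -> measurable_fun setT (X t).
Proof. by move=> t0; apply: (filtration_measurable hF t0); exact: ito_adapted hX t t0. Qed.

Definition ito_part t w := X t w - X 0 w - \int[lebesgue_measure]_(s in `[0, t]) a s w.

Lemma ito_part_measurable t : 0 <= t -> measurable_fun setT (ito_part t).
Proof.
move=> t0; apply: measurable_funB.
  by apply: measurable_funB; exact: ito_measurable.
by apply: measurable_time_Rintegral; exact: (ito_drift_measurable hX).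
Qed.

Lemma ito_partP t : 0 <= t -> is_ito_integral P F W b t (ito_part t).
Proof. exact: (ito_equation hX). Qed.

End ito_process_facts.

Section ito_unique.
Context {R : realType} {d : measure_display} {T : measurableType d}.
Variables (P : probability T R) (F : R -> set (set T)) (W : R -> T -> R).
Hypotheses (hF : filtration F) (hW : wiener P F W).
Variables (X a b : R -> T -> R) (c : R).
Hypothesis hX : ito_process P F W X a b.
Hypothesis X0 : forall w, X 0 w = c.
Hypothesis ca : {ae P, forall w, {within [set s : R | 0 <= s], continuous (a ^~ w)}}.
Hypothesis cb : {ae P, forall w, {within [set s : R | 0 <= s], continuous (b ^~ w)}}.

Section horizon.
Variables (Tm K : R).
Hypotheses (Tm_gt0 : 0 < Tm) (K_gt0 : 0 < K).

(** Rational fractions of the horizon are countable and stable under subdivision: the Euler grids of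
    [0, tau q] consist of such times, and tau 1 = Tm. *)
Let tau (q : rat) : R := Tm * ratr q.

(* A path that is good up to time tau q obeys linear growth bounds there with
   the fixed constant K. The event G q is decided by countably many times up to
   tau q, so that its indicator may multiply the integrands of Euler sums. *)
Let good q w := [/\ `|X (tau q) w - c| <= K,
  `|a (tau q) w| <= K * `|X (tau q) w - c| &
  `|b (tau q) w| <= K * `|X (tau q) w - c|].

Let G q := [set w | forall r : rat, 0 <= r -> r <= q -> good r w].

Let tau_ge0 q : 0 <= q -> 0 <= tau q.
Proof. by move=> q0; rewrite mulr_ge0 ?(ltW Tm_gt0)// ler0q. Qed.

Let tau_le q r : q <= r -> tau q <= tau r.
Proof. by move=> qr; rewrite ler_pM2l// ler_rat. Qed.

Let good_F q : 0 <= q -> F (tau q) (good q).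
Proof.
move=> q0; have t0 := tau_ge0 q0; have sF := filtration_sigma hF t0.
have rX : rv_measurable (F (tau q)) (fun w => `|X (tau q) w - c|).
  apply: rv_norm => //; apply: rvB => //; last exact: rv_cst.
  exact: ito_adapted hX _ t0.
have rKX : rv_measurable (F (tau q)) (fun w => K * `|X (tau q) w - c|).
  by apply: rvM => //; exact: rv_cst.
have -> : good q = [set w | `|X (tau q) w - c| <= K] `&`
  ([set w | `|a (tau q) w| <= K * `|X (tau q) w - c|] `&`
   [set w | `|b (tau q) w| <= K * `|X (tau q) w - c|]).
  by apply/seteqP; split=> w; [move=> [h1 h2 h3]; split|move=> [h1 [h2 h3]]; split].
apply: sigma_algebra_setI => //; first by apply: rv_le => //; exact: rv_cst.
apply: sigma_algebra_setI => //; apply: rv_le => //; apply: rv_norm => //.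
- exact: ito_drift_adapted hX _ t0.
- exact: ito_diffusion_adapted hX _ t0.
Qed.

(** The rationals are enumerated through [unpickle]; a code of no rational, or of one outside
    [0, q], imposes no condition and contributes the whole space to the intersection. *)
Let G_F q : 0 <= q -> F (tau q) (G q).
Proof.
move=> q0; have t0 := tau_ge0 q0; have sF := filtration_sigma hF t0.
pose A i := [set w | forall r : rat, unpickle i = Some r -> 0 <= r -> r <= q -> good r w].
have -> : G q = \bigcap_i A i.
  apply/seteqP; split=> w /= h.
    by move=> i _ r _; exact: h.
  by move=> r; apply: (h (pickle r) I r); rewrite pickleK.
apply: sigma_algebra_bigcapT => // i.
have FT : F (tau q) setT.
  by have := rv_cst sF (0 : R) measurableT; rewrite preimage_setT.
case E : (unpickle i : option rat) => [r|]; last first.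
  by rewrite (_ : A i = setT)//; apply/seteqP; split => w //= _ r; rewrite E.
have [/andP[r0 rq]|nr] := boolP ((0 <= r) && (r <= q)); last first.
  rewrite (_ : A i = setT)//; apply/seteqP; split => w //= _ r'; rewrite E => -[<-] r0 rq.
  by move: nr; rewrite r0 rq.
have -> : A i = good r.
  apply/seteqP; split => w /=; first by apply.
  by move=> gr r'; rewrite E => -[<-].
case: hF => _ _ /(_ _ _ (tau_ge0 r0) (tau_le rq)); apply; exact: good_F.
Qed.

Let G_mono q r : q <= r -> G r `<=` G q.
Proof. by move=> qr w Gw s s0 sq; apply: Gw => //; exact: le_trans qr. Qed.

Let G_good q w : 0 <= q -> G q w -> good q w.
Proof. by move=> q0; apply. Qed.

Let G_meas q : 0 <= q -> measurable (G q).
Proof.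
move=> q0; case: hF => _ h _; apply: (h (tau q)); first exact: tau_ge0.
exact: G_F.
Qed.

Let e q := Ex P (fun w => \1_(G q) w * (X (tau q) w - c) ^+ 2).

Let mX q : 0 <= q -> measurable_fun setT (fun w => X (tau q) w - c).
Proof.
move=> q0; apply: measurable_funB => //; apply: (ito_measurable hF hX); exact: tau_ge0.
Qed.

Let phi_le q (Y : T -> R) k : 0 <= k -> (forall w, G q w -> `|Y w| <= k) ->
  forall w, `|\1_(G q) w * Y w| <= k.
Proof.
move=> k0 Yk w; rewrite indicE; case: (boolP (w \in G q)) => [|_].
  by rewrite inE mul1r; exact: Yk.
by rewrite mul0r normr0.
Qed.

Let e_L1 q : 0 <= q -> L1 P (fun w => \1_(G q) w * (X (tau q) w - c) ^+ 2).
Proof.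
move=> q0; apply: (@L1_bounded _ _ _ _ _ (K ^+ 2)).
  apply: measurable_funM; first by apply: measurable_indic; exact: G_meas.
  by apply: measurable_funX; exact: mX.
apply: phi_le; first exact: sqr_ge0.
move=> w /(G_good q0)[h _ _]; rewrite normrX; apply: lerXn2r => //;
by rewrite nnegrE// ltW.
Qed.

Let e_le q : 0 <= q -> e q <= K ^+ 2.
Proof.
move=> q0; rewrite -[leRHS](Ex_cst P); apply: le_Ex.
- exact: e_L1.
- exact: L1_cst.
- move=> w; apply: (le_trans (ler_norm _)); apply: (@phi_le q (fun w => (X (tau q) w - c) ^+ 2) (K ^+ 2) (sqr_ge0 K)) => {}w.
  move=> /(G_good q0)[h _ _]; rewrite normrX; apply: lerXn2r => //;
  by rewrite nnegrE// ltW.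
Qed.

Let e0 : e 0 = 0.
Proof.
rewrite /e -[RHS](Ex_cst P); congr Ex; apply/funext => w.
by rewrite /tau rmorph0 mulr0 X0 subrr expr0n mulr0.
Qed.

(* The growth bounds give e q <= C * \int_0^q e; iterating this in the norm
   sup e(r) exp(- lam r) with lam large contracts by 1/4. *)
Let e_step (q : rat) (M lam : R) : 0 < q -> q <= 1 -> 0 < lam -> 0 <= M ->
  (forall r, 0 <= r -> r < q -> e r <= M * expR (lam * ratr r)) ->
  e q <= 2 * (Tm + 1) * K ^+ 2 * Tm * M * (expR (lam * ratr q) / lam).
Proof.
move=> q0 q1 lam0 M0 eM.
pose t := tau q.
have t0 : 0 < t by rewrite mulr_gt0// ltr0q.
have tTm : t <= Tm by rewrite ger_pMr// -(rmorph1 (@ratr R)) ler_rat.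
pose dt k : R := t / k.+1%:R.
have dt0 k : 0 <= dt k by rewrite divr_ge0// ltW.
have mdt k : k.+1%:R * dt k = t by rewrite mulrC divfK// pnatr_eq0.
have dtc : dt k @[k --> \oo] --> 0.
  by rewrite -(mulr0 t); apply: cvgMr; exact: cvg_harmonic.
pose qs k i : rat := q * i%:R / k.+1%:R.
have qs_ge0 k i : 0 <= qs k i by rewrite divr_ge0// mulr_ge0// ltW.
have qs_tau k i : tau (qs k i) = i%:R * dt k.
  rewrite /tau /qs /dt /t /tau rmorphM/= fmorphV/= rmorphM/= !ratr_nat; ring.
have qs_lt k i : (i < k.+1)%N -> qs k i < q.
  by move=> ik; rewrite /qs ltr_pdivrMr// ltr_pM2l// ltr_nat.
(* The indicator at the left end point keeps the coefficients adapted and bounded by K^2, so that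
   the isometry applies. On [G q] all these indicators equal 1 and the genuine Euler sums
   reappear. *)
pose u k i w := \1_(G (qs k i)) w * a (i%:R * dt k) w.
pose v k i w := \1_(G (qs k i)) w * b (i%:R * dt k) w.
have idt0 k i : 0 <= i%:R * dt k by rewrite mulr_ge0.
have rG k i : rv_measurable (F (i%:R * dt k)) (\1_(G (qs k i)) : T -> R).
  by apply: rv_indic; [exact: (filtration_sigma hF (idt0 k i))|rewrite -qs_tau; exact: G_F].
have ru k i : rv_measurable (F (i%:R * dt k)) (u k i).
  apply: rvM => //; first exact: (filtration_sigma hF (idt0 k i)).
  exact: ito_drift_adapted hX _ (idt0 k i).
have rv k i : rv_measurable (F (i%:R * dt k)) (v k i).
  apply: rvM => //; first exact: (filtration_sigma hF (idt0 k i)).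
  exact: ito_diffusion_adapted hX _ (idt0 k i).
have u_bd k i w : `|u k i w| <= K * K.
  apply: (@phi_le (qs k i) (a (i%:R * dt k))); first by rewrite mulr_ge0// ltW.
  move=> {}w /(G_good (qs_ge0 k i))[h1 h2 _]; rewrite -qs_tau (le_trans h2)//.
  by rewrite ler_wpM2l// ltW.
have v_bd k i w : `|v k i w| <= K * K.
  apply: (@phi_le (qs k i) (b (i%:R * dt k))); first by rewrite mulr_ge0// ltW.
  move=> {}w /(G_good (qs_ge0 k i))[h1 _ h2]; rewrite -qs_tau (le_trans h2)//.
  by rewrite ler_wpM2l// ltW.
have sq_le (Y : R -> T -> R) k i w :
    (forall w, G (qs k i) w -> `|Y (i%:R * dt k) w| <= K * `|X (tau (qs k i)) w - c|) ->
    (\1_(G (qs k i)) w * Y (i%:R * dt k) w) ^+ 2 <=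
    K ^+ 2 * (\1_(G (qs k i)) w * (X (tau (qs k i)) w - c) ^+ 2).
  move=> YX; rewrite !indicE; case: (boolP (w \in G (qs k i))) => [|_]; last first.
    by rewrite !mul0r mulr0 expr0n.
  rewrite inE !mul1r => /YX h; rewrite -(real_normK (num_real (Y _ _))).
  rewrite -(real_normK (num_real (X _ _ - c))) -exprMn; apply: lerXn2r => //;
  by rewrite nnegrE// mulr_ge0// ltW.
have u_sq k i w : u k i w ^+ 2 <= K ^+ 2 * (\1_(G (qs k i)) w * (X (tau (qs k i)) w - c) ^+ 2).
  apply: (sq_le a) => {}w /(G_good (qs_ge0 k i))[_ h _]; by rewrite -qs_tau.
have v_sq k i w : v k i w ^+ 2 <= K ^+ 2 * (\1_(G (qs k i)) w * (X (tau (qs k i)) w - c) ^+ 2).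
  apply: (sq_le b) => {}w /(G_good (qs_ge0 k i))[_ _ h]; by rewrite -qs_tau.
have mu' k i : measurable_fun setT (u k i) := filtration_measurable hF (idt0 k i) (ru k i).
have mv' k i : measurable_fun setT (v k i) := filtration_measurable hF (idt0 k i) (rv k i).
have L2u k i : L2 P (u k i) by apply: (L2_bounded P (mu' k i) (u_bd k i)).
have L2v k i : L2 P (v k i) by apply: (L2_bounded P (mv' k i) (v_bd k i)).
pose p k i := i%:R * dt k.
have p0 k : 0 <= p k 0%N by exact: idt0.
have p_nd k i : p k i <= p k i.+1 by rewrite ler_wpM2r// ler_nat.
have pS k i : p k i.+1 - p k i = dt k by rewrite /p -addn1 natrD; ring.
have v_bd' k i : exists c0 : R, forall w, `|v k i w| <= c0 by exists (K * K).
pose D k w := \sum_(i < k.+1) dt k * u k i w.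
pose S k w := grid_sum W (p k) (v k) k.+1 w.
have L2D' k : L2 P (D k) by apply: L2_sum => i _; exact: L2Zl.
have L2S k : L2 P (S k) by exact: (grid_sum_L2 hF hW (p0 k) (p_nd k) (rv k) (v_bd' k)).
have Esq_le (Y : T -> R) k i : L2 P Y ->
    (forall w, Y w ^+ 2 <= K ^+ 2 * (\1_(G (qs k i)) w * (X (tau (qs k i)) w - c) ^+ 2)) ->
    Ex P (fun w => Y w ^+ 2) <= K ^+ 2 * e (qs k i).
  move=> L2Y Yle; rewrite /e -ExZl; last exact: e_L1.
  by apply: le_Ex => //; [exact: L2Y.2|apply: L1Zl; exact: e_L1].
(* The factor 2 comes from (D + S)^2 <= 2 D^2 + 2 S^2. In Tm + 1, the term Tm comes from
   Cauchy-Schwarz on the drift sum, with t <= Tm, and the term 1 from the isometry of the stochastic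
   sum. *)
pose B := 2 * (Tm + 1) * K ^+ 2 * Tm * M * (expR (lam * ratr q) / lam).
have sum_e k : \sum_(i < k.+1) K ^+ 2 * e (qs k i) * dt k <=
    K ^+ 2 * Tm * M * (expR (lam * ratr q) / lam).
  have hk : k.+1%:R * (ratr q / k.+1%:R) = ratr q :> R by rewrite mulrC divfK// pnatr_eq0.
  have := @expR_Riemann_sum R lam (ratr q / k.+1%:R) k.+1 lam0.
  rewrite hk => /(ler_wpM2l (mulr_ge0 (mulr_ge0 (sqr_ge0 K) (ltW Tm_gt0)) M0)).
  apply: le_trans; rewrite mulr_sumr; apply: ler_sum => i _.
  have -> : dt k = Tm * (ratr q / k.+1%:R) by rewrite /dt /t /tau; ring.
  have := eM _ (qs_ge0 k i) (qs_lt k i (ltn_ord i)).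
  have -> : ratr (qs k i) = i%:R * (ratr q / k.+1%:R) :> R.
    by rewrite /qs rmorphM/= fmorphV/= rmorphM/= !ratr_nat; ring.
  have h0 : 0 <= ratr q / k.+1%:R :> R by rewrite divr_ge0// ler0q ltW.
  set E := expR _; set y := ratr q / _ => h.
  have KT : 0 <= K ^+ 2 * Tm * y by apply: mulr_ge0 => //; apply: mulr_ge0; [exact: sqr_ge0|exact: ltW].
  by have := ler_wpM2l KT h; nra.
have ES k : Ex P (fun w => S k w ^+ 2) <= K ^+ 2 * Tm * M * (expR (lam * ratr q) / lam).
  rewrite /S (grid_isometry hF hW (p0 k) (p_nd k) (rv k) (v_bd' k)).
  apply: le_trans (sum_e k); apply: ler_sum => i _; rewrite pS ler_wpM2r//.
  exact: Esq_le.
have ED k : Ex P (fun w => D k w ^+ 2) <= t * (K ^+ 2 * Tm * M * (expR (lam * ratr q) / lam)).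
  apply: (@le_trans _ _ (Ex P (fun w => t * \sum_(i < k.+1) dt k * u k i w ^+ 2))).
    apply: le_Ex; first exact: (L2D' k).2.
    - by apply: L1Zl; apply: L1_sum => i _; apply: L1Zl; exact: (L2u k i).2.
    - move=> w; have := @weighted_sqr_sum _ k.+1 (fun=> dt k) (fun i => u k i w) (fun=> dt0 k).
      by rewrite sumr_const card_ord -mulr_natl mdt.
  rewrite ExZl; last by apply: L1_sum => i _; apply: L1Zl; exact: (L2u k i).2.
  apply: ler_wpM2l; first exact: ltW.
  apply: le_trans (sum_e k); rewrite Ex_sum => [|i _]; last by apply: L1Zl; exact: (L2u k i).2.
  apply: ler_sum => i _; rewrite (ExZl (dt k) (L2u k i).2) mulrC ler_wpM2r//.
  exact: Esq_le.
pose Z k w := D k w + S k w.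
have L2Z k : L2 P (Z k) by exact: L2D.
have EZ k : Ex P (fun w => Z k w ^+ 2) <= B.
  apply: (@le_trans _ _ (Ex P (fun w => 2 * D k w ^+ 2 + 2 * S k w ^+ 2))).
    apply: le_Ex; first exact: (L2Z k).2.
      by apply: L1D; apply: L1Zl; [exact: (L2D' k).2|exact: (L2S k).2].
    by move=> w; rewrite /Z; have := sqr_ge0 (D k w - S k w); nra.
  rewrite ExD; [|by apply: L1Zl; exact: (L2D' k).2|by apply: L1Zl; exact: (L2S k).2].
  rewrite (ExZl _ (L2D' k).2) (ExZl _ (L2S k).2).
  have := ES k; have := ED k; rewrite /B.
  set y1 := Ex P _; set y2 := Ex P _.
  have : 0 <= K ^+ 2 * Tm * M * (expR (lam * ratr q) / lam).
    apply: mulr_ge0; last by rewrite divr_ge0 ?expR_ge0// ltW.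
    by apply: mulr_ge0 => //; apply: mulr_ge0; [exact: sqr_ge0|exact: ltW].
  set y := K ^+ 2 * Tm * M * _ => y0 h1 h2.
  have -> : 2 * (Tm + 1) * K ^+ 2 * Tm * M * (expR (lam * ratr q) / lam) = 2 * (Tm + 1) * y.
    by rewrite /y; ring.
  by have := ler_wpM2r y0 tTm; nra.
suff [] : L1 P (fun w => \1_(G q) w * (X t w - c) ^+ 2) /\
    Ex P (fun w => \1_(G q) w * (X t w - c) ^+ 2) <= B by [].
have mGq := G_meas (ltW q0).
(* On [G q] the variables Z k converge in probability to X t - c: Euler sums converge to the Ito
   part, Riemann sums to the drift. *)
apply: (fatou_prob (mX (ltW q0)) L2Z mGq EZ).
move=> eps eps0.
have eps2 : 0 < eps / 2 by rewrite divr_gt0.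
have mI := ito_part_measurable hF hX (ltW t0).
have ma : measurable_fun setT (fun w => \int[lebesgue_measure]_(s in `[0, t]) a s w).
  by apply: measurable_time_Rintegral; exact: (ito_drift_measurable hX).
have within_t (h : R -> R) : {within [set s : R | 0 <= s], continuous h} ->
    {within `[0, t], continuous h}.
  by apply: continuous_subspaceW => s /=; rewrite in_itv/= => /andP[].
have G1 k i w : (i < k.+1)%N -> G q w -> \1_(G (qs k i)) w = 1 :> R.
  by move=> ik Gw; rewrite indicE mem_set//; apply: G_mono Gw; exact/ltW/qs_lt.
apply: (@cvg_prob_subU _ _ _ _ _
  (fun k => G q `&` [set w | eps / 2 < `|S k w - ito_part X a t w|])
  (fun k => G q `&` [set w | eps / 2 < `|D k w - \int[lebesgue_measure]_(s in `[0, t]) a s w|])).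
- move=> k; apply: measurableI => //; apply: measurable_set_lt => //.
  apply: measurableT_comp => //; apply: measurable_funB; first exact: (L2Z k).1.
  exact: mX (ltW q0).
- move=> k; apply: measurableI => //; apply: measurable_set_lt => //.
  by apply: measurableT_comp => //; apply: measurable_funB => //; exact: (L2S k).1.
- move=> k; apply: measurableI => //; apply: measurable_set_lt => //.
  by apply: measurableT_comp => //; apply: measurable_funB => //; exact: (L2D' k).1.
- move=> k w [Gw /= epsw].
  have [h|h] := leP `|S k w - ito_part X a t w| (eps / 2); last by left.
  right; split => //=; rewrite ltNge; apply/negP => h'.
  move: epsw; rewrite ltNge => /negP; apply.
  have -> : Z k w - (X (tau q) w - c) = (S k w - ito_part X a t w) +
      (D k w - \int[lebesgue_measure]_(s in `[0, t]) a s w).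
    by rewrite /Z /ito_part X0 -/t; ring.
  by rewrite (le_trans (ler_normD _ _))// [eps]splitr lerD.
- apply: (euler_ito hF hW t0 dt0 mdt dtc v_bd' rv (ito_diffusion_measurable hX)
    (ito_partP hX (ltW t0)) mI mGq _ eps2).
  apply: filterS cb => w cbw Gw; split; first exact: within_t.
  by move=> k i ik; rewrite /v G1// mul1r.
- apply: cvg_prob_of_ae.
    move=> k; apply: measurableI => //; apply: measurable_set_lt => //.
    by apply: measurableT_comp => //; apply: measurable_funB => //; exact: (L2D' k).1.
  apply: filterS ca => w caw.
  have hn := @Riemann_near R (a ^~ w) t (fun k => k.+1) dt dt0 mdt dtc t0 (within_t _ caw) _ eps2.
  near=> k; move=> [Gw /=]; apply/negP; rewrite -leNgt distrC.
  rewrite (_ : D k w = \sum_(i < k.+1) a (i%:R * dt k) w * dt k).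
    by near: k; exact: hn.
  by apply: eq_bigr => i _; rewrite /u G1// mul1r mulrC.
Unshelve. all: by end_near. Qed.

Let e_zero (q : rat) : 0 <= q -> q <= 1 -> e q = 0.
Proof.
move=> q0 q1.
(* Chosen so that the factor 2 (Tm + 1) K^2 Tm / lam of [e_step] equals 1/4. *)
pose lam := 8 * (Tm + 1) * K ^+ 2 * Tm.
have lam0 : 0 < lam by rewrite !mulr_gt0 ?exprn_gt0// ltr_wpDr.
have h N r : 0 <= r -> r <= 1 -> e r <= K ^+ 2 * (4^-1) ^+ N * expR (lam * ratr r).
  elim: N r => [|N IH] r r0 r1.
    rewrite expr0 mulr1; apply: (le_trans (e_le r0)).
    rewrite ler_peMr ?sqr_ge0// -[leLHS]expR0 ler_expR.
    by rewrite mulr_ge0 ?ler0q// ltW.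
  move: r0; rewrite le_eqVlt => /predU1P[<-|r0].
    rewrite e0; apply: mulr_ge0; last exact: expR_ge0.
    by apply: mulr_ge0; [exact: sqr_ge0|apply: exprn_ge0; rewrite invr_ge0].
  have M0 : 0 <= K ^+ 2 * (4^-1) ^+ N by apply: mulr_ge0; [exact: sqr_ge0|apply: exprn_ge0; rewrite invr_ge0].
  apply: (le_trans (e_step r0 r1 lam0 M0 _)).
    by move=> r' r'0 r'r; apply: IH => //; exact: le_trans (ltW r'r) r1.
  rewrite le_eqVlt; apply/orP; left; apply/eqP.
  rewrite [_ ^+ N.+1]exprS; set E := expR _; set y := _ ^+ N.
  by rewrite /lam; field; rewrite !gt_eqF// ltr_wpDr.
apply/eqP; rewrite eq_le; apply/andP; split; last first.
  by apply: Ex_ge0 => w; rewrite mulr_ge0 ?sqr_ge0// indicE.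
apply/ler_addgt0Pr => eps eps0; rewrite add0r.
have : (K ^+ 2 * expR (lam * ratr q)) * (4^-1) ^+ N @[N --> \oo] --> (0 : R).
  rewrite -(mulr0 (K ^+ 2 * expR (lam * ratr q))); apply: cvgMr.
  by apply: cvg_expr; rewrite ger0_norm ?invr_ge0// invf_lt1// ltr1n.
move=> /cvgr0Pnorm_le/(_ _ eps0)[N _ /(_ N (leqnn N)) /= hN].
apply: (le_trans (h N q q0 q1)); rewrite mulrAC; exact: le_trans (ler_norm _) hN.
Qed.

(** At q = 1 a nonnegative variable, the square of X Tm - c times the indicator of the good event,
    has mean 0 and hence vanishes almost surely. *)
Lemma ito_unique_on_good : {ae P, forall w,
  (forall q : rat, 0 <= q -> q <= 1 ->
    [/\ `|X (Tm * ratr q) w - c| <= K,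
      `|a (Tm * ratr q) w| <= K * `|X (Tm * ratr q) w - c| &
      `|b (Tm * ratr q) w| <= K * `|X (Tm * ratr q) w - c|]) -> X Tm w = c}.
Proof.
have tau1 : tau 1 = Tm by rewrite /tau rmorph1 mulr1.
have h0 : 0 <= 1 :> rat by [].
have e1 := e_zero h0 (lexx _).
have L := e_L1 h0.
have hae : {ae P, forall w, (\1_(G 1) w * (X (tau 1) w - c) ^+ 2)%:E = 0%E}.
  have [+ _] := ae_eq_integral_abs P measurableT (measurable_int _ L).
  case=> [|N [mN N0 NS]].
    have n0 w : 0 <= \1_(G 1) w * (X (tau 1) w - c) ^+ 2.
      by rewrite mulr_ge0 ?sqr_ge0// indicE.
    under eq_integral do rewrite /= ger0_norm//.
    by rewrite (L1_fin L); congr EFin; exact: e1.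
  by exists N; split => // w hw; apply: NS => /= h; apply: hw; exact: h.
apply: filterS hae => w /eqP; rewrite tau1 eqe mulf_eq0 sqrf_eq0 subr_eq0 => h good1.
move: h; rewrite indicE mem_set ?oner_eq0/=; first by move=> /eqP.
by move=> r r0 r1; exact: good1.
Qed.

End horizon.

Hypothesis lin : {ae P, forall w t, 0 <= t -> exists C, forall s, 0 <= s <= t ->
  `|a s w| <= C * `|X s w - c| /\ `|b s w| <= C * `|X s w - c|}.

(** The growth constant depends on the path, but along each path some integer bounds both it and the
    maximum of |X - c| on [0, t]. The null sets of the countably many integers are merged
    beforehand. *)
Let ito_unique_at t : 0 < t -> {ae P, forall w, X t w = c}.
Proof.
move=> t0.
have hN : {ae P, forall w (N : nat), (forall q : rat, 0 <= q -> q <= 1 ->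
    [/\ `|X (t * ratr q) w - c| <= N.+1%:R,
      `|a (t * ratr q) w| <= N.+1%:R * `|X (t * ratr q) w - c| &
      `|b (t * ratr q) w| <= N.+1%:R * `|X (t * ratr q) w - c|]) -> X t w = c}.
  apply/ae_foralln => N; apply: ito_unique_on_good => //.
apply: filterS3 hN lin (ito_continuous hX) => w hw linw cXw.
have [C hC] := linw t (ltW t0).
have : {within `[0, t], continuous (fun s => `|X s w - c|)}.
  have ct : {within `[0, t], continuous (X ^~ w)}.
    by apply: continuous_subspaceW cXw => s /=; rewrite in_itv/= => /andP[].
  move=> s; apply: cvg_norm; apply: cvgB; last exact: cvg_cst.
  exact: ct.
move=> /(EVT_max (ltW t0))[s0 s0t hmax].
pose M := Num.max `|X s0 w - c| C.
apply: (hw (Num.truncn M)) => q q0 q1.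
have MN : M <= (Num.truncn M).+1%:R by apply/ltW/truncnS_gt.
have tq : 0 <= t * ratr q <= t.
  by rewrite mulr_ge0 ?ler0q ?(ltW t0)//= ger_pMr// -(rmorph1 (@ratr R)) ler_rat.
have [ha hb] := hC _ tq.
have CN : C <= (Num.truncn M).+1%:R by apply: le_trans MN; rewrite le_max lexx orbT.
split.
- apply: le_trans MN; rewrite le_max; apply/orP; left.
  by apply: hmax; rewrite in_itv.
- by apply: (le_trans ha); rewrite ler_wpM2r.
- by apply: (le_trans hb); rewrite ler_wpM2r.
Qed.

(** One null set has to serve all times: it comes from the positive rational times, and path
    continuity covers the rest. The approximating rationals lie to the right of t, so t = 0 is
    included. *)
Lemma ito_unique : {ae P, forall w t, 0 <= t -> X t w = c}.
Proof.
have hQ : {ae P, forall w (n : nat) (q : rat), unpickle n = Some q -> 0 < q -> X (ratr q) w = c}.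
  apply/ae_foralln => n.
  case E : (unpickle n : option rat) => [q|]; last by apply: aeW.
  have [q0|q0] := boolP (0 < q); last first.
    by apply: aeW => w q' [<-] q'0; move: q0; rewrite q'0.
  have := @ito_unique_at (ratr q); rewrite ltr0q => /(_ q0); apply: filterS => w h q' [<-] _.
  exact: h.
apply: filterS2 hQ (ito_continuous hX) => w hw cXw t t0.
have {}hw (q : rat) : 0 < q -> X (ratr q) w = c.
  by move=> q0; apply: (hw (pickle q)) => //; rewrite pickleK.
apply/eqP; rewrite -subr_eq0 -normr_eq0 eq_le normr_ge0 andbT.
apply/ler_addgt0Pr => e e0; rewrite add0r.
have /cvgrPdist_lt/(_ _ e0) := (iffLR (subspace_continuousP _ _) cXw) t t0.
rewrite near_withinE => -[r /= r0 hr].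
have [|q] := @rat_in_itvoo R t (t + r); first by rewrite ltrDl.
rewrite in_itv/= => /andP[tq qr].
have q0 : 0 < ratr q :> R by exact: le_lt_trans tq.
have hq : X (ratr q) w = c by apply: hw; rewrite ltr0q in q0.
rewrite -hq; apply/ltW/hr => /=; last exact: ltW.
by rewrite distrC gtr0_norm ?subr_gt0// ltrBlDl.
Qed.

End ito_unique.

(** * The linear equation *)

Section L2_limit.
Context {R : realType} {d : measure_display} {T : measurableType d}.
Variable P : probability T R.

Lemma sqr_Ex_le (Y : T -> R) : L2 P Y -> Ex P Y ^+ 2 <= Ex P (fun w => Y w ^+ 2).
Proof.
move=> L2Y; have L1Y := L2_L1 L2Y; rewrite -subr_ge0.
have -> : Ex P (fun w => Y w ^+ 2) - Ex P Y ^+ 2 =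
    Ex P (fun w => (Y w - Ex P Y) ^+ 2).
  transitivity (Ex P (fun w => (Y w ^+ 2 - 2 * Ex P Y * Y w) + Ex P Y ^+ 2)).
    rewrite ExD; [|by apply: L1B; [exact: L2Y.2|exact: L1Zl]|exact: L1_cst].
    rewrite ExB; [|exact: L2Y.2|exact: L1Zl].
    by rewrite ExZl// Ex_cst; ring.
  by congr Ex; apply/funext => w; ring.
by apply: Ex_ge0 => w; exact: sqr_ge0.
Qed.

(** Young's inequality with weight u compares U^2 with Z k^2 in both directions, at the cost of a
    multiple 1/u of (Z k - U)^2; once the mean of the latter is at most u^2, all errors are of order
    u. *)
Lemma L2_limit (U : T -> R) (Z : nat -> T -> R) (V : R) :
  (forall k, L2 P (Z k)) -> (forall k, Ex P (Z k) = 0) ->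
  (forall k, L2 P (fun w => Z k w - U w)) ->
  Ex P (fun w => (Z k w - U w) ^+ 2) @[k --> \oo] --> 0 ->
  Ex P (fun w => Z k w ^+ 2) @[k --> \oo] --> V ->
  [/\ L2 P U, Ex P U = 0 & Ex P (fun w => U w ^+ 2) = V].
Proof.
move=> L2Z EZ L2ZU ZU0 ZV.
have L2U : L2 P U.
  have := L2B (L2Z 0%N) (L2ZU 0%N); congr L2.
  by apply/funext => w; ring.
split => //.
- apply/eqP; rewrite -sqrf_eq0 eq_le sqr_ge0 andbT; apply/ler_addgt0Pr => e e0; rewrite add0r.
  have := (cvgr0Pnorm_le _).1 ZU0 _ e0.
  move=> /(_ _)[N _ /(_ N (leqnn N)) /= h].
  apply: le_trans (le_trans (ler_norm _) h).
  have -> : Ex P U ^+ 2 = Ex P (fun w => Z N w - U w) ^+ 2.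
    by rewrite ExB ?EZ ?sub0r ?sqrrN//; exact: L2_L1.
  exact: sqr_Ex_le.
- apply/eqP; rewrite -subr_eq0 -normr_eq0 eq_le normr_ge0 andbT.
  apply/ler_addgt0Pr => e e0; rewrite add0r.
  (* With E[Z k^2] <= |V| + 1 and E[(Z k - U)^2] <= u^2, the errors add up to at most u (|V| +
     5). *)
  pose u := Num.min 1 (e / (`|V| + 5)).
  have V5 : 0 < `|V| + 5 by rewrite ltr_wpDl.
  have u0 : 0 < u by rewrite lt_min ltr01 divr_gt0.
  have u1 : u <= 1 by rewrite ge_min lexx.
  have ue : u * (`|V| + 5) <= e by rewrite -ler_pdivlMr// ge_min lexx orbT.
  have uu : 0 < u ^+ 2 by rewrite exprn_gt0.
  have h1 := (cvgr0Pnorm_le _).1 ZU0 _ uu.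
  have h2 := (cvgrPdist_le _ _).1 ZV _ u0.
  near \oo => k.
  have k1 : `|Ex P (fun w => (Z k w - U w) ^+ 2)| <= u ^+ 2 by near: k; exact: h1.
  have k2 : `|V - Ex P (fun w => Z k w ^+ 2)| <= u by near: k; exact: h2.
  have ui0 : 0 <= u^-1 by rewrite invr_ge0 ltW.
  have up : Ex P (fun w => U w ^+ 2) <= (1 + u) * Ex P (fun w => Z k w ^+ 2) +
      (1 + u^-1) * Ex P (fun w => (Z k w - U w) ^+ 2).
    have L1' : L1 P (fun w => (1 + u) * Z k w ^+ 2) by apply: L1Zl; exact: (L2Z k).2.
    have L2' : L1 P (fun w => (1 + u^-1) * (Z k w - U w) ^+ 2) by apply: L1Zl; exact: (L2ZU k).2.
    rewrite -(ExZl _ (L2Z k).2) -(ExZl _ (L2ZU k).2) -ExD//.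
    apply: le_Ex; [exact: L2U.2|exact: L1D|move=> w].
    set z := Z k w; set y := U w.
    have := mulr_ge0 ui0 (sqr_ge0 (u * z + (z - y))).
    have -> : u^-1 * (u * z + (z - y)) ^+ 2 =
        u * z ^+ 2 + 2 * z * (z - y) + u^-1 * (z - y) ^+ 2 by field; rewrite gt_eqF.
    by nra.
  have down : (1 - u) * Ex P (fun w => Z k w ^+ 2) <=
      Ex P (fun w => U w ^+ 2) + (u^-1 - 1) * Ex P (fun w => (Z k w - U w) ^+ 2).
    have L1' : L1 P (fun w => (1 - u) * Z k w ^+ 2) by apply: L1Zl; exact: (L2Z k).2.
    have L2' : L1 P (fun w => (u^-1 - 1) * (Z k w - U w) ^+ 2) by apply: L1Zl; exact: (L2ZU k).2.
    rewrite -(ExZl _ (L2Z k).2) -(ExZl _ (L2ZU k).2) -ExD//; last exact: L2U.2.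
    apply: le_Ex => //; first by apply: L1D => //; exact: L2U.2.
    move=> w; set z := Z k w; set y := U w.
    have := mulr_ge0 ui0 (sqr_ge0 (u * z - (z - y))).
    have -> : u^-1 * (u * z - (z - y)) ^+ 2 =
        u * z ^+ 2 - 2 * z * (z - y) + u^-1 * (z - y) ^+ 2 by field; rewrite gt_eqF.
    by nra.
  have Y0 : 0 <= Ex P (fun w => (Z k w - U w) ^+ 2) by apply: Ex_ge0 => w; exact: sqr_ge0.
  have Z0 : 0 <= Ex P (fun w => Z k w ^+ 2) by apply: Ex_ge0 => w; exact: sqr_ge0.
  rewrite (ger0_norm Y0) in k1.
  have uY : u^-1 * Ex P (fun w => (Z k w - U w) ^+ 2) <= u.
    by rewrite mulrC ler_pdivrMr// -expr2.
  move: k2 Y0 Z0 uY up down k1; set y := Ex P (fun w => (Z k w - U w) ^+ 2).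
  set z := Ex P (fun w => Z k w ^+ 2); set x := Ex P (fun w => U w ^+ 2).
  move=> k2 Y0 Z0 uY up down k1.
  have hV := ler_norm V.
  have zV : z <= `|V| + 1 by move: k2; rewrite ler_norml => /andP[]; lra.
  apply: (le_trans _ ue); rewrite ler_norml.
  move: k2; rewrite ler_norml => /andP[h3 h4].
  have uz := ler_wpM2l (ltW u0) zV.
  have uu1 : u ^+ 2 <= u by rewrite expr2 ger_pMr.
  have uV : 0 <= u * `|V| by rewrite mulr_ge0// ltW.
  by apply/andP; split; nra.
Unshelve. all: by end_near. Qed.

End L2_limit.

(** * Wiener sums of deterministic functions on dyadic grids *)

Section dyadic_sums.
Context {R : realType} {d : measure_display} {T : measurableType d}.
Variables (P : probability T R) (F : R -> set (set T)) (W : R -> T -> R).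
Hypotheses (hF : filtration F) (hW : wiener P F W).
Variable t : R.
Hypothesis t_gt0 : 0 < t.

(** Dyadic grids are nested: point i of level k is point i 2^j of level k + j, so the error at every
    grid time can be studied by refinement. *)
Definition mesh (k : nat) : R := t / (2 ^ k)%:R.

Lemma pow2_neq0 k : (2 ^ k)%:R != 0 :> R.
Proof. by rewrite pnatr_eq0 expn_eq0. Qed.

Lemma mesh_gt0 k : 0 < mesh k.
Proof. by rewrite divr_gt0// ltr0n expn_gt0. Qed.

Lemma mesh_total k : (2 ^ k)%:R * mesh k = t.
Proof. by rewrite mulrC divfK// pow2_neq0. Qed.

Lemma mesh_refine k j : mesh k = (2 ^ j)%:R * mesh (k + j).
Proof.
rewrite /mesh expnD natrM invfM; have := pow2_neq0 j; have := pow2_neq0 k.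
set x := (2 ^ k)%:R; set y := (2 ^ j)%:R => x0 y0.
by field; rewrite x0 y0.
Qed.

Lemma mesh_cvg : mesh k @[k --> \oo] --> 0.
Proof.
have h : t * (2^-1) ^+ k @[k --> \oo] --> (0 : R).
  rewrite -(mulr0 t); apply: cvgMr; apply: cvg_expr.
  by rewrite ger0_norm ?invr_ge0// invf_lt1// ltr1n.
by under eq_fun do rewrite /mesh natrX -exprVn.
Qed.

Lemma mesh_le i k : (i <= 2 ^ k)%N -> i%:R * mesh k <= t.
Proof. by move=> ik; rewrite -(mesh_total k) ler_wpM2r ?ler_nat// ltW// mesh_gt0. Qed.

Lemma mesh_ge0 i k : 0 <= i%:R * mesh k.
Proof. by rewrite mulr_ge0// ltW// mesh_gt0. Qed.

Lemma mesh_S i k : i.+1%:R * mesh k = i%:R * mesh k + mesh k.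
Proof. by rewrite -addn1 natrD; ring. Qed.

Implicit Types h : R -> R.

Definition dsum h k i w : R :=
  \sum_(l < i) h (l%:R * mesh k) * incr W (l%:R * mesh k) (l.+1%:R * mesh k) w.

Lemma dsumE h k i :
  dsum h k i = grid_sum W (fun l => l%:R * mesh k) (fun l => cst (h (l%:R * mesh k))) i.
Proof. by []. Qed.

Let p0 k : 0 <= 0%:R * mesh k. Proof. exact: mesh_ge0. Qed.
Let p_nd k l : l%:R * mesh k <= l.+1%:R * mesh k.
Proof. by rewrite mesh_S lerDl ltW// mesh_gt0. Qed.
Let c_rv k (x : nat -> R) l : rv_measurable (F (l%:R * mesh k)) (cst (x l) : T -> R).
Proof. by apply: rv_cst; exact: (filtration_sigma hF (mesh_ge0 l k)). Qed.
Let c_bd (x : nat -> R) l : exists c : R, forall w : T, `|(cst (x l) : T -> R) w| <= c.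
Proof. by exists `|x l|. Qed.

Lemma dsum_L2 h k i : L2 P (dsum h k i).
Proof.
rewrite dsumE; apply: (grid_sum_L2 hF hW (p0 k) (p_nd k)).
  exact: (@c_rv k (fun l => h (l%:R * mesh k))).
exact: (c_bd (fun l => h (l%:R * mesh k))).
Qed.

Lemma dsum_mean h k i : Ex P (dsum h k i) = 0.
Proof.
rewrite dsumE; apply: (grid_sum_mean hF hW (p0 k) (p_nd k)).
  exact: (@c_rv k (fun l => h (l%:R * mesh k))).
exact: (c_bd (fun l => h (l%:R * mesh k))).
Qed.

Let det_isometry k (x : nat -> R) i :
  Ex P (fun w => grid_sum W (fun l => l%:R * mesh k) (fun l => cst (x l)) i w ^+ 2) =
  \sum_(l < i) x l ^+ 2 * mesh k.
Proof.
rewrite (grid_isometry hF hW (p0 k) (p_nd k) (@c_rv k x) (c_bd x)).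
by apply: eq_bigr => l _; rewrite (Ex_cst P (x l ^+ 2)) mesh_S; ring.
Qed.

Lemma dsum_isometry h k i : Ex P (fun w => dsum h k i w ^+ 2) =
  \sum_(l < i) h (l%:R * mesh k) ^+ 2 * mesh k.
Proof. exact: (det_isometry k (fun l => h (l%:R * mesh k))). Qed.

(** The quotient of l by 2^j is the index of the coarse cell that contains the fine cell l. With its
    coefficients frozen in this way the coarse sum lives on the fine grid and can be subtracted term
    by term. *)
Lemma dsum_refine h k j i w : dsum h k i w = \sum_(l < i * 2 ^ j)
  h ((l %/ 2 ^ j)%:R * mesh k) *
    incr W (l%:R * mesh (k + j)) (l.+1%:R * mesh (k + j)) w.
Proof.
set n := (2 ^ j)%N; have n0 : (0 < n)%N by rewrite expn_gt0.
rewrite /dsum; elim: i => [|i IH]; first by rewrite mul0n !big_ord0.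
rewrite big_ord_recr/= IH.
rewrite -!(big_mkord xpredT (fun l => h ((l %/ n)%:R * mesh k) *
    incr W (l%:R * mesh (k + j)) (l.+1%:R * mesh (k + j)) w)).
rewrite (@big_cat_nat _ _ _ (i * n)%N 0 (i.+1 * n)%N)//=; last first.
  by rewrite leq_mul2r leqnSn orbT.
have shift (G : nat -> R) :
    \sum_(i * n <= l < i.+1 * n) G l = \sum_(0 <= l < n) G (l + i * n)%N.
  by rewrite -{1}(add0n (i * n)%N) big_addn mulSn addnK.
congr (_ + _); rewrite shift.
rewrite (eq_big_nat _ _ (F2 := fun l => h (i%:R * mesh k) *
    (W ((i * n + l.+1)%:R * mesh (k + j)) w - W ((i * n + l)%:R * mesh (k + j)) w))); last first.
  move=> l /andP[_ ln]; rewrite addnC divnMDl// divn_small// addn0.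
  by rewrite /incr addnS.
rewrite -mulr_sumr; congr (_ * _).
rewrite (telescope_sumr (fun l => W ((i * n + l)%:R * mesh (k + j)) w))// /incr.
have E a : (a * n)%:R * mesh (k + j) = a%:R * mesh k.
  by rewrite (mesh_refine k j) -/n mulrA -natrM.
by rewrite -(E i) -(E i.+1) mulSn addn0 [(n + _)%N]addnC.
Qed.

(** The difference of fine and coarse sums has coefficients bounded by the oscillation eta of h over
    a coarse cell. The isometry bounds its second moment uniformly in j, and [fatou_prob] carries
    the bound to the limit N. *)
Lemma refine_err h (N : T -> R) (k i : nat) (eta : R) :
  0 <= eta -> (i <= 2 ^ k)%N -> measurable_fun setT N ->
  (forall x y, 0 <= x <= t -> 0 <= y <= t -> `|x - y| < mesh k -> `|h x - h y| <= eta) ->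
  (forall e : R, 0 < e ->
    P [set w | e < `|dsum h (k + j) (i * 2 ^ j) w - N w|] @[j --> \oo] --> 0%E) ->
  L2 P (fun w => N w - dsum h k i w) /\
  Ex P (fun w => (N w - dsum h k i w) ^+ 2) <= eta ^+ 2 * t.
Proof.
move=> eta0 ik mN osc hN.
pose x j l : R := h (l%:R * mesh (k + j)) - h ((l %/ 2 ^ j)%:R * mesh k).
pose Z j := grid_sum W (fun l => l%:R * mesh (k + j)) (fun l => cst (x j l)) (i * 2 ^ j).
have L2Z j : L2 P (Z j).
  exact: (grid_sum_L2 hF hW (p0 _) (p_nd _) (@c_rv (k + j) (x j)) (c_bd (x j))).
have ZE j w : Z j w = dsum h (k + j) (i * 2 ^ j) w - dsum h k i w.
  rewrite (dsum_refine h k j i w) /dsum -sumrB; apply: eq_bigr => l _.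
  by rewrite /= /x mulrBl.
have xle j l : (l < i * 2 ^ j)%N -> `|x j l| <= eta.
  move=> li; have n0 : (0 < 2 ^ j)%N by rewrite expn_gt0.
  have e1 : l%:R * mesh (k + j) - (l %/ 2 ^ j)%:R * mesh k = (l %% 2 ^ j)%:R * mesh (k + j).
    by rewrite {1}(divn_eq l (2 ^ j)) natrD natrM (mesh_refine k j); ring.
  have m0 := mesh_gt0 (k + j).
  apply: osc.
  - rewrite mesh_ge0/= -(mesh_total (k + j)) ler_pM2r// ler_nat.
    by rewrite expnD (leq_trans (ltnW li))// leq_mul2r ik orbT.
  - rewrite mesh_ge0/= mesh_le// (leq_trans _ ik)// ltnW//.
    by rewrite ltn_divLR.
  - rewrite e1 ger0_norm ?mesh_ge0// (mesh_refine k j) ltr_pM2r// ltr_nat.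
    exact: ltn_pmod.
have EZ j : Ex P (fun w => Z j w ^+ 2) <= eta ^+ 2 * t.
  rewrite det_isometry.
  apply: (@le_trans _ _ (\sum_(l < i * 2 ^ j) eta ^+ 2 * mesh (k + j))).
    apply: ler_sum => l _; rewrite ler_pM2r ?mesh_gt0//.
    by rewrite -(real_normK (num_real (x j l))); apply: lerXn2r; rewrite ?nnegrE// xle.
  rewrite sumr_const card_ord -mulrnAr -mulr_natl ler_wpM2l ?sqr_ge0//.
  by rewrite mesh_le// expnD leq_mul2r ik orbT.
have mY : measurable_fun setT (fun w => N w - dsum h k i w).
  by apply: measurable_funB => //; exact: (dsum_L2 h k i).1.
have := @fatou_prob _ _ _ P _ Z setT _ mY L2Z measurableT EZ.
have -> : (fun w => \1_[set: T] w * (N w - dsum h k i w) ^+ 2) =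
    (fun w => (N w - dsum h k i w) ^+ 2).
  by apply/funext => w; rewrite indicT mul1r.
case; last by move=> h1 h2.
move=> e e0; have := hN e e0.
rewrite (_ : (fun j => P [set w | e < `|dsum h (k + j) (i * 2 ^ j) w - N w|]) =
  (fun j => P ([set: T] `&` [set w | e < `|Z j w - (N w - dsum h k i w)|])))//.
apply/funext => j; rewrite setTI; congr (P _); apply/seteqP; split => w /=;
by rewrite ZE opprB addrA subrK.
Qed.

End dyadic_sums.

Lemma within_continuous_bounded {R : realType} (h : R -> R) (a b : R) : a <= b ->
  {within `[a, b], continuous h} ->
  exists2 M, 0 <= M & forall x, a <= x <= b -> `|h x| <= M.
Proof.
move=> ab ch.
have : {within `[a, b], continuous (fun x => `|h x|)}.
  by move=> x; apply: cvg_norm; exact: ch.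
by move=> /(EVT_max ab)[c cab hc]; exists `|h c| => // x xab; apply: hc; rewrite in_itv.

Qed.

(** Along a path, d(E D) = E dD + D dE with dD = dN - q dt and dE = p dt, and the drift terms cancel
    by p D = E q. There is no bracket term because E is absolutely continuous. *)
Lemma product_rule_sum {R : realType} (D E p q N : R -> R) (t : R)
    (m : nat -> nat) (dt : nat -> R) : 0 < t ->
  (forall k, 0 <= dt k) -> (forall k, (m k)%:R * dt k = t) ->
  dt k @[k --> \oo] --> 0 ->
  {within `[0, t], continuous D} -> {within `[0, t], continuous E} ->
  {within `[0, t], continuous p} -> {within `[0, t], continuous q} ->
  (forall x, 0 <= x <= t -> p x * D x = E x * q x) ->
  (forall x, 0 <= x <= t -> E x - E 0 = \int[lebesgue_measure]_(s in `[0, x]) p s) ->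
  (forall x, 0 <= x <= t ->
    N x = D x - D 0 + \int[lebesgue_measure]_(s in `[0, x]) q s) ->
  forall e, 0 < e -> \forall k \near \oo,
    `|\sum_(l < m k) E (l%:R * dt k) * (N (l.+1%:R * dt k) - N (l%:R * dt k))
      - (E t * D t - E 0 * D 0)| <= e.
Proof.
move=> t0 dt0 mdt dtc cD cE cp cq pq HE HN e e0.
have [MD MD0 hMD] := within_continuous_bounded (ltW t0) cD.
have [ME ME0 hME] := within_continuous_bounded (ltW t0) cE.
have [Mp Mp0 hMp] := within_continuous_bounded (ltW t0) cp.
(* Each cell contributes an error of at most eta dt (MD + ME + Mp); the extra 1 makes M positive. *)
pose M := MD + ME + Mp + 1.
have M0 : 0 < M by rewrite ltr_wpDl// !addr_ge0.
pose eta := e / (t * M).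
have eta0 : 0 < eta by rewrite divr_gt0// mulr_gt0.
have [r1 r10 h1] := heine cD eta0.
have [r2 r20 h2] := heine cp eta0.
have [r3 r30 h3] := heine cq eta0.
have r0 : 0 < Num.min r1 (Num.min r2 r3) by rewrite !lt_min r10 r20 r30.
have [ip iq] : lebesgue_measure.-integrable `[0, t] (EFin \o p) /\
    lebesgue_measure.-integrable `[0, t] (EFin \o q).
  by split; apply: continuous_compact_integrable => //; exact: segment_compact.
have hn := (cvgr0Pnorm_lt _).1 dtc _ r0.
near=> k; have : `|dt k| < Num.min r1 (Num.min r2 r3) by near: k; exact: hn.
rewrite !lt_min => /andP[dt1 /andP[dt2 dt3]].
have tm : (m k)%:R * dt k = t := mdt k.
have -> : E t * D t - E 0 * D 0 = \sum_(l < m k)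
    (E (l.+1%:R * dt k) * D (l.+1%:R * dt k) - E (l%:R * dt k) * D (l%:R * dt k)).
  rewrite -(big_mkord xpredT (fun l => E (l.+1%:R * dt k) * D (l.+1%:R * dt k) - E (l%:R * dt k) * D (l%:R * dt k))).
  by rewrite (telescope_sumr (fun l => E (l%:R * dt k) * D (l%:R * dt k)))// tm mul0r.
rewrite -sumrB (le_trans (ler_norm_sum _ _ _))//.
have -> : e = \sum_(l < m k) eta * M * dt k.
  rewrite sumr_const card_ord -mulrnAr -mulr_natl tm /eta; field.
  by rewrite !gt_eqF.
apply: ler_sum => l _.
have u0 : 0 <= l%:R * dt k by rewrite mulr_ge0.
have uvE : l.+1%:R * dt k = l%:R * dt k + dt k by rewrite -addn1 natrD; ring.
have uv : l%:R * dt k <= l.+1%:R * dt k by rewrite uvE lerDl.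
have vt : l.+1%:R * dt k <= t by rewrite -tm ler_wpM2r// ler_nat.
have ut := le_trans uv vt; have v0 := le_trans u0 uv.
have osc (h : R -> R) r : `|dt k| < r ->
    (forall x y, 0 <= x <= t -> 0 <= y <= t -> `|x - y| < r -> `|h x - h y| <= eta) ->
    forall s, l%:R * dt k < s <= l.+1%:R * dt k -> `|h s - h (l%:R * dt k)| <= eta.
  move=> dtr hh s /andP[us sv]; apply: hh.
  - by rewrite (le_trans u0 (ltW us)) (le_trans sv).
  - by rewrite u0.
  - rewrite gtr0_norm ?subr_gt0//; move: sv; rewrite uvE => sv.
    by apply: le_lt_trans dtr; rewrite (le_trans _ (ler_norm _))// lerBlDl.
have := Rintegral_local u0 uv vt ip (osc p r2 dt2 h2).
have := Rintegral_local u0 uv vt iq (osc q r3 dt3 h3).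
have HEv : E (l.+1%:R * dt k) - E (l%:R * dt k) =
   \int[lebesgue_measure]_(s in `[0, l.+1%:R * dt k]) p s -
   \int[lebesgue_measure]_(s in `[0, l%:R * dt k]) p s.
  by rewrite -!HE ?u0 ?v0//; ring.
have HNv : N (l.+1%:R * dt k) - N (l%:R * dt k) = D (l.+1%:R * dt k) - D (l%:R * dt k) +
   (\int[lebesgue_measure]_(s in `[0, l.+1%:R * dt k]) q s -
   \int[lebesgue_measure]_(s in `[0, l%:R * dt k]) q s).
  by rewrite !HN ?u0 ?v0//; ring.
rewrite HNv -HEv.
have hD : `|D (l.+1%:R * dt k) - D (l%:R * dt k)| <= eta.
  move: (uv); rewrite le_eqVlt => /predU1P[<-|uv']; first by rewrite subrr normr0 ltW.
  by apply: (osc D r1 dt1 h1); rewrite uv' lexx.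
have pDq := pq (l%:R * dt k); rewrite u0 ut in pDq; move: (pDq isT) => {}pDq.
have b1 : `|D (l.+1%:R * dt k)| <= MD by apply: hMD; rewrite v0.
have b2 : `|E (l%:R * dt k)| <= ME by apply: hME; rewrite u0.
have b3 : `|p (l%:R * dt k)| <= Mp by apply: hMp; rewrite u0.
have dtE : l.+1%:R * dt k - l%:R * dt k = dt k by rewrite uvE; ring.
rewrite dtE.
move: b1 b2 b3 hD pDq.
set D1 := D _; set D0 := D _; set E0 := E _; set E1 := E _; set p0 := p _; set q0 := q _.
set I := \int[_]_(_ in _) _ - _.
move=> b1 b2 b3 hD pDq hI hE.
(* Three local errors, each at most a constant times eta dt, and a drift term that the relation p D
   = E q cancels. *)
have -> : E0 * (D1 - D0 + I) - (E1 * D1 - E0 * D0) =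
   E0 * (I - q0 * dt k) - (E1 - E0 - p0 * dt k) * D1 - p0 * dt k * (D1 - D0)
   + (E0 * q0 - p0 * D0) * dt k by ring.
rewrite pDq subrr mul0r addr0.
have := dt0 k => dtk0.
apply: (@le_trans _ _ (ME * (eta * dt k) + (eta * dt k) * MD + Mp * dt k * eta)).
  apply: (le_trans (ler_normB _ _)); apply: lerD.
    apply: (le_trans (ler_normB _ _)); apply: lerD.
      by rewrite normrM ler_pM.
    by rewrite normrM ler_pM.
  rewrite !normrM (ger0_norm dtk0) ler_pM ?mulr_ge0//.
  by rewrite ler_wpM2r.
by rewrite /M; have := mulr_ge0 (ltW eta0) dtk0; nra.
Unshelve. all: by end_near. Qed.

(** * The integrating factor and the Wiener integral *)

Section linear_sde.
Context {R : realType} {d : measure_display} {T : measurableType d}.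
Variables (P : probability T R) (F : R -> set (set T)) (W : R -> T -> R).
Hypotheses (hF : filtration F) (hW : wiener P F W).
Variables (Th al be : R -> T -> R) (th0 B L : R) (f g : R -> R).
Hypothesis hTh : ito_process P F W Th al be.
Hypothesis Th0 : forall w, Th 0 w = th0.
Hypothesis f_ge0 : forall x, 0 <= x -> 0 <= f x.
Hypothesis f_cont : {within [set s : R | 0 <= s], continuous f}.
Hypothesis g_der : forall x : R, 0 <= x -> is_derive x 1 g (f x).
Hypothesis g0 : g 0 = 0.
Hypothesis hal : {ae P, forall w s, 0 <= s -> al s w = - B ^+ 2 * f s * (Th s w - L)}.
Hypothesis hbe : {ae P, forall w s, 0 <= s -> be s w = B / 2 * f s}.

Definition integrating_factor (x : R) : R := expR (B ^+ 2 * g x).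
Local Notation E := integrating_factor.
(* Let N be the martingale part of Th, dN = h dW. The integrating factor E solves
   dE = p dt, hence d(E (Th - L)) = E dN, and U t below is the Wiener integral of
   the deterministic function E h over [0, t]. *)
Let p x := B ^+ 2 * f x * E x.
Let h x := B / 2 * f x.

Let E_gt0 x : 0 < E x. Proof. exact: expR_gt0. Qed.

Let E0 : E 0 = 1. Proof. by rewrite /E g0 mulr0 expR0. Qed.

Let E_der (x : R) : 0 <= x -> is_derive x 1 E (p x).
Proof.
move=> x0; have gx := g_der x0; rewrite /integrating_factor; apply: is_derive_eq.
by rewrite /GRing.scale /= /p /E; ring.
Qed.

Let within_t t (k : R -> R) : {within [set s : R | 0 <= s], continuous k} ->
  {within `[0, t], continuous k}.
Proof. by apply: continuous_subspaceW => s /=; rewrite in_itv/= => /andP[]. Qed.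

Let E_cont : {within [set s : R | 0 <= s], continuous E}.
Proof.
apply/subspace_continuousP => x /= x0; apply: cvg_within_filter.
have xd := E_der x0; apply: differentiable_continuous.
exact/derivable1_diffP/(@ex_derive _ _ _ _ _ _ _ xd).
Qed.

Let cst_cont (c : R) : {within [set s : R | 0 <= s], continuous (cst c : R -> R)}.
Proof. by apply: continuous_subspaceT => x; exact: cst_continuous. Qed.

Let withinM (k l : R -> R) : {within [set s : R | 0 <= s], continuous k} ->
  {within [set s : R | 0 <= s], continuous l} ->
  {within [set s : R | 0 <= s], continuous (fun x => k x * l x)}.
Proof. by move=> ck cl x; apply: cvgM; [exact: ck|exact: cl]. Qed.

Let p_cont : {within [set s : R | 0 <= s], continuous p}.
Proof. exact: (withinM (withinM (@cst_cont (B ^+ 2)) f_cont) E_cont). Qed.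

Let h_cont : {within [set s : R | 0 <= s], continuous h}.
Proof. exact: (withinM (@cst_cont (B / 2)) f_cont). Qed.

Let Eh_cont : {within [set s : R | 0 <= s], continuous (fun x => E x * h x)}.
Proof. exact: (withinM E_cont h_cont). Qed.

Let E_incr x y : 0 <= x -> x <= y ->
  (\int[lebesgue_measure]_(s in `[x, y]) (p s)%:E = (E y - E x)%:E)%E.
Proof.
move=> x0 xy; apply: FTC2_closed => //.
  by apply: continuous_subspaceW p_cont => s /=; rewrite in_itv/= => /andP[/(le_trans x0)].
by move=> s /andP[/(le_trans x0) s0 _]; exact: E_der.
Qed.

Let E_mono x y : 0 <= x -> x <= y -> E x <= E y.
Proof.
move=> x0 xy; rewrite -subr_ge0 -lee_fin -E_incr//; apply: integral_ge0 => s /=.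
rewrite in_itv/= => /andP[xs _]; rewrite lee_fin /p mulr_ge0 ?(ltW (E_gt0 _))//.
by rewrite mulr_ge0 ?sqr_ge0// f_ge0// (le_trans x0).
Qed.

Let N t w := ito_part Th al t w.

Let N0 w : N 0 w = 0.
Proof. by rewrite /N /ito_part subrr set_itv1 Rintegral_set1 subrr. Qed.

Variable t : R.
Hypothesis t_gt0 : 0 < t.
Local Notation dt := (mesh t).
Local Notation Q := (dsum W t).

(** Almost surely [be] equals the deterministic h at all nonnegative times, so the Euler
    coefficients can be taken constant in the outcome. The index i is positive because [euler_ito]
    works on a positive horizon. *)
Let N_lim k i e : (0 < i)%N -> (i <= 2 ^ k)%N -> 0 < e ->
  P [set w | e < `|Q h (k + j) (i * 2 ^ j) w - N (i%:R * dt k) w|]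
    @[j --> \oo] --> 0%E.
Proof.
move=> i0 ik e0; have m0 := mesh_gt0 t_gt0.
have s0 : 0 < i%:R * dt k by rewrite mulr_gt0// ltr0n.
have sub j : (i * 2 ^ j)%:R * dt (k + j) = i%:R * dt k.
  by rewrite (mesh_refine t k j) natrM mulrA.
have mc : dt (k + j) @[j --> \oo] --> 0.
  rewrite (_ : (fun j => dt (k + j)) = (fun j => dt (j + k))); last first.
    by apply/funext => j; rewrite addnC.
  by rewrite cvg_shiftn; exact: mesh_cvg.
have := @euler_ito _ _ _ P F W hF hW be (i%:R * dt k) (N (i%:R * dt k)) setT
  (fun j => i * 2 ^ j)%N (fun j => dt (k + j))
  (fun j l => cst (h (l%:R * dt (k + j)))) s0 (fun j => ltW (m0 _)) sub mc.
have bdc j l : exists c : R, forall w : T, `|(cst (h (l%:R * dt (k + j))) : T -> R) w| <= c.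
  by exists `|h (l%:R * dt (k + j))|.
have rvc j l : rv_measurable (F (l%:R * dt (k + j))) (cst (h (l%:R * dt (k + j))) : T -> R).
  by apply: rv_cst; apply: (filtration_sigma hF); exact: mesh_ge0.
move=> /(_ bdc rvc (ito_diffusion_measurable hTh) (ito_partP hTh (ltW s0))
  (ito_part_measurable hF hTh (ltW s0)) measurableT).
move=> H; have {}H := H _ e e0.
have -> : (fun j => P [set w | e < `|Q h (k + j) (i * 2 ^ j) w - N (i%:R * dt k) w|]) =
   (fun j => P (setT `&` [set w | e < `|\sum_(l < i * 2 ^ j) cst (h (l%:R * dt (k + j))) w *
       incr W (l%:R * dt (k + j)) (l.+1%:R * dt (k + j)) w - N (i%:R * dt k) w|])).
  by apply/funext => j; rewrite setTI.
apply: H; apply: filterS hbe => w hw _; split.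
  have : {within `[0, i%:R * dt k], continuous h} by exact: within_t.
  apply: subspace_eq_continuous => s; rewrite inE/= in_itv/= => /andP[s00 _].
  exact: (esym (hw s s00)).
by move=> j l _; rewrite /= hw// mesh_ge0.
Qed.

Let N_meas s : 0 <= s -> measurable_fun setT (N s).
Proof. exact: (ito_part_measurable hF hTh). Qed.

Let R_ k i w := N (i%:R * dt k) w - Q h k i w.

Let R_0 k w : R_ k 0 w = 0.
Proof. by rewrite /R_ mul0r N0 /dsum big_ord0 subrr. Qed.

Let osc_ex (k : R -> R) : {within [set s : R | 0 <= s], continuous k} ->
  forall eta, 0 < eta -> \forall n \near \oo, forall x y, 0 <= x <= t ->
    0 <= y <= t -> `|x - y| < dt n -> `|k x - k y| <= eta.
Proof.
move=> ck eta eta0.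
have [r r0 hr] := heine (@within_t t k ck) eta0.
have hn := (cvgr0Pnorm_lt _).1 (@mesh_cvg _ t) _ r0.
near=> n; have dtr : `|dt n| < r by near: n; exact: hn.
move=> x y xt yt xy; apply: hr => //; apply: (lt_trans xy).
exact: le_lt_trans (ler_norm _) dtr.
Unshelve. all: by end_near. Qed.

Let R_L2 k i eta : (i <= 2 ^ k)%N -> 0 <= eta ->
  (forall x y, 0 <= x <= t -> 0 <= y <= t -> `|x - y| < dt k -> `|h x - h y| <= eta) ->
  L2 P (R_ k i) /\ Ex P (fun w => R_ k i w ^+ 2) <= eta ^+ 2 * t.
Proof.
move=> ik eta0 osc; case: i ik => [|i] ik.
  have -> : R_ k 0 = cst 0 by apply/funext => w; rewrite R_0.
  split; first exact: L2_cst.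
  by rewrite (_ : (fun w => _) = cst 0) ?Ex_cst ?mulr_ge0 ?sqr_ge0 ?(ltW t_gt0)//;
    apply/funext => w; rewrite /= expr0n.
apply: (refine_err hF hW t_gt0 eta0 ik) => //.
  by apply: N_meas; exact: mesh_ge0.
by move=> e e0; exact: N_lim.
Qed.

Let J k w := \sum_(l < 2 ^ k) E (l%:R * dt k) * (N (l.+1%:R * dt k) w - N (l%:R * dt k) w).
Let Z k := Q (fun x => E x * h x) k (2 ^ k).

(* Summation by parts: J and Z differ by the error of N against Euler sums,
   weighted with the increments of the monotone function E. *)
Let JZE k w : J k w - Z k w =
  \sum_(l < (2 ^ k).+1) (if l == (2 ^ k)%N :> nat then E t * R_ k (2 ^ k) w
     else (E (l.+1%:R * dt k) - E (l%:R * dt k)) * - R_ k l.+1 w).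
Proof.
rewrite big_ord_recr/= eqxx.
rewrite (eq_bigr (fun l : 'I_(2 ^ k) =>
    (E (l.+1%:R * dt k) - E (l%:R * dt k)) * - R_ k l.+1 w)); last first.
  by move=> l _; rewrite ltn_eqF.
have gen n : \sum_(l < n) E (l%:R * dt k) * (N (l.+1%:R * dt k) w - N (l%:R * dt k) w)
    - Q (fun x => E x * h x) k n w =
    \sum_(l < n) (E (l.+1%:R * dt k) - E (l%:R * dt k)) * - R_ k l.+1 w
    + E (n%:R * dt k) * R_ k n w.
  elim: n => [|n IH]; first by rewrite /dsum !big_ord0 R_0 mulr0 subrr addr0.
  rewrite [in RHS]big_ord_recr/= [in LHS]big_ord_recr/=.
  have -> : Q (fun x => E x * h x) k n.+1 w = Q (fun x => E x * h x) k n w +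
      E (n%:R * dt k) * (Q h k n.+1 w - Q h k n w).
    rewrite /dsum !big_ord_recr/=; ring.
  move: IH; set A := \sum_(l < n) _; set C := Q _ k n w; set S := \sum_(l < n) _ => IH.
  have -> : A = S + E (n%:R * dt k) * R_ k n w + C by rewrite -IH; ring.
  rewrite /R_; ring.
by rewrite /J /Z gen mesh_total.
Qed.

(** The weights in [JZE] are nonnegative, as E is nondecreasing, and their total is at most 2 E t: E
    t from the last weight, E t - E 0 from the telescoping ones. Weighted Cauchy-Schwarz then
    reduces the claim to the bound eta^2 t on each error. *)
Let JZ_L2 k eta : 0 <= eta ->
  (forall x y, 0 <= x <= t -> 0 <= y <= t -> `|x - y| < dt k -> `|h x - h y| <= eta) ->
  L2 P (fun w => J k w - Z k w) /\
  Ex P (fun w => (J k w - Z k w) ^+ 2) <= (2 * E t) ^+ 2 * (eta ^+ 2 * t).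
Proof.
move=> eta0 osc.
pose n := (2 ^ k)%N.
pose u l := if l == n then E t else E (l.+1%:R * dt k) - E (l%:R * dt k).
pose x l w := if l == n then R_ k n w else - R_ k l.+1 w.
have u0 l : 0 <= u l.
  rewrite /u; case: ifP => _; first exact/ltW/E_gt0.
  rewrite subr_ge0 E_mono//; first exact: mesh_ge0.
  by rewrite ler_wpM2r ?ler_nat// ltW// mesh_gt0.
have xL2 l : (l < n.+1)%N -> L2 P (x l).
  rewrite /x ltnS leq_eqVlt; case: eqP => [_ _|_ /= ln].
    exact: (R_L2 (leqnn _) eta0 osc).1.
  have := L2Zl (-1) (R_L2 ln eta0 osc).1.
  by congr L2; apply/funext => w; rewrite mulN1r.
have xE l : (l < n.+1)%N -> Ex P (fun w => x l w ^+ 2) <= eta ^+ 2 * t.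
  rewrite /x ltnS leq_eqVlt; case: eqP => [_ _|_ /= ln].
    exact: (R_L2 (leqnn _) eta0 osc).2.
  rewrite (_ : (fun w => _) = (fun w => R_ k l.+1 w ^+ 2)).
    exact: (R_L2 ln eta0 osc).2.
  by apply/funext => w; rewrite sqrrN.
have JE w : J k w - Z k w = \sum_(l < n.+1) u l * x l w.
  by rewrite JZE; apply: eq_bigr => l _; rewrite /u /x -/n; case: ifP.
have uS : \sum_(l < n.+1) u l <= 2 * E t.
  rewrite big_ord_recr/= {2}/u eqxx.
  rewrite (eq_bigr (fun l : 'I_n => E (l.+1%:R * dt k) - E (l%:R * dt k))); last first.
    by move=> l _; rewrite /u ltn_eqF.
  rewrite -(big_mkord xpredT (fun l => E (l.+1%:R * dt k) - E (l%:R * dt k))).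
  rewrite (telescope_sumr (fun l => E (l%:R * dt k)))// /n mesh_total.
  by have := E_gt0 (0%:R * dt k); lra.
have uS0 : 0 <= \sum_(l < n.+1) u l by apply: sumr_ge0.
have JL2 : L2 P (fun w => J k w - Z k w).
  under [X in L2 _ X]eq_fun do rewrite JE.
  by apply: L2_sum => l _; apply: L2Zl; exact: xL2.
split=> //.
apply: (@le_trans _ _ (Ex P (fun w => (\sum_(l < n.+1) u l) * \sum_(l < n.+1) u l * x l w ^+ 2))).
  apply: le_Ex; first exact: JL2.2.
    apply: L1Zl; apply: L1_sum => l _; apply: L1Zl; exact: (xL2 l (ltn_ord l)).2.
  by move=> w; rewrite JE; apply: (@weighted_sqr_sum _ n.+1 u (x ^~ w)).
rewrite ExZl; last by apply: L1_sum => l _; apply: L1Zl; exact: (xL2 l (ltn_ord l)).2.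
rewrite Ex_sum => [|l _]; last by apply: L1Zl; exact: (xL2 l (ltn_ord l)).2.
apply: (@le_trans _ _ ((\sum_(l < n.+1) u l) * \sum_(l < n.+1) u l * (eta ^+ 2 * t))).
  apply: ler_wpM2l => //; apply: ler_sum => l _.
  rewrite (ExZl _ (xL2 l (ltn_ord l)).2) ler_wpM2l//; exact: xE.
have et0 : 0 <= eta ^+ 2 * t by rewrite mulr_ge0 ?sqr_ge0 ?ltW.
rewrite -mulr_suml mulrA; apply: ler_wpM2r => //.
by rewrite expr2 ler_pM.
Qed.

Let U w := E t * (Th t w - L) - (th0 - L).

(** The pathwise product rule with D = Th - L and q = B^2 f (Th - L): both p D and E q are then B^2
    f E (Th - L). *)
Let J_ae e : 0 < e -> {ae P, forall w, \forall k \near \oo, `|J k w - U w| <= e}.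
Proof.
move=> e0; apply: filterS2 hal (ito_continuous hTh) => w alw cTh.
have cD : {within [set s : R | 0 <= s], continuous (fun s => Th s w - L)}.
  by move=> s; apply: cvgB; [exact: cTh|exact: cvg_cst].
pose q s := B ^+ 2 * f s * (Th s w - L).
have cq : {within [set s : R | 0 <= s], continuous q}.
  exact: (withinM (withinM (@cst_cont (B ^+ 2)) f_cont) cD).
have := @product_rule_sum R (fun s => Th s w - L) E p q (N ^~ w) t
  (fun k => 2 ^ k)%N (mesh t) t_gt0 (fun k => ltW (mesh_gt0 t_gt0 k))
  (fun k => mesh_total t k) (@mesh_cvg _ t) (within_t cD) (within_t E_cont)
  (within_t p_cont) (within_t cq).
rewrite /J /U E0 Th0 mul1r; apply => //.
- by move=> x _; rewrite /p /q; ring.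
- by move=> x /andP[x0 _]; rewrite /Rintegral (E_incr (lexx 0) x0) /= E0.
- move=> x /andP[x0 _]; rewrite /N /ito_part Th0.
  have iq : lebesgue_measure.-integrable `[0, x] (EFin \o q).
    apply: continuous_compact_integrable; first exact: segment_compact.
    exact: within_t.
  rewrite (_ : \int[lebesgue_measure]_(s in `[0, x]) al s w =
    \int[lebesgue_measure]_(s in `[0, x]) (-1 * q s)).
    by rewrite RintegralZl//; ring.
  apply: eq_Rintegral => s; rewrite inE/= in_itv/= => /andP[s0 _].
  by rewrite alw// /q; ring.
Qed.

Let U_meas : measurable_fun setT U.
Proof.
apply: measurable_funB => //; apply: measurable_funM => //; apply: measurable_funB => //.
exact: (ito_measurable hF hTh (ltW t_gt0)).
Qed.

Let J_meas k : measurable_fun setT (J k).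
Proof.
apply: measurable_sum => l; apply: measurable_funM => //.
by apply: measurable_funB; apply: N_meas; exact: mesh_ge0.
Qed.

Let Z_L2 k : L2 P (Z k). Proof. exact: (dsum_L2 hF hW t_gt0). Qed.

Let small (c : R) (u : nat -> R) : 0 <= c ->
  (forall eta, 0 < eta -> \forall k \near \oo, 0 <= u k <= c * eta ^+ 2) ->
  u k @[k --> \oo] --> 0.
Proof.
move=> c0 hu; apply/cvgr0Pnorm_le => e e0.
pose eta := Num.min 1 (e / (c + 1)).
have c1 : 0 < c + 1 by rewrite ltr_wpDl.
have eta0 : 0 < eta by rewrite lt_min ltr01 divr_gt0.
have eta1 : eta <= 1 by rewrite ge_min lexx.
have etae : eta * (c + 1) <= e by rewrite -ler_pdivlMr// ge_min lexx orbT.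
have hn := hu _ eta0; near=> k.
have /andP[u0 uc] : 0 <= u k <= c * eta ^+ 2 by near: k; exact: hn.
rewrite ger0_norm// (le_trans uc)// (le_trans _ etae)//.
have : eta ^+ 2 <= eta by rewrite expr2 ger_pMr.
by move=> /(ler_wpM2l c0); have := ltW eta0; nra.
Unshelve. all: by end_near. Qed.

Let JZ_prob e : 0 < e -> P [set w | e < `|J k w - Z k w|] @[k --> \oo] --> 0%E.
Proof.
move=> e0; apply/cvge0P => [k|eps eps0]; first exact: measure_ge0.
have c0 : 0 <= (2 * E t) ^+ 2 * t / e ^+ 2.
  by rewrite divr_ge0 ?sqr_ge0// mulr_ge0 ?sqr_ge0// ltW.
pose c := (2 * E t) ^+ 2 * t / e ^+ 2.
pose eta := Num.min 1 (eps / (c + 1)).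
have c1 : 0 < c + 1 by rewrite ltr_wpDl.
have eta0 : 0 < eta by rewrite lt_min ltr01 divr_gt0.
have eta1 : eta <= 1 by rewrite ge_min lexx.
have etae : eta * (c + 1) <= eps by rewrite -ler_pdivlMr// ge_min lexx orbT.
have hn := osc_ex h_cont eta0; near=> k.
have osc : forall x y, 0 <= x <= t -> 0 <= y <= t -> `|x - y| < dt k -> `|h x - h y| <= eta.
  by near: k; exact: hn.
have [L2JZ EJZ] := JZ_L2 (ltW eta0) osc.
apply: (le_trans (markov_sqr e0 L2JZ EJZ)); rewrite lee_fin.
have -> : (2 * E t) ^+ 2 * (eta ^+ 2 * t) / e ^+ 2 = c * eta ^+ 2.
  by rewrite /c; ring.
rewrite (le_trans _ etae)//.
have : eta ^+ 2 <= eta by rewrite expr2 ger_pMr.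
by move=> /(ler_wpM2l c0); have := ltW eta0; rewrite -/c; nra.
Unshelve. all: by end_near. Qed.

Let Z_prob e : 0 < e -> P [set w | e < `|Z k w - U w|] @[k --> \oo] --> 0%E.
Proof.
move=> e0; have e2 : 0 < e / 2 by rewrite divr_gt0.
have mJU k : measurable [set w | e / 2 < `|J k w - U w|].
  apply: measurable_set_lt => //; apply: measurableT_comp => //.
  exact: measurable_funB.
apply: (@cvg_prob_subU _ _ _ _ _ (fun k => [set w | e / 2 < `|J k w - Z k w|])
  (fun k => [set w | e / 2 < `|J k w - U w|])) => //.
- move=> k; apply: measurable_set_lt => //; apply: measurableT_comp => //.
  by apply: measurable_funB => //; exact: (Z_L2 k).1.
- move=> k; apply: measurable_set_lt => //; apply: measurableT_comp => //.
  by apply: measurable_funB => //; exact: (Z_L2 k).1.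
- move=> k w /= ew.
  have [h1|h1] := leP `|J k w - Z k w| (e / 2); last by left.
  right => /=; rewrite ltNge; apply/negP => h2.
  move: ew; rewrite ltNge => /negP; apply.
  have -> : Z k w - U w = (J k w - U w) - (J k w - Z k w) by ring.
  by rewrite (le_trans (ler_normB _ _))// [e]splitr lerD.
- exact: JZ_prob.
- apply: cvg_prob_of_ae => //; apply: filterS (J_ae e2) => w hw.
  near=> k; apply/negP; rewrite -leNgt; near: k; exact: hw.
Unshelve. all: by end_near. Qed.

(** [Z_prob] identifies U as the limit in probability of the Wiener sums Z k, and [refine_err] turns
    this into convergence in L2. Mean 0 survives the limit, and the isometry sum, a Riemann sum,
    tends to the integral. *)
Lemma linear_sde_moments :
  [/\ L2 P U, Ex P U = 0 & Ex P (fun w => U w ^+ 2) =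
    \int[lebesgue_measure]_(s in `[0, t]) (E s * (B / 2 * f s)) ^+ 2].
Proof.
have UZ k eta : 0 <= eta -> (forall x y, 0 <= x <= t -> 0 <= y <= t ->
    `|x - y| < dt k -> `|E x * h x - E y * h y| <= eta) ->
    L2 P (fun w => U w - Z k w) /\ Ex P (fun w => (U w - Z k w) ^+ 2) <= eta ^+ 2 * t.
  move=> eta0 osc.
  apply: (@refine_err _ _ _ P F W hF hW t t_gt0 (fun x => E x * h x) U k (2 ^ k) eta eta0 (leqnn _) U_meas osc).
  move=> e e0; have := Z_prob e0; rewrite -(cvg_shiftn k).
  rewrite (_ : (fun n => P [set w | e < `|Z (n + k) w - U w|]) =
    (fun j => P [set w | e < `|Q (fun x => E x * h x) (k + j) (2 ^ k * 2 ^ j) w - U w|]))//.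
  by apply/funext => j; rewrite /Z addnC expnD.
have ZU_sym k : (fun w => (Z k w - U w) ^+ 2) = (fun w => (U w - Z k w) ^+ 2).
  by apply/funext => w; ring.
have UZ_L2 k : L2 P (fun w => Z k w - U w).
  (* Square integrability is required at every level k, not only on fine grids, so the oscillation
     is bounded crudely by 2 M. *)
  have [M M0 hM] := within_continuous_bounded (ltW t_gt0) (within_t Eh_cont).
  have MM : 0 <= M + M by rewrite addr_ge0.
  have [|L2UZ _] := UZ k (M + M) MM.
    by move=> x y xt yt _; rewrite (le_trans (ler_normB _ _))// lerD ?hM.
  have := L2Zl (-1) L2UZ; congr L2; apply/funext => w; ring.
apply: (@L2_limit _ _ _ P U Z) => //.
- by move=> k; exact: (dsum_mean hF hW).
- apply: (small (ltW t_gt0)) => eta eta0.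
  have hn := osc_ex Eh_cont eta0; near=> k; rewrite ZU_sym.
  rewrite Ex_ge0/=; last by move=> w; exact: sqr_ge0.
  rewrite mulrC; apply: (UZ k eta (ltW eta0) _).2.
  by near: k; exact: hn.
- apply/cvgrPdist_le => e e0.
  have cE2 : {within `[0, t], continuous (fun s => (E s * (B / 2 * f s)) ^+ 2)}.
    by apply: within_t; exact: (withinM Eh_cont Eh_cont).
  have := @Riemann_near R (fun s => (E s * (B / 2 * f s)) ^+ 2) t (fun k => 2 ^ k)%N (mesh t)
    (fun k => ltW (mesh_gt0 t_gt0 k)) (fun k => mesh_total t k) (@mesh_cvg _ t) t_gt0 cE2 e e0.
  move=> hn; near=> k; rewrite (dsum_isometry hF hW)//.
  by near: k; exact: hn.
Unshelve. all: by end_near. Qed.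

End linear_sde.

(** * Asymptotics of the variance *)

Section variance_bounds.
Context {R : realType}.
Variables (B : R) (f g : R -> R).
Hypothesis f_ge0 : forall x, 0 <= x -> 0 <= f x.
Hypothesis f_cont : {within [set s : R | 0 <= s], continuous f}.
Hypothesis g_der : forall x : R, 0 <= x -> is_derive x 1 g (f x).
Local Notation E := (integrating_factor B g).

Definition sde_variance (t : R) : R :=
  (\int[lebesgue_measure]_(s in `[0, t]) (E s * (B / 2 * f s)) ^+ 2) / E t ^+ 2.

Let E_gt0 x : 0 < E x. Proof. exact: expR_gt0. Qed.

Let E2_der (x : R) : 0 <= x -> is_derive x 1 (fun y => E y ^+ 2) (2 * B ^+ 2 * f x * E x ^+ 2).
Proof.
move=> x0; have gx := g_der x0; rewrite /integrating_factor; apply: is_derive_eq.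
by rewrite /GRing.scale /=; ring.
Qed.

Let E_cont : {within [set s : R | 0 <= s], continuous E}.
Proof.
apply/subspace_continuousP => x /= x0; apply: cvg_within_filter.
have gx := g_der x0.
have xd : is_derive x 1 E (E x * (B ^+ 2 * f x)).
  by rewrite /integrating_factor; apply: is_derive_eq; rewrite /GRing.scale /=; ring.
apply: differentiable_continuous.
exact/derivable1_diffP/(@ex_derive _ _ _ _ _ _ _ xd).
Qed.

Let withinM (k l : R -> R) : {within [set s : R | 0 <= s], continuous k} ->
  {within [set s : R | 0 <= s], continuous l} ->
  {within [set s : R | 0 <= s], continuous (fun x => k x * l x)}.
Proof. by move=> ck cl x; apply: cvgM; [exact: ck|exact: cl]. Qed.

Let cst_cont (c : R) : {within [set s : R | 0 <= s], continuous (cst c : R -> R)}.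
Proof. by apply: continuous_subspaceT => x; exact: cst_continuous. Qed.

Let h s := (E s * (B / 2 * f s)) ^+ 2.
Let q s := 2 * B ^+ 2 * f s * E s ^+ 2.

Let h_cont : {within [set s : R | 0 <= s], continuous h}.
Proof.
have c := withinM E_cont (withinM (@cst_cont (B / 2)) f_cont).
exact: (withinM c c).
Qed.

Let q_cont : {within [set s : R | 0 <= s], continuous q}.
Proof.
exact: (withinM (withinM (@cst_cont (2 * B ^+ 2)) f_cont) (withinM E_cont E_cont)).
Qed.

Let integ (k : R -> R) a b : 0 <= a -> {within [set s : R | 0 <= s], continuous k} ->
  lebesgue_measure.-integrable `[a, b] (EFin \o k).
Proof.
move=> a0 ck; apply: continuous_compact_integrable; first exact: segment_compact.
by apply: continuous_subspaceW ck => s /=; rewrite in_itv/= => /andP[/(le_trans a0)].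
Qed.

Let int_q s0 t : 0 <= s0 -> s0 <= t ->
  \int[lebesgue_measure]_(s in `]s0, t]) q s = E t ^+ 2 - E s0 ^+ 2.
Proof.
move=> s00 s0t; rewrite Rintegral_itv_obnd_cbnd; last first.
  apply: (integrableS _ _ _ (@integ q s0 t s00 q_cont)) => //.
  by apply: subset_itvr; rewrite bnd_simp.
have cq : {within `[s0, t], continuous q}.
  by apply: continuous_subspaceW q_cont => s /=; rewrite in_itv/= => /andP[/(le_trans s00)].
have dq x : s0 <= x <= t -> is_derive x 1 (fun s => E s ^+ 2) (q x).
  by move=> /andP[/(le_trans s00) x0 _]; exact: E2_der.
by rewrite /Rintegral (FTC2_closed s0t cq dq).
Qed.

Let I t := \int[lebesgue_measure]_(s in `[0, t]) h s.

Let I_split s0 t : 0 <= s0 -> s0 <= t ->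
  I t - I s0 = \int[lebesgue_measure]_(s in `]s0, t]) h s.
Proof.
move=> s00 s0t; apply: (@Rintegral_itvB R h (BLeft 0) (BRight t) s0).
- exact: integ.
- by rewrite bnd_simp.
- by rewrite bnd_simp.
Qed.

(* Since q is the derivative of E^2, the variance is the average of f / 8 with
   respect to d(E^2), up to normalisation. *)
Let hq s : h s = 8^-1 * f s * q s.
Proof. by rewrite /h /q; field. Qed.

Let q_ge0 s : 0 <= s -> 0 <= q s.
Proof. by move=> s0; rewrite /q mulr_ge0 ?sqr_ge0// mulr_ge0 ?f_ge0// mulr_ge0 ?sqr_ge0. Qed.

Let sub_integ (k : R -> R) s0 t : 0 <= s0 -> {within [set s : R | 0 <= s], continuous k} ->
  lebesgue_measure.-integrable `]s0, t] (EFin \o k).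
Proof.
move=> s00 ck; apply: (integrableS _ _ _ (@integ k s0 t s00 ck)) => //.
by apply: subset_itvr; rewrite bnd_simp.
Qed.

(** The part of the integral before s0 is a constant over E t^2; after s0 the integrand is at most m
    / 8 times the derivative of E^2. *)
Lemma sde_variance_le m s0 t : 0 <= s0 -> s0 <= t -> 0 <= m ->
  (forall s, s0 < s <= t -> f s <= m) ->
  sde_variance t <= I s0 / E t ^+ 2 + m / 8 * (1 - E s0 ^+ 2 / E t ^+ 2).
Proof.
move=> s00 s0t m0 fm; have Et : 0 < E t ^+ 2 by rewrite exprn_gt0.
rewrite /sde_variance ler_pdivrMr// mulrDl divfK ?gt_eqF// -lerBlDl I_split//.
have -> : m / 8 * (1 - E s0 ^+ 2 / E t ^+ 2) * E t ^+ 2 = m / 8 * (E t ^+ 2 - E s0 ^+ 2).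
  by field; rewrite gt_eqF.
rewrite -int_q// -RintegralZl//; last exact: sub_integ.
apply: le_Rintegral => //; first exact: sub_integ.
  exact: (sub_integ t s00 (withinM (@cst_cont (m / 8)) q_cont)).
move=> s /=; rewrite in_itv/= => st; rewrite hq.
have s_ge0 : 0 <= s by case/andP: st => /ltW/(le_trans s00).
rewrite ler_wpM2r ?q_ge0// mulrC ler_wpM2r// fm//.
Qed.

Lemma sde_variance_ge m s0 t : 0 <= s0 -> s0 <= t -> 0 <= m ->
  (forall s, s0 < s <= t -> m <= f s) ->
  m / 8 * (1 - E s0 ^+ 2 / E t ^+ 2) <= sde_variance t.
Proof.
move=> s00 s0t m0 fm; have Et : 0 < E t ^+ 2 by rewrite exprn_gt0.
have I0 : 0 <= I s0 by apply: Rintegral_ge0 => s _; exact: sqr_ge0.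
rewrite /sde_variance ler_pdivlMr//.
apply: (@le_trans _ _ (I t - I s0)); last by rewrite lerBlDr lerDl.
rewrite I_split//.
have -> : m / 8 * (1 - E s0 ^+ 2 / E t ^+ 2) * E t ^+ 2 = m / 8 * (E t ^+ 2 - E s0 ^+ 2).
  by field; rewrite gt_eqF.
rewrite -int_q// -RintegralZl//; last exact: sub_integ.
apply: le_Rintegral => //; last 2 first.
- exact: sub_integ.
- move=> s /=; rewrite in_itv/= => st; rewrite hq.
  have s_ge0 : 0 <= s by case/andP: st => /ltW/(le_trans s00).
  by rewrite ler_wpM2r ?q_ge0// mulrC ler_wpM2l// fm.
- exact: (sub_integ t s00 (withinM (@cst_cont (m / 8)) q_cont)).
Qed.

End variance_bounds.

Section variance_limits.
Context {R : realType}.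
Variables (B : R) (f g : R -> R).
Hypothesis f_ge0 : forall x, 0 <= x -> 0 <= f x.
Hypothesis f_cont : {within [set s : R | 0 <= s], continuous f}.
Hypothesis g_der : forall x : R, 0 <= x -> is_derive x 1 g (f x).
Local Notation E := (integrating_factor B g).

Let E_gt0 x : 0 < E x. Proof. exact: expR_gt0. Qed.

Lemma sde_variance_le_eighth t : (forall x, 0 <= x -> f x <= 1) -> 0 <= t ->
  sde_variance B f g t <= 8^-1.
Proof.
move=> f1 t0; apply: (le_trans (@sde_variance_le R B f g f_ge0 f_cont g_der 1 0 t _ t0 ler01 _)) => //.
  by move=> s /andP[/ltW s0 _]; exact: f1.
rewrite set_itv1 /Rintegral integral_set1 /= mul0r add0r mul1r -[leRHS]mulr1 ler_pM2l//.
by rewrite gerBl divr_ge0// sqr_ge0.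
Qed.

Hypothesis Einv : (E t)^-1 @[t --> +oo] --> 0.

Let cvg_sqr c : c / E t ^+ 2 @[t --> +oo] --> 0.
Proof.
rewrite -(mulr0 c); apply: cvgMr.
under eq_fun do rewrite -exprVn expr2.
by rewrite -(mulr0 0); exact: (cvgM Einv Einv).
Qed.

Lemma cvg_sde_variance0 : f t @[t --> +oo] --> 0 -> sde_variance B f g t @[t --> +oo] --> 0.
Proof.
move=> f0; apply/cvgr0Pnorm_le => e e0.
(* With f <= 4 e beyond s0, the second term of [sde_variance_le] is at most e / 2; the first tends
   to 0 because 1 / E t does. *)
have e4 : 0 < 4 * e by rewrite mulr_gt0.
have [s1 [_ fs1]] : \forall t \near +oo, `|f t| <= 4 * e by move/cvgr0Pnorm_le : f0; exact.
pose s0 := Num.max s1 0.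
have s00 : 0 <= s0 by rewrite le_max lexx orbT.
near=> t.
have s0t : s0 <= t by near: t; apply: nbhs_pinfty_ge; rewrite num_real.
have t0 : 0 <= t := le_trans s00 s0t.
rewrite ger0_norm; last first.
  by rewrite divr_ge0 ?sqr_ge0//; apply: Rintegral_ge0 => s _; exact: sqr_ge0.
apply: (le_trans (@sde_variance_le R B f g f_ge0 f_cont g_der (4 * e) s0 t s00 s0t (ltW e4) _)).
  move=> s /andP[s0s _]; apply: (le_trans (ler_norm _)); apply: fs1.
  by apply: le_lt_trans s0s; rewrite le_max lexx.
apply: (@le_trans _ _ (e / 2 + e / 2)); last by rewrite -splitr.
apply: lerD.
  apply: (le_trans (ler_norm _)); near: t.
  have /cvgr0Pnorm_le := cvg_sqr (\int[lebesgue_measure]_(s in `[0, s0]) (E s * (B / 2 * f s)) ^+ 2).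
  by apply; rewrite divr_gt0.
have -> : 4 * e / 8 = e / 2 by field.
rewrite -[leRHS]mulr1 ler_pM2l ?divr_gt0//.
by rewrite gerBl divr_ge0// sqr_ge0.
Unshelve. all: by end_near. Qed.

Lemma cvg_sde_variance_eighth : (forall x, 0 <= x -> f x = 1) ->
  sde_variance B f g t @[t --> +oo] --> (8^-1 : R).
Proof.
move=> f1.
have lim : 8^-1 * (1 - E 0 ^+ 2 / E t ^+ 2) @[t --> +oo] --> (8^-1 : R).
  suff : 8^-1 * (1 - E 0 ^+ 2 / E t ^+ 2) @[t --> +oo] --> (8^-1 * (1 - 0) : R).
    by rewrite subr0 mulr1.
  by apply: cvgMr; apply: cvgB; [exact: cvg_cst|exact: cvg_sqr].
apply: (@squeeze_cvgr _ _ _ _ (fun t => 8^-1 * (1 - E 0 ^+ 2 / E t ^+ 2)) (cst 8^-1)); last 2 first.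
- exact: lim.
- exact: cvg_cst.
near=> t.
have t0 : 0 <= t by near: t; apply: nbhs_pinfty_ge; rewrite num_real.
rewrite sde_variance_le_eighth ?andbT//; last by move=> x x0; rewrite f1.
rewrite -[8^-1]mul1r; apply: sde_variance_ge => // s /andP[/ltW s0 _].
by rewrite f1.
Unshelve. all: by end_near. Qed.

Lemma cvg_sde_variance_pinfty : f t @[t --> +oo] --> +oo ->
  sde_variance B f g t @[t --> +oo] --> +oo.
Proof.
move=> /cvgryPge foo; apply/cvgryPgey; near=> A.
have A0 : 0 < A by near: A; apply: nbhs_pinfty_gt; rewrite num_real.
(* The lower bound becomes 2 A (1 - E s0^2 / E t^2), where the ratio is eventually at most 1/2. *)
have [s1 [_ fs1]] := foo (16 * A).
pose s0 := Num.max s1 0.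
have s00 : 0 <= s0 by rewrite le_max lexx orbT.
near=> t.
have s0t : s0 <= t by near: t; apply: nbhs_pinfty_ge; rewrite num_real.
apply: (le_trans _ (@sde_variance_ge R B f g f_ge0 f_cont g_der (16 * A) s0 t s00 s0t _ _)); last 2 first.
- by rewrite mulr_ge0// ltW.
- move=> s /andP[s0s _]; apply: fs1.
  by apply: le_lt_trans s0s; rewrite le_max lexx.
have -> : 16 * A / 8 = A * 2 by field.
rewrite -mulrA; apply: ler_peMr; first exact: ltW.
have h : E s0 ^+ 2 / E t ^+ 2 <= 2^-1.
  apply: (le_trans (ler_norm _)); near: t.
  by have /cvgr0Pnorm_le := cvg_sqr (E s0 ^+ 2); apply; rewrite invr_gt0.
lra.
Unshelve. all: by end_near. Qed.

End variance_limits.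

(** * Growth of powers, the gain and its primitive *)

Lemma cvg_powR_pinfty {R : realType} (r : R) : 0 < r -> x `^ r @[x --> +oo] --> +oo.
Proof.
move=> r0; apply/cvgryPgey; near=> A.
have A0 : 0 <= A by near: A; apply: nbhs_pinfty_ge; rewrite num_real.
near=> x.
have Ax : A `^ r^-1 <= x by near: x; apply: nbhs_pinfty_ge; rewrite num_real.
have -> : A = (A `^ r^-1) `^ r by rewrite -powRrM mulVf ?gt_eqF// powRr1.
apply: (ge0_ler_powR (ltW r0)) Ax; rewrite nnegrE ?powR_ge0//.
Unshelve. all: by end_near. Qed.

Lemma cvg_ln_pinfty {R : realType} : @ln R x @[x --> +oo] --> +oo.
Proof.
apply/cvgryPge => A; near=> x.
have Ax : expR A <= x by near: x; apply: nbhs_pinfty_ge; rewrite num_real.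
by rewrite -[A]expRK ler_ln ?posrE ?expR_gt0// (lt_le_trans (expR_gt0 _) Ax).
Unshelve. all: by end_near. Qed.

Section gain.
Context {R : realType}.
Variables (K p : R).
Hypothesis K_gt0 : 0 < K.

(** Normalised to vanish at 0, so that the integrating factor starts at 1. *)
Definition gain_primitive (s : R) : R :=
  if p == 1 then ln (K * s + 1) / K else ((K * s + 1) `^ (1 - p) - 1) / (K * (1 - p)).

Let base_ge1 s : 0 <= s -> 1 <= K * s + 1.
Proof. by move=> s0; rewrite lerDr mulr_ge0// ltW. Qed.

Let base_gt0 s : 0 <= s -> 0 < K * s + 1.
Proof. by move=> /base_ge1; apply: lt_le_trans. Qed.

Lemma gain_ge0 s : 0 <= gain K p s. Proof. exact: powR_ge0. Qed.

Lemma gain_primitive0 : gain_primitive 0 = 0.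
Proof. by rewrite /gain_primitive mulr0 add0r ln1 mul0r powR1 subrr mul0r if_same. Qed.

Let base_der (s : R) : is_derive s 1 (fun x : R => K * x + 1) K.
Proof. by apply: is_derive_eq; rewrite /GRing.scale /= mulr1 addr0. Qed.

Lemma is_derive_gain_primitive (s : R) : 0 <= s -> is_derive s 1 gain_primitive (gain K p s).
Proof.
move=> s0; have b0 := base_gt0 s0; rewrite /gain_primitive /gain.
have [->|p1] := eqVneq p 1.
  have dl := is_derive1_ln b0.
  have dc : is_derive s 1 (fun x : R => ln (K * x + 1)) ((K * s + 1)^-1 * K).
    exact: (@is_derive1_comp _ (@ln R) (fun x : R => K * x + 1) s _ _ dl (base_der s)).
  apply: is_derive_eq; rewrite /GRing.scale /=.
  by rewrite powR_inv1 ?ltW//; field; rewrite !gt_eqF.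
have dp := is_derive1_powR (1 - p) b0.
have dc : is_derive s 1 (fun x : R => (K * x + 1) `^ (1 - p))
    ((1 - p) * (K * s + 1) `^ (1 - p - 1) * K).
  exact: (@is_derive1_comp _ ((@powR R) ^~ (1 - p)) (fun x : R => K * x + 1) s _ _ dp (base_der s)).
apply: is_derive_eq; rewrite /GRing.scale /=.
have -> : 1 - p - 1 = - p by ring.
have p1' : 1 - p != 0 by rewrite subr_eq0 eq_sym.
by field; rewrite p1' gt_eqF.
Qed.

Lemma continuous_gain : {within [set s : R | 0 <= s], continuous (gain K p)}.
Proof.
apply/subspace_continuousP => s /= s0; apply: cvg_within_filter.
have dp := is_derive1_powR (- p) (base_gt0 s0).
have dc := @is_derive1_comp _ ((@powR R) ^~ (- p)) (fun x : R => K * x + 1) s _ _ dp (base_der s).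
apply: differentiable_continuous.
exact/derivable1_diffP/(@ex_derive _ _ _ _ _ _ _ dc).
Qed.

Let base_cvg : K * s + 1 @[s --> +oo] --> +oo.
Proof.
apply/cvgryPge => A; near=> s.
have As : (A - 1) / K <= s by near: s; apply: nbhs_pinfty_ge; rewrite num_real.
by rewrite -lerBlDr mulrC -ler_pdivrMr.
Unshelve. all: by end_near. Qed.

Let base_powR r : 0 < r -> (K * s + 1) `^ r @[s --> +oo] --> +oo.
Proof. by move=> r0; exact: (cvg_comp _ _ base_cvg (cvg_powR_pinfty r0)). Qed.

Let base_powR0 r : r < 0 -> (K * s + 1) `^ r @[s --> +oo] --> 0.
Proof.
move=> r0; have := @base_powR (- r); rewrite oppr_gt0 => /(_ r0) h.
have : ((K * s + 1) `^ (- r))^-1 @[s --> +oo] --> 0.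
  apply/gtr0_cvgV0 => //; near=> s; apply: powR_gt0; apply: base_gt0.
  by near: s; apply: nbhs_pinfty_ge; rewrite num_real.
by under eq_fun do rewrite -powRN opprK.
Unshelve. all: by end_near. Qed.

Lemma gain_primitive_pinfty : p <= 1 -> gain_primitive s @[s --> +oo] --> +oo.
Proof.
rewrite le_eqVlt /gain_primitive => /predU1P[->|p1].
  rewrite eqxx; under eq_fun do rewrite mulrC.
  apply: gt0_cvgMry; first by rewrite invr_gt0.
  exact: (cvg_comp _ _ base_cvg cvg_ln_pinfty).
rewrite lt_eqF//; under eq_fun do rewrite mulrC.
apply: gt0_cvgMry; first by rewrite invr_gt0 mulr_gt0// subr_gt0.
apply/cvgryPge => A.
have /cvgryPge/(_ (A + 1)) : (K * s + 1) `^ (1 - p) @[s --> +oo] --> +oo.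
  by apply: base_powR; rewrite subr_gt0.
by apply: filterS => s; rewrite -lerBrDr.
Qed.

Lemma gain_primitive_cvg : 1 < p -> gain_primitive s @[s --> +oo] --> (K * (p - 1))^-1.
Proof.
move=> p1; rewrite /gain_primitive gt_eqF//.
have -> : (K * (p - 1))^-1 = (0 - 1) / (K * (1 - p)).
  have n1 : 1 - p != 0 by rewrite subr_eq0 lt_eqF.
  have n2 : p - 1 != 0 by rewrite subr_eq0 gt_eqF.
  by field; rewrite n1 n2 gt_eqF.
apply: cvgMl; apply: cvgB; last exact: cvg_cst.
by apply: base_powR0; rewrite subr_lt0.
Qed.

Lemma gain_le1 s : 0 <= p -> 0 <= s -> gain K p s <= 1.
Proof.
move=> p0 s0; rewrite /gain -[leRHS](powRr0 (K * s + 1)).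
by rewrite ler_powR ?base_ge1// oppr_le0.
Qed.

Lemma gain_cvg0 : 0 < p -> gain K p s @[s --> +oo] --> 0.
Proof. by move=> p0; apply: base_powR0; rewrite oppr_lt0. Qed.

Lemma gain_pinfty : p < 0 -> gain K p s @[s --> +oo] --> +oo.
Proof. by move=> p0; apply: base_powR; rewrite oppr_gt0. Qed.

End gain.

Lemma cvg_integrating_factorV {R : realType} (B : R) (g : R -> R) :
  B != 0 -> g t @[t --> +oo] --> +oo -> (integrating_factor B g t)^-1 @[t --> +oo] --> 0.
Proof.
move=> B0 goo; rewrite /integrating_factor; under eq_fun do rewrite -expRN.
have h : B ^+ 2 * g t @[t --> +oo] --> +oo by apply: gt0_cvgMry => //; rewrite exprn_even_gt0.
exact: (cvg_comp _ _ h (@cvgr_expR R)).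
Qed.

(** * Filters started at an eigenstate *)

Section diagonal_entries.
Context {R : realType} (J : nat).
Local Notation state := 'M[R[i]]_((2 * J).+1).
Local Notation Re := (@complex.Re R).
Implicit Types (A : state) (i : 'I_((2 * J).+1)).

Definition level i : R := J%:R - i%:R.

Let Jz_levelE : @Jz R J = diag_mx (\row_i (level i)%:C%C).
Proof. by congr diag_mx; apply/rowP => i; rewrite !mxE /level rmorphB !rmorph_nat. Qed.

Let ReM (x : R) (a : R[i]) : Re (x%:C%C * a) = x * Re a.
Proof. by case: a => a b /=; rewrite mul0r subr0. Qed.

Let ReD (a b : R[i]) : Re (a + b) = Re a + Re b.
Proof. by case: a b => a1 a2 [b1 b2]. Qed.

Let ReN (a : R[i]) : Re (- a) = - Re a.
Proof. by case: a. Qed.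

Let JzM A i j : (Jz J *m A) i j = (level i)%:C%C * A i j.
Proof. by rewrite Jz_levelE mul_diag_mx !mxE. Qed.

Let MJz A i j : (A *m Jz J) i j = A i j * (level j)%:C%C.
Proof. by rewrite Jz_levelE mul_mx_diag !mxE. Qed.

(** [Jz] is real and diagonal, so its mean sees only the real parts of the diagonal entries; this
    reduces the matrix equation to scalar ones. *)
Lemma mean_JzE A : mean_Jz A = \sum_i level i * Re (A i i).
Proof.
rewrite /mean_Jz /mxtrace (big_morph Re ReD (erefl _ : Re 0 = 0)).
by apply: eq_bigr => i _; rewrite JzM ReM.
Qed.

Let subE A B i j : (A - B) i j = A i j - B i j.
Proof. by rewrite !mxE. Qed.

Let commutator_Jz_diag A i : commutator (Jz J) A i i = 0.
Proof. by rewrite /commutator subE JzM MJz mulrC subrr. Qed.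

(** Without control the Hamiltonian is a multiple of [Jz], and a commutator with a diagonal matrix
    has zero diagonal. The diagonal entries thus move only through the backaction, which is
    proportional to the entry itself. *)
Lemma Re_lindblad_diag omega kappa A i : Re (lindblad omega kappa 0 A i i) = 0.
Proof.
rewrite /lindblad /hamiltonian scale0r addr0.
have -> : commutator (omega%:C%C *: Jz J) A = omega%:C%C *: commutator (Jz J) A.
  by rewrite /commutator -scalemxAl -scalemxAr scalerBr.
have scaleE c B : (c *: B : state) i i = c * B i i by rewrite mxE.
by rewrite subE !scaleE !commutator_Jz_diag !mulr0 subrr.
Qed.

Lemma Re_backaction_diag A i :
  Re (backaction A i i) = 2 * (level i - mean_Jz A) * Re (A i i).
Proof.
rewrite /backaction subE.
have -> : (Jz J *m A + A *m Jz J) i i = (Jz J *m A) i i + (A *m Jz J) i i by rewrite mxE.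
rewrite JzM MJz mxE ReD ReN ReD [A i i * _]mulrC !ReM; ring.
Qed.

End diagonal_entries.

Section eigenstate_filter.
Context {R : realType} {d : measure_display} {T : measurableType d}.
Variables (P : probability T R) (F : R -> set (set T)) (W : R -> T -> R).
Hypotheses (hF : filtration F) (hW : wiener P F W).
Variables (J : nat) (n : 'I_((2 * J).+1)) (omega : R) (kappa theta u : R -> T -> R).
Variables (dy : @differential R d T) (rho : R -> T -> 'M[R[i]]_((2 * J).+1)).
Hypothesis rho_filter : filter_equation P F W omega kappa theta u dy rho.
Hypothesis rho0 : forall w, rho 0 w = pure_state n.
Local Notation Re := (@complex.Re R).
Local Notation x t w := (mean_Jz (rho t w)).
Local Notation r i t w := (Re (rho t w i i)).

Let withinM (k l : R -> R) : {within [set s : R | 0 <= s], continuous k} ->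
  {within [set s : R | 0 <= s], continuous l} ->
  {within [set s : R | 0 <= s], continuous (fun x => k x * l x)}.
Proof. by move=> ck cl y; apply: cvgM; [exact: ck|exact: cl]. Qed.

Let withinB (k l : R -> R) : {within [set s : R | 0 <= s], continuous k} ->
  {within [set s : R | 0 <= s], continuous l} ->
  {within [set s : R | 0 <= s], continuous (fun x => k x - l x)}.
Proof. by move=> ck cl y; apply: cvgB; [exact: ck|exact: cl]. Qed.

Let cst_cont (c : R) : {within [set s : R | 0 <= s], continuous (cst c : R -> R)}.
Proof. by apply: continuous_subspaceT => s; exact: cst_continuous. Qed.

Let r_cont : {ae P, forall w, forall i, {within [set s : R | 0 <= s], continuous (fun s => r i s w)}}.
Proof. by apply: filter_forall => i; have [/ito_continuous] := rho_filter i i. Qed.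

Let x_contP w : (forall i, {within [set s : R | 0 <= s], continuous (fun s => r i s w)}) ->
  {within [set s : R | 0 <= s], continuous (fun s => x s w)}.
Proof.
move=> rc; have -> : (fun s => x s w) = fun s => \sum_i level i * r i s w.
  by apply/funext => s; exact: mean_JzE.
move=> s; apply: cvg_big => [|i _]; first exact: add_continuous.
exact: (withinM (@cst_cont (level i)) (rc i)).
Qed.

Lemma continuous_mean_Jz : continuous_paths P (fun t w => x t w).
Proof. by apply: filterS r_cont => w; exact: x_contP. Qed.

Hypothesis u0 : forall t w, 0 <= t -> u t w = 0.
Hypothesis dy2 : forall t w, dy.2 t w = 1.
Hypothesis theta_cont : continuous_paths P theta.
Hypothesis dy_cont : continuous_paths P dy.1.

Let v t w := theta t w * (dy.1 t w - 2 * theta t w * x t w).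
(** Ratios of drift and diffusion to the entry r i, as [aE] and [bE] show. Their continuous paths
    supply the random growth constant for [ito_unique]. *)
Let D (i : 'I_(2 * J).+1) t w := v t w * (2 * (level i - x t w)).
Let G (i : 'I_(2 * J).+1) t w := theta t w * (2 * (level i - x t w)).

Let regular : {ae P, forall w,
  [/\ forall i, {within [set s : R | 0 <= s], continuous (fun s => r i s w)},
      {within [set s : R | 0 <= s], continuous (theta ^~ w)},
      {within [set s : R | 0 <= s], continuous (v ^~ w)},
      forall i, {within [set s : R | 0 <= s], continuous (D i ^~ w)}
    & forall i, {within [set s : R | 0 <= s], continuous (G i ^~ w)}]}.
Proof.
near=> w.
have rc : forall i, {within [set s : R | 0 <= s], continuous (fun s => r i s w)} by near: w; exact: r_cont.
have tc : {within [set s : R | 0 <= s], continuous (theta ^~ w)} by near: w; exact: theta_cont.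
have yc : {within [set s : R | 0 <= s], continuous (dy.1 ^~ w)} by near: w; exact: dy_cont.
have xc := x_contP rc.
have zc (i : 'I_(2 * J).+1) := withinM (@cst_cont 2) (withinB (@cst_cont (level i)) xc).
have vc := withinM tc (withinB yc (withinM (withinM (@cst_cont 2) tc) xc)).
split; [exact: rc|exact: tc|exact: vc|move=> i|move=> i].
  exact: (withinM vc (zc i)).
exact: (withinM tc (zc i)).
Unshelve. all: by end_near. Qed.

Let a (i : 'I_(2 * J).+1) t w := Re ((lindblad omega (kappa t w) (u t w) (rho t w) + (v t w)%:C%C *: backaction (rho t w)) i i).
Let b (i : 'I_(2 * J).+1) t w := Re (((theta t w * dy.2 t w)%:C%C *: backaction (rho t w)) i i).

Let Re_scale (c : R) (A : 'M[R[i]]_((2 * J).+1)) i : Re ((c%:C%C *: A) i i) = c * Re (A i i).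
Proof. by rewrite mxE; case: (A i i) => p q /=; rewrite mul0r subr0. Qed.

Let aE i t w : 0 <= t -> a i t w = D i t w * r i t w.
Proof.
move=> t0; rewrite /a u0// mxE.
have ReD (p q : R[i]) : Re (p + q) = Re p + Re q by case: p q => ? ? [? ?].
by rewrite ReD Re_lindblad_diag add0r Re_scale Re_backaction_diag /D mulrA.
Qed.

Let bE i t w : b i t w = G i t w * r i t w.
Proof. by rewrite /b Re_scale dy2 mulr1 Re_backaction_diag /G mulrA. Qed.

Let itoP i : ito_process P F W (fun t w => r i t w) (a i) (b i).
Proof. by have [] := rho_filter i i. Qed.

Let a_cont i : {ae P, forall w, {within [set s : R | 0 <= s], continuous (a i ^~ w)}}.
Proof.
apply: filterS regular => w [rc _ _ Dc _].
apply: (subspace_eq_continuous _ (withinM (Dc i) (rc i))) => s; rewrite inE/= => s0.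
by rewrite /from_subspace /= -aE.
Qed.

Let b_cont i : {ae P, forall w, {within [set s : R | 0 <= s], continuous (b i ^~ w)}}.
Proof.
apply: filterS regular => w [rc _ _ _ Gc].
have -> : b i ^~ w = fun s => G i s w * r i s w by apply/funext => s; exact: bE.
exact: (withinM (Gc i) (rc i)).
Qed.

Let bounded_path (h : R -> R) t : 0 <= t -> {within [set s : R | 0 <= s], continuous h} ->
  exists M, forall s, 0 <= s <= t -> `|h s| <= M.
Proof.
move=> t0 hc; have : {within `[0, t], continuous h}.
  by apply: continuous_subspaceW hc => s /=; rewrite in_itv/= => /andP[].
by move=> /(within_continuous_bounded t0)[M _ hM]; exists M.
Qed.

(** This concerns the diagonal entries other than the n-th: they start at 0, and drift and diffusion
    are multiples of the entry, so 0 is a fixed point. *)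
Let off_diagonal i : i != n -> {ae P, forall w t, 0 <= t -> r i t w = 0}.
Proof.
move=> ni; apply: (ito_unique hF hW (itoP i)) => //.
  by move=> w; rewrite rho0 mxE (negbTE ni).
apply: filterS regular => w [rc _ _ Dc Gc] t t0.
have [C1 h1] := bounded_path t0 (Dc i); have [C2 h2] := bounded_path t0 (Gc i).
exists (Num.max C1 C2) => s st; rewrite subr0.
have s0 : 0 <= s by case/andP: st.
rewrite aE// bE [X in X <= _ /\ _]normrM [X in _ /\ X <= _]normrM.
by split; apply: ler_wpM2r => //; rewrite le_max ?h1 ?h2 ?orbT.
Qed.

Lemma mean_Jz_eigenstate : {ae P, forall w t, 0 <= t -> x t w = level n}.
Proof.
have off : {ae P, forall w, forall i, i != n -> forall t, 0 <= t -> r i t w = 0}.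
  apply: filter_forall => i; have [->|ni] := eqVneq i n; first by apply: aeW.
  by apply: filterS (off_diagonal ni) => w + _.
have xr : {ae P, forall w t, 0 <= t -> x t w = level n * r n t w}.
  apply: filterS off => w h t t0; rewrite mean_JzE (bigD1 n)//= big1 ?addr0// => i ni.
  by rewrite h// mulr0.
(* Once the other entries are gone, level n - x = - level n (r n - 1). Drift and diffusion are then
   multiples of r n - 1, and 1 is a fixed point. *)
have rn : {ae P, forall w t, 0 <= t -> r n t w = 1}.
  apply: (ito_unique hF hW (itoP n)) => //.
    by move=> w; rewrite rho0 mxE eqxx.
  apply: filterS2 regular xr => w [rc tc vc _ _] xw t t0.
  pose l s := 2 * level n * r n s w.
  have lc := withinM (@cst_cont (2 * level n)) (rc n).
  have [C1 h1] := bounded_path t0 (withinM vc lc).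
  have [C2 h2] := bounded_path t0 (withinM tc lc).
  exists (Num.max C1 C2) => s st.
  have s0 : 0 <= s by case/andP: st.
  have -> : a n s w = - (v s w * l s) * (r n s w - 1).
    by rewrite aE// /D xw// /l; ring.
  have -> : b n s w = - (theta s w * l s) * (r n s w - 1).
    by rewrite bE /G xw// /l; ring.
  rewrite [X in X <= _ /\ _]normrM [X in _ /\ X <= _]normrM !normrN.
  by split; apply: ler_wpM2r => //; rewrite le_max ?h1 ?h2 ?orbT.
apply: filterS2 xr rn => w xw rw t t0.
by rewrite xw// rw// mulr1.
Qed.

End eigenstate_filter.

(** * Mean and variance of the adaptive parameter *)

Section moments.
Context {R : realType} {d : measure_display} {T : measurableType d}.
Variable P : probability T R.
Implicit Types X : T -> R.

Lemma L2_Lfun X : L2 P X -> X \in Lfun P 2%:E.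
Proof.
move=> [mX iX]; rewrite inE; apply/andP; split; rewrite inE//=.
rewrite /finite_norm unlock /= poweR_lty//.
under eq_integral do rewrite powR_mulrn// real_normK ?num_real//.
by rewrite L1_fin// ltry.
Qed.

Lemma expectation_Ex X : L1 P X -> 'E_P[X]%E = (Ex P X)%:E.
Proof. by move=> iX; rewrite unlock L1_fin. Qed.

Lemma variance_Ex X : L2 P X -> 'V_P[X]%E = (Ex P (fun w => (X w - Ex P X) ^+ 2))%:E.
Proof.
move=> X2; have X1 := L2_L1 X2.
have [_ i2] := L2B X2 (L2_cst P (Ex P X)).
rewrite /variance unlock (expectation_Ex X1)/=.
rewrite unlock -L1_fin//.
Qed.

End moments.

Lemma limf_esup_le_pinfty {R : realType} (h : R -> \bar R) (c : \bar R) :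
  (\forall t \near +oo%R, (h t <= c)%E) -> (limf_esup h (+oo%R : set_system R) <= c)%E.
Proof.
move=> hc; apply: (@le_trans _ _ (ereal_sup (h @` [set t | (h t <= c)%E]))).
  by apply: ereal_inf_lbound; exists [set t | (h t <= c)%E].
by apply: ge_ereal_sup => _ [t /= ht <-].
Qed.

Section adaptation.
Context {R : realType} {d : measure_display} {T : measurableType d}.
Variables (P : probability T R) (F : R -> set (set T)) (W : R -> T -> R).
Hypotheses (hF : filtration F) (hW : wiener P F W).
Variables (J : nat) (n m : 'I_((2 * J).+1)).
Hypothesis m_neq_J : (m : nat) <> J.
Variables (omega M eta omegah etah K p : R).
Hypothesis K_gt0 : 0 < K.
Variables (u y : R -> T -> R) (rho rhoh : R -> T -> 'M[R[i]]_((2 * J).+1)).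
Variables (thetah : R -> T -> R) (theta0 : R).
Hypothesis sys : adaptive_system P F W omega M eta omegah etah K p u y rho rhoh thetah theta0.
Hypothesis u0 : forall t w, 0 <= t -> u t w = 0.
Hypothesis rho0 : forall w, rho 0 w = pure_state n.
Hypothesis rhoh0 : forall w, rhoh 0 w = pure_state m.
Local Notation theta := (Num.sqrt (eta * M)).
Let B : R := level m.
Let L : R := theta * (level n / level m).
Let E := integrating_factor B (gain_primitive K p).

Let B_neq0 : B != 0.
Proof. by rewrite /B /level subr_eq0 eqr_nat eq_sym; apply/eqP. Qed.

Let theta_cont : continuous_paths P (fun (_ : R) (_ : T) => theta).
Proof. by apply: aeW => w; apply: continuous_subspaceT => s; exact: cst_continuous. Qed.

Let dy_cont : continuous_paths P (output_differential theta rho).1.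
Proof.
apply: filterS (continuous_mean_Jz (true_system sys)) => w xc s.
by apply: cvgMr; exact: xc.
Qed.

Let x_const : {ae P, forall w t, 0 <= t -> mean_Jz (rho t w) = level n}.
Proof. exact: (mean_Jz_eigenstate hF hW (true_system sys) rho0 u0 _ theta_cont dy_cont). Qed.

Let xh_const : {ae P, forall w t, 0 <= t -> mean_Jz (rhoh t w) = level m}.
Proof.
exact: (mean_Jz_eigenstate hF hW (adaptive_model sys) rhoh0 u0 _ (ito_continuous (adaptation sys)) dy_cont).
Qed.

Lemma thetah_moments t : 0 < t ->
  [/\ L2 P (thetah t), Ex P (thetah t) = L + (theta0 - L) / E t
    & Ex P (fun w => (thetah t w - (L + (theta0 - L) / E t)) ^+ 2) =
      sde_variance B (gain K p) (gain_primitive K p) t].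
Proof.
move=> t0; have E0 : 0 < E t by exact: expR_gt0.
have E_neq0 : E t != 0 by rewrite gt_eqF.
have drift : {ae P, forall w s, 0 <= s ->
    gain K p s * (- mean_Jz (rhoh s w) ^+ 2 * thetah s w
      + 2^-1 * mean_Jz (rhoh s w) * (output_differential theta rho).1 s w) =
    - B ^+ 2 * gain K p s * (thetah s w - L)}.
  apply: filterS2 x_const xh_const => w xw xhw s s0.
  by rewrite /= xw// xhw// /L /B; field.
have diffusion : {ae P, forall w s, 0 <= s ->
    gain K p s * (2^-1 * mean_Jz (rhoh s w) * (output_differential theta rho).2 s w) =
    B / 2 * gain K p s}.
  apply: filterS xh_const => w xhw s s0.
  by rewrite /= xhw// /B; field.
have [U2 U_mean U_var] := linear_sde_moments hF hW (adaptation sys) (thetah_init sys)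
  (fun x _ => gain_ge0 K p x) (@continuous_gain _ K p K_gt0) (@is_derive_gain_primitive _ K p K_gt0)
  (gain_primitive0 K p) drift diffusion t0.
set U := (fun w => _ - _) in U2 U_mean U_var.
have thE : thetah t = fun w => (E t)^-1 * U w + (L + (theta0 - L) / E t).
  by apply/funext => w; rewrite /U -/E; field.
have U1 := L1Zl (E t)^-1 (L2_L1 U2).
split.
- by rewrite thE; exact: (L2D (L2Zl _ U2) (L2_cst P _)).
- rewrite thE (ExD U1 (L1_cst P _)) ExZl; last exact: L2_L1.
  by rewrite U_mean mulr0 add0r Ex_cst.
- have -> : (fun w => (thetah t w - (L + (theta0 - L) / E t)) ^+ 2) =
      fun w => (E t)^-2 * U w ^+ 2.
    by apply/funext => w; rewrite thE addrK exprMn exprVn.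
  case: (U2) => _ iU2; rewrite (ExZl _ iU2).
  by rewrite [Ex P _]U_var /sde_variance mulrC.
Qed.

Lemma thetah_Lfun t : 0 <= t -> thetah t \in Lfun P 2%:E.
Proof.
rewrite le_eqVlt => /predU1P[<-|t0]; last by have [/L2_Lfun] := thetah_moments t0.
have -> : thetah 0 = cst theta0 by apply/funext => w; exact: thetah_init sys w.
exact/L2_Lfun/L2_cst.
Qed.

Lemma thetah_expectation t : 0 < t -> 'E_P[thetah t]%E = (L + (theta0 - L) / E t)%:E.
Proof. by move=> t0; have [t2 <- _] := thetah_moments t0; exact/expectation_Ex/L2_L1. Qed.

Lemma thetah_variance t : 0 < t ->
  'V_P[thetah t]%E = (sde_variance B (gain K p) (gain_primitive K p) t)%:E.
Proof.
by move=> t0; have [t2 t1 <-] := thetah_moments t0; rewrite variance_Ex// t1.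
Qed.

End adaptation.

(** Membership in [Lfun P 2%:E] guarantees that the expectations and variances are those of
    square-integrable variables. For p > 1 the function [L] is chosen before the solution, so that
    with the other data fixed the limit is a function of [theta0], and a nonconstant one. *)
Theorem proposition4 (R : realType) (J : nat) (n m : 'I_((2 * J).+1))
  (omega M eta omegah etah K p : R)
  (omega_gt0 : 0 < omega) (M_gt0 : 0 < M) (eta_gt0 : 0 < eta) (eta_le1 : eta <= 1)
  (omegah_gt0 : 0 < omegah) (etah_gt0 : 0 < etah) (etah_le1 : etah <= 1)
  (K_gt0 : 0 < K) (m_neq_J : (m : nat) <> J)
  (d : measure_display) (T : measurableType d) (P : probability T R)
  (F : R -> set (set T)) (W : R -> T -> R)
  (hF : filtration F) (hW : wiener P F W) :
  let theta := Num.sqrt (eta * M) in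
  let solution (theta0 : R) (thetah : R -> T -> R) :=
    exists (u y : R -> T -> R) (rho rhoh : R -> T -> 'M[R[i]]_((2 * J).+1)),
      [/\ adaptive_system P F W omega M eta omegah etah K p
            u y rho rhoh thetah theta0,
          forall t w, 0 <= t -> u t w = 0,
          forall w, rho 0 w = pure_state n
        & forall w, rhoh 0 w = pure_state m] in
  (forall (theta0 : R) (thetah : R -> T -> R), solution theta0 thetah ->
     [/\ forall t, 0 <= t -> thetah t \in Lfun P 2%:E,
         p <= 1 ->
           ('E_P[thetah t])%E @[t --> +oo%R] -->
             (theta * ((J%:R - n%:R) / (J%:R - m%:R)))%:E
       & [/\ 1 < p ->
               (limf_esup (fun t : R => 'V_P[thetah t]) (+oo%R : set_system R) <= (8^-1)%:E)%E,
             0 < p -> p <= 1 -> ('V_P[thetah t])%E @[t --> +oo%R] --> 0%E,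
             p = 0 -> ('V_P[thetah t])%E @[t --> +oo%R] --> (8^-1)%:E
           & p < 0 -> ('V_P[thetah t])%E @[t --> +oo%R] --> +oo%E]])
  /\
  (1 < p -> exists L : R -> R,
     (exists a b : R, L a <> L b) /\
     forall (theta0 : R) (thetah : R -> T -> R), solution theta0 thetah ->
       ('E_P[thetah t])%E @[t --> +oo%R] --> (L theta0)%:E).
Proof.
move=> theta solution.
pose g := gain_primitive K p; pose B : R := level m.
pose E := integrating_factor B g; pose lim0 := theta * (level n / level m).
have B_neq0 : B != 0 by rewrite /B /level subr_eq0 eqr_nat eq_sym; apply/eqP.
have f_ge0 (x : R) : 0 <= x -> 0 <= gain K p x by move=> _; exact: gain_ge0.
have f_cont := @continuous_gain _ K p K_gt0.
have g_der := @is_derive_gain_primitive _ K p K_gt0.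
have Einv : p <= 1 -> (E t)^-1 @[t --> +oo] --> 0.
  by move=> p1; exact: (cvg_integrating_factorV B_neq0 (gain_primitive_pinfty K_gt0 p1)).
have mean theta0 thetah (c : R) : solution theta0 thetah -> (E t)^-1 @[t --> +oo] --> c ->
    ('E_P[thetah t])%E @[t --> +oo%R] --> (lim0 + (theta0 - lim0) * c)%:E.
  move=> [u [y [rho [rhoh [sys u0 rho0 rhoh0]]]]] Ec.
  have : (lim0 + (theta0 - lim0) / E t)%:E @[t --> +oo%R] --> (lim0 + (theta0 - lim0) * c)%:E.
    apply/cvg_EFin; first by apply: nearW.
    by apply: cvgD; [exact: cvg_cst|exact: cvgMr].
  apply: cvg_trans; apply: near_eq_cvg; near=> t.
  rewrite (thetah_expectation hF hW m_neq_J K_gt0 sys u0 rho0 rhoh0)//.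
have var theta0 thetah : solution theta0 thetah ->
    \forall t \near +oo, (sde_variance B (gain K p) g t)%:E = 'V_P[thetah t]%E.
  move=> [u [y [rho [rhoh [sys u0 rho0 rhoh0]]]]]; near=> t.
  apply/esym/(thetah_variance hF hW m_neq_J K_gt0 sys u0 rho0 rhoh0).
  by near: t; apply: nbhs_pinfty_gt; rewrite num_real.
split=> [theta0 thetah sol|p1].
  split.
  - move: sol => [u [y [rho [rhoh [sys u0 rho0 rhoh0]]]]] t.
    exact: (thetah_Lfun hF hW m_neq_J K_gt0 sys u0 rho0 rhoh0).
  - move=> /Einv Einv0.
    by have := mean _ _ _ sol Einv0; rewrite mulr0 addr0.
  - split.
    + move=> p1; apply: limf_esup_le_pinfty.
      apply: filterS2 (var _ _ sol) (nbhs_pinfty_gt (num_real 0)) => t <- t0.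
      rewrite lee_fin; apply: (sde_variance_le_eighth _ f_ge0 f_cont g_der _ (ltW t0)).
      by move=> x x0; apply: gain_le1 => //; exact/ltW/(lt_trans ltr01).
    + move=> p0 p1; apply: (cvg_trans (near_eq_cvg (var _ _ sol))); apply/cvg_EFin; first exact: nearW.
      exact: (cvg_sde_variance0 f_ge0 f_cont g_der (Einv p1) (gain_cvg0 K_gt0 p0)).
    + move=> p0; apply: (cvg_trans (near_eq_cvg (var _ _ sol))); apply/cvg_EFin; first exact: nearW.
      apply: (cvg_sde_variance_eighth f_ge0 f_cont g_der (Einv _)); first by rewrite p0.
      by move=> x _; rewrite /gain p0 oppr0 powRr0.
    + move=> p0; apply: (cvg_trans (near_eq_cvg (var _ _ sol))); apply/cvgeryP.
      apply: (cvg_sde_variance_pinfty f_ge0 f_cont g_der (Einv _) (gain_pinfty K_gt0 p0)).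
      exact: (le_trans (ltW p0)).
(* For p > 1 the integral of the gain converges, so 1 / E t has a positive limit and a fixed
   fraction of the initial error theta0 - lim0 persists. *)
have Einv1 : (E t)^-1 @[t --> +oo] --> (expR (B ^+ 2 * (K * (p - 1))^-1))^-1.
  apply: cvgV; first by rewrite gt_eqF ?expR_gt0.
  have h : B ^+ 2 * g t @[t --> +oo] --> B ^+ 2 * (K * (p - 1))^-1.
    by apply: cvgMr; exact: gain_primitive_cvg.
  exact: (cvg_comp _ _ h (@continuous_expR R _)).
exists (fun theta0 => lim0 + (theta0 - lim0) * (expR (B ^+ 2 * (K * (p - 1))^-1))^-1).
split; last by move=> theta0 thetah sol; exact: mean sol Einv1.
(* Starting from lim0 the limit is lim0; starting from lim0 + 1 it exceeds lim0 by the positive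
   limit of 1 / E t. *)
exists lim0, (lim0 + 1) => /addrI; rewrite subrr mul0r addrC addKr mul1r => /esym/eqP.
by rewrite invr_eq0 gt_eqF ?expR_gt0.
Unshelve. all: by end_near. Qed.
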